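(* Let $(X_n)_{n\ge0}$ be a transient nearest neighbour random walk on the directed cover $\mathcal{T}$ of $G$ with transition data $p_G(i,j)$, $p(-i)$, whose non-zero transition probabilities are bounded away from $0$: there is $\varepsilon_0>0$ with $p(x,y)\ge\varepsilon_0$ for all $x,y\in\mathcal{T}$ with $p(x,y)>0$. Assume that the Markov chain on $G$ with transition matrix $Q=(q(i,j))_{i,j\in G}$, $q(i,j)=\frac{1-F(-j)}{1-F(-i)}\,p(i,j)\,\overline{G}_i(1)$, is positive recurrent, and that the spectral radius of $(X_n)$ is strictly smaller than $1$. Let $\pi_n$ be the distribution of $X_n$ and $h=\lim_{n\to\infty}-\frac1n\mathbb{E}[\log\pi_n(X_n)]$ the asymptotic entropy (which exists). Then $$h=\liminf_{n\to\infty}-\frac{\log\pi_n(X_n)}{n}\quad\text{almost surely.}$$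
   Context: $G$ is a countable directed graph, strongly connected, of bounded geometry (uniformly bounded vertex degrees), without multiple edges; $i_0\in G$. The directed cover $\mathcal{T}$ of $G$ rooted in $i_0$ is the rooted tree with vertices labelled by $\tau:\mathcal{T}\to G$: the root $o$ has label $i_0$, and recursively a vertex with label $i$ has exactly one direct descendant with label $j$ for each edge $(i,j)$ of $G$ and no others. $x^-$ denotes the direct ancestor of $x\neq o$. Given are transition probabilities $p_G(i,j)$ on $G$ (stochastic, with $p_G(i,j)>0$ iff there is an edge from $i$ to $j$) and backward probabilities $p(-i)\in(0,1)$, $i\in G$, such that for some $\varepsilon\in(0,1)$, $\varepsilon<p(-i)<1-\varepsilon$ for all $i$. Put $p(i,j)=(1-p(-i))p_G(i,j)$. A loop is added at the root. The random walk $(X_n)$ on $\mathcal{T}$ starts at $o$ and has transition probabilities $p(x,y)=p(\tau(x),\tau(y))$ if $y^-=x$; $p(x,x^-)=p(-\tau(x))$ for $x\ne o$; $p(o,o)=p(-i_0)$; and $0$ otherwise. For $i\in G$ and any $x\in\mathcal{T}\setminus\{o\}$ with $\tau(x)=i$ (the choice is irrelevant), $F(-i)=\mathbb{P}[\exists n:\ X_n=x^-\mid X_0=x]$ and $\overline{G}_i(1)=\sum_{n\ge0}\mathbb{P}[X_n=x,\ X_m\neq x^-\ \forall m<n\mid X_0=x]$. The spectral radius of $(X_n)$ is $1/R$, where $R$ is the radius of convergence of $G(o,o|z)=\sum_{n\ge0}\mathbb{P}[X_n=o\mid X_0=o]z^n$. *)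

(* Defs.v *)
From HB Require Import structures.
From mathcomp Require Import all_boot all_order all_algebra.
From mathcomp Require Import all_classical all_reals all_analysis.

Set Implicit Arguments.
Unset Strict Implicit.
Unset Printing Implicit Defensive.

Import Order.TTheory GRing.Theory Num.Theory.
Import numFieldNormedType.Exports.

Local Open Scope classical_set_scope.
Local Open Scope ring_scope.

(* A directed graph without multiple edges is its adjacency relation; loops
   are allowed. *)
Section Graph.
Context (G : countType) (edge : rel G).

Definition strongly_connected :=
  forall i j : G, exists2 s : seq G, path edge i s & last i s = j.

(* Both the out-degrees and the in-degrees are uniformly bounded. *)
Definition bounded_geometry :=
  exists D : nat, forall i : G,
    ([set j | edge i j] #<= `I_D)%card /\ ([set j | edge j i] #<= `I_D)%card.

End Graph.

(* The vertex of the directed cover reached from the root through the labels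
   j1, ..., jn is the sequence [:: j1; ...; jn]: the vertices are exactly the
   finite directed paths of the graph that start at i0. *)
Section DirectedCover.
Context (G : countType) (edge : rel G) (i0 : G).

Definition dcover := {s : seq G | path edge i0 s}.
HB.instance Definition _ := Countable.on dcover.

Definition dc_root : dcover := exist _ [::] isT.

Definition dc_label (x : dcover) : G := last i0 (val x).

(* Drops the last label; meaningful only away from the root, which it fixes. *)
Definition dc_anc (x : dcover) : dcover :=
  exist _ (take (size (val x)).-1 (val x)) (take_path _ (valP x)).

End DirectedCover.

Arguments dc_root {G edge i0}.

Section TransitionData.
Context (R : realType) (G : countType) (edge : rel G) (i0 : G).
Context (pG : G -> G -> R) (pb : G -> R).

Definition graph_transitions :=
  [/\ forall i j, 0 <= pG i j,
      forall i j, 0 < pG i j <-> edge i j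
    & forall i, (\esum_(j in [set: G]) (pG i j)%:E = 1)%E].

Definition backward_probabilities :=
  (forall i, 0 < pb i < 1) /\
  exists eps : R, 0 < eps < 1 /\ forall i, eps < pb i < 1 - eps.

Definition pfwd (i j : G) : R := (1 - pb i) * pG i j.

Definition ptree (x y : dcover edge i0) : R :=
  if (y != dc_root) && (dc_anc y == x) then pfwd (dc_label x) (dc_label y)
  else if (x != dc_root) && (y == dc_anc x) then pb (dc_label x)
  else if (x == dc_root) && (y == dc_root) then pb i0
  else 0.

End TransitionData.

Section MarkovChain.
Context (R : realType) (S : countType) (d : measure_display)
  (W : measurableType d).

(* Under P x, the process X is a Markov chain with transition probabilities p
   started at x, so that P x is the conditional law given X_0 = x. *)
Definition markov_family (p : S -> S -> R) (P : S -> probability W R)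
    (X : nat -> W -> S) :=
  [/\ forall n y, measurable [set w | X n w = y],
      forall x, P x [set w | X 0%N w = x] = 1%E
    & forall x n (s : nat -> S) y,
        P x [set w | (forall k, (k <= n)%N -> X k w = s k) /\ X n.+1 w = y] =
        (P x [set w | forall k, (k <= n)%N -> X k w = s k]
         * (p (s n) y)%:E)%E].

Context (P : S -> probability W R) (X : nat -> W -> S).

Definition transient :=
  forall x, (P x [set w | exists n, X n.+1 w = x] < 1)%E.

Definition law (x : S) (n : nat) (y : S) : R :=
  fine (P x [set w | X n w = y]).

End MarkovChain.

Section SpectralRadius.
Context (R : realType).
Local Open Scope ereal_scope.

Definition convergence_radius (a : nat -> R) : \bar R :=
  ereal_sup [set (`|z|%R)%:E | z in [set z : R | cvgn (pseries a z)]].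

Definition spectral_radius (S : countType) (d : measure_display)
    (W : measurableType d) (P : S -> probability W R) (X : nat -> W -> S)
    (o : S) : \bar R :=
  (convergence_radius (fun n => law P X o n o))^-1.

End SpectralRadius.

Section PositiveRecurrence.
Context (R : realType) (S : countType) (q : S -> S -> R).
Local Open Scope ereal_scope.

(* The probability, starting at i, that the first visit to j at a positive
   time takes place at time n + 1. *)
Fixpoint first_passage (n : nat) (i j : S) : \bar R :=
  if n is m.+1 then \esum_(k in [set~ j]) ((q i k)%:E * first_passage m k j)
  else (q i j)%:E.

Definition positive_recurrent :=
  forall i, \sum_(0 <= n <oo) first_passage n i i = 1 /\
            \sum_(0 <= n <oo) (n.+1%:R%:E * first_passage n i i) < +oo.

End PositiveRecurrence.

Section LastExitChain.
Context (R : realType) (G : countType) (edge : rel G) (i0 : G).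
Context (pG : G -> G -> R) (pb : G -> R).
Context (d : measure_display) (W : measurableType d).
Let T := dcover edge i0.
Context (P : T -> probability W R) (X : nat -> W -> T).

(* Some non-root vertex with label i; one exists if the graph is strongly
   connected and every vertex has an outgoing edge, and under
   [markov_family (ptree pG pb) P X] the quantities below do not depend on the
   choice. *)
Definition some_vertex (i : G) : T :=
  xget dc_root [set x : T | x <> dc_root /\ dc_label x = i].

Definition Fback (i : G) : R :=
  let x := some_vertex i in
  fine (P x [set w | exists n, X n w = dc_anc x]).

(* The series is at most 1 / p(-i): every visit to x is followed by a step to
   the ancestor of x with probability p(-i). *)
Definition Gbar (i : G) : R :=
  let x := some_vertex i in
  fine (\sum_(0 <= n <oo)
    P x [set w | X n w = x /\ forall m, (m < n)%N -> X m w <> dc_anc x])%E.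

Definition Qmat (i j : G) : R :=
  (1 - Fback j) / (1 - Fback i) * pfwd pG pb i j * Gbar i.

End LastExitChain.

(* Main.v *)
(* Let [Goo] be the Green function at the root. By spectral radius < 1 the walk
   escapes, and its last exits from the successive vertices of its limit ray
   code the path by a sequence of pairs (label, time between two last exits) whose
   law is given by products of one-step weights. Summed over the times these
   weights are [p(i,j) * Gbar_j], and conjugating by the function
   [(1 - F(-i)) / Gbar_i] gives the matrix [Q]. Positive recurrence of [Q] cuts
   that sequence into i.i.d. cycles of finite mean duration, so that the strong law
   (derived from the maximal ergodic inequality) yields a constant [h] with
   [Y(X_n) / n --> h] almost surely, where
   [Y(x) = - \sum log (p(i,j) * Gbar_j)] along the path from the root to [x]. The
   Green function is [G(o,x) = Goo * exp(- Y(x))].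

   Now compare [- log pi_n(X_n)] with [Y(X_n)]. From below,
   [pi_n(x) <= G(o,x)]. From above, [G(o,x) <= 2 \sum_(m < K n) pi_m(x)] for
   [|x| <= n], because the tail of the series is exponentially small; therefore
   [E[G(o,X_n) / pi_n(X_n)] <= 2 K n], and since [log t <= t] the difference
   [- log pi_n(X_n) - Y(X_n)] has mean [O(log n)]. Hence the means divided by [n]
   converge to [h] as well, and Fatou's lemma, applied to the nonnegative
   difference divided by [n], gives [liminf = 0] almost surely. *)

Require Import Defs.
From HB Require Import structures.
From mathcomp Require Import all_boot all_order all_algebra.
From mathcomp Require Import all_classical all_reals all_analysis.
From mathcomp Require Import measurable_realfun zify ring lra.

Set Implicit Arguments.
Unset Strict Implicit.
Unset Printing Implicit Defensive.

Import Order.TTheory GRing.Theory Num.Theory.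
Import numFieldNormedType.Exports.

Local Open Scope classical_set_scope.
Local Open Scope ring_scope.

(** The laws pi_n have no product structure of their own; last exits supply one, because the future
    after a last exit stays in a cone, and cones over equal labels are isomorphic. Only the loop at
    the root breaks this symmetry: excursions are therefore compared at non-root vertices, whereas
    escape events, which never use the loop, are compared at all vertices. The step after a last
    exit at label i enters a child of label j, and the next excursion takes place at that child;
    this is why the weights carry Gbar_j where Q carries Gbar_i, and why Gbar enters the conjugating
    function.

    The spectral radius is used through a single rate r < 1 valid at every vertex. It bounds Gbar
    and the mean excursion lengths uniformly, and it makes the tail of G(o,x) beyond time K n
    negligible against eps^|x|, a lower bound of G(o,x).

    The comparison of - log pi_n(X_n) with Y(X_n) is controlled only in mean. After division by n
    the difference tends to 0 in L^1, which yields an almost sure liminf but not an almost sure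
    limit. *)

(** * Countable sums, discrete measurability and path space *)

Lemma esum_pickle (R : realType) (U : countType) (a : U -> \bar R) :
  (forall u, 0 <= a u)%E ->
  (\esum_(u in setT) a u = \sum_(n <oo) oapp a 0 (pickle_inv n))%E.
Proof.
move=> a0; rewrite nneseries_esumT; last by move=> n; case: pickle_inv.
rewrite (esumID (range (@pickle U))); last by move=> n _; case: pickle_inv.
rewrite [X in (_ + X)%E]esum1 ?adde0; last first.
  move=> n [_ /= nr]; case E : (pickle_inv n) => [u|]//; exfalso; apply: nr.
  by exists u => //; have := @pickle_invK U n; rewrite E.
rewrite setTI esum_image; last by move=> u v _ _ /(pcan_inj pickleK).
by apply: eq_esum => u _; rewrite pickleK_inv.
Qed.

Section DiscreteMeasurability.
Context (d : measure_display) (W : measurableType d).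

(* Measurability for the discrete sigma-algebra on [U]. *)
Definition dmeas (U : Type) (f : W -> U) :=
  forall A : set U, measurable (f @^-1` A).

Lemma dmeas_fibers (U : countType) (f : W -> U) :
  (forall u, measurable [set w | f w = u]) -> dmeas f.
Proof.
move=> mf A.
have -> : f @^-1` A = \bigcup_(u in A) [set w | f w = u].
  apply/seteqP; split => [w Aw|w [u Au /= fu]].
    by exists (f w).
  by rewrite /preimage /= fu.
rewrite bigcup_mkcond; apply: countable_bigcupT_measurable => // u.
by case: ifPn.
Qed.

Lemma dmeas_comp (U V : Type) (f : W -> U) (g : U -> V) :
  dmeas f -> dmeas (g \o f).
Proof. by move=> mf A; rewrite comp_preimage; exact: mf. Qed.

Lemma dmeas_pair (U V : countType) (f : W -> U) (g : W -> V) :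
  dmeas f -> dmeas g -> dmeas (fun w => (f w, g w)).
Proof.
move=> mf mg; apply: dmeas_fibers => -[u v].
have -> : [set w | (f w, g w) = (u, v)] = f @^-1` [set u] `&` g @^-1` [set v].
  by apply/seteqP; split => [w /= [-> ->]|w /= [-> ->]].
by apply: measurableI; [exact: mf|exact: mg].
Qed.

Lemma dmeas_mkseq (U : countType) (f : nat -> W -> U) n :
  (forall k, dmeas (f k)) -> dmeas (fun w => mkseq (f ^~ w) n).
Proof.
move=> mf; elim: n => [|n IHn].
  by move=> A; rewrite [X in measurable X](preimage_cst [::] A); case: ifPn.
have -> : (fun w => mkseq (f ^~ w) n.+1) =
    (fun p => rcons p.1 p.2) \o (fun w => (mkseq (f ^~ w) n, f n w)).
  apply/funext => w; rewrite /= /mkseq -addn1 iotaD map_cat /= cats1.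
  by rewrite add0n.
exact/dmeas_comp/dmeas_pair.
Qed.

Lemma dmeas_measurable_fun (U : Type) d' (V : measurableType d')
    (f : W -> U) (g : U -> V) : dmeas f -> measurable_fun setT (g \o f).
Proof. by move=> mf _ B mB; rewrite setTI comp_preimage; exact: mf. Qed.

Lemma measure_fibers (R : realType) (mu : {measure set W -> \bar R})
    (U : countType) (f : W -> U) (D : set W) (A : set U) :
  measurable D -> dmeas f ->
  mu (D `&` f @^-1` A) = (\esum_(u in A) mu (D `&` [set w | f w = u]))%E.
Proof.
move=> mD mf; rewrite esum_mkcond.
pose F u := if u \in A then D `&` [set w | f w = u] else set0.
pose G n := oapp F set0 (pickle_inv n).
have mF u : measurable (F u).
  by rewrite /F; case: ifPn => // _; apply: measurableI => //; exact: (mf [set u]).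
have mG n : measurable (G n) by rewrite /G; case: pickle_inv => //=.
have -> : D `&` f @^-1` A = \bigcup_n G n.
  apply/seteqP; split => [w [Dw Aw]|w [n _]].
    exists (pickle (f w)) => //; rewrite /G pickleK_inv /= /F ifT//.
    exact: mem_set.
  rewrite /G; case: pickle_inv => //= u; rewrite /F; case: ifPn => // /set_mem Au.
  by move=> [Dw /= fu]; split => //; rewrite /preimage /= fu.
rewrite measure_semi_bigcup//; last 2 first.
- apply/trivIsetP => i j _ _ ij; apply/seteqP; split => // w [].
  rewrite /G; have := @pickle_invK U i; have := @pickle_invK U j.
  case: pickle_inv => [u|]//=; case: pickle_inv => [v|]//= uj vi.
  rewrite /F; case: ifPn => // _ [_ /= fv]; case: ifPn => // _ [_ /= fu].
  by move: ij; rewrite -uj -vi -fu -fv eqxx.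
- exact: bigcupT_measurable.
rewrite esum_pickle; last by move=> u; case: ifPn.
apply: eq_eseriesr => n _; rewrite /G; case: pickle_inv => [u|] /=; last exact: measure0.
by rewrite /F; case: ifPn => _; rewrite ?measure0.
Qed.

End DiscreteMeasurability.

Section PathSpace.
Context (U : countType) (u0 : U).

(* The base point [u0] only serves to make the type pointed. *)
Definition pathspace : Type := let _ := u0 in nat -> U.

HB.instance Definition _ := gen_eqMixin pathspace.
HB.instance Definition _ := gen_choiceMixin pathspace.
HB.instance Definition _ := isPointed.Build pathspace (fun=> u0).

Definition cyl n (g : nat -> U) : set pathspace :=
  [set f | forall k, (k < n)%N -> f k = g k].

(** The empty set is included to make the family closed under intersection, since two incompatible
    cylinders are disjoint; uniqueness of measures needs a pi-system. *)
Definition cylinders : set (set pathspace) :=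
  [set A | A = set0 \/ exists n g, A = cyl n g].

HB.instance Definition _ := @isMeasurable.Build (sigma_display cylinders)
  pathspace <<s cylinders >> (@sigma_algebra0 _ setT cylinders)
  (@sigma_algebraC _ cylinders) (@sigma_algebra_bigcup _ setT cylinders).

Lemma cyl_measurable n g : measurable (cyl n g).
Proof. by apply: sub_sigma_algebra; right; exists n, g. Qed.

Lemma cyl0 g : cyl 0 g = setT.
Proof. by apply/seteqP; split. Qed.

Lemma cylinders_setI : setI_closed cylinders.
Proof.
have H n m g g' : (n <= m)%N -> cylinders (cyl n g `&` cyl m g').
  move=> nm; have [gg'|] := pselect (forall k, (k < n)%N -> g k = g' k).
    right; exists m, g'; apply/seteqP; split => [f []//|f fg']; split => // k kn.
    by rewrite gg'// fg'// (leq_trans kn).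
  move=> ngg'; left; apply/seteqP; split => // f [fg fg']; apply: ngg' => k kn.
  by rewrite -fg// fg'// (leq_trans kn).
move=> A B [->|[n [g ->]]]; first by rewrite set0I; left.
case=> [->|[m [g' ->]]]; first by rewrite setI0; left.
by case/orP: (leq_total n m) => nm; [|rewrite setIC]; exact: H.
Qed.

Lemma dmeas_coord n : dmeas (fun f : pathspace => f n).
Proof.
apply: dmeas_fibers => u.
have -> : [set f : pathspace | f n = u] =
    \bigcup_(s in [set s : seq U | nth u0 s n = u]) cyl n.+1 (nth u0 s).
  apply/seteqP; split => [f fnu|f [s /= <-]]; last exact.
  exists (mkseq f n.+1) => [|k kn]; first by rewrite /= nth_mkseq.
  by rewrite nth_mkseq.
rewrite bigcup_mkcond; apply: countable_bigcupT_measurable => // s.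
by case: ifPn => // _; exact: cyl_measurable.
Qed.

Lemma path_measurable_fun d (W : measurableType d) (phi : W -> pathspace) :
  (forall n, dmeas (phi ^~ n)) -> measurable_fun setT phi.
Proof.
move=> mphi; apply: (measurability cylinders) => //.
move=> _ [B [->|[n [g ->]]] <-]; first by rewrite preimage_set0 setI0.
rewrite setTI.
have -> : phi @^-1` cyl n g = \bigcap_(k in `I_n) phi ^~ k @^-1` [set g k].
  by apply/seteqP; split.
by apply: bigcap_measurableType => k _; exact: mphi.
Qed.

(** Uniqueness of measures on a pi-system, for restricted and rescaled image measures: with [D1] a
    cylinder and [c] its mass, agreement on cylinders becomes the Markov property for all measurable
    futures. *)
Lemma path_measure_unique (R : realType) d1 d2 (W1 : measurableType d1)
    (W2 : measurableType d2) (mu1 : {measure set W1 -> \bar R})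
    (mu2 : {measure set W2 -> \bar R}) (D1 : set W1) (D2 : set W2)
    (phi1 : W1 -> pathspace) (phi2 : W2 -> pathspace) (c : R) :
  0 <= c -> measurable D1 -> measurable D2 ->
  (forall n, dmeas (phi1 ^~ n)) -> (forall n, dmeas (phi2 ^~ n)) ->
  (mu1 D1 < +oo)%E ->
  (forall n g, mu1 (D1 `&` phi1 @^-1` cyl n g) =
               c%:E * mu2 (D2 `&` phi2 @^-1` cyl n g))%E ->
  forall B, measurable B ->
  mu1 (D1 `&` phi1 @^-1` B) = (c%:E * mu2 (D2 `&` phi2 @^-1` B))%E.
Proof.
move=> c0 mD1 mD2 /path_measurable_fun m1 /path_measurable_fun m2 fin1 E B mB.
pose nu1_ : {measure set pathspace -> \bar R} := pushforward (mrestr mu1 mD1) phi1.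
pose nu2_ : {measure set pathspace -> \bar R} :=
  mscale (NngNum c0) (pushforward (mrestr mu2 mD2) phi2).
pose nu1 := nu1_ m1; pose nu2 := nu2_ m2.
have -> : mu1 (D1 `&` phi1 @^-1` B) = nu1 B.
  by rewrite /nu1 /= /pushforward /mrestr setIC.
have -> : (c%:E * mu2 (D2 `&` phi2 @^-1` B))%E = nu2 B.
  by rewrite /nu2 /= /mscale /pushforward /mrestr setIC.
apply: (measure_unique cylinders (fun=> setT)) => //.
- exact: cylinders_setI.
- by move=> _; right; exists 0%N, (fun=> u0); rewrite cyl0.
- by rewrite bigcup_const.
- move=> A [->|[n [g ->]]]; first by rewrite !measure0.
  by have := E n g; rewrite [D1 `&` _]setIC [D2 `&` _]setIC.
- by move=> _; rewrite /nu1 /= /pushforward /mrestr preimage_setT setTI.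
Qed.

End PathSpace.
Arguments cyl {U}.

(** * Maximal ergodic inequality and strong law *)

Section MaximalErgodic.
Context (R : realType) (d : measure_display) (W : measurableType d).
Context (P : probability W R) (th : W -> W) (mth : measurable_fun setT th).
Hypothesis thP : forall B, measurable B -> P (th @^-1` B) = P B.

(** The maximum of the Birkhoff sums of lengths 0 to n along [th]. The recursive form is the
    identity on which the proof of the maximal inequality rests. *)
Fixpoint maxS (f : W -> R) (n : nat) (w : W) : R :=
  if n is m.+1 then Num.max 0 (f w + maxS f m (th w)) else 0.

Lemma maxS_ge0 f n w : 0 <= maxS f n w.
Proof. by case: n => [|n] //=; rewrite le_max lexx. Qed.

Lemma maxS_leS f n w : maxS f n w <= maxS f n.+1 w.
Proof.
elim: n w => [|n IHn] w; first exact: maxS_ge0.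
rewrite [X in X <= _]/= [X in _ <= X]/=.
by rewrite ge_max !le_max lexx /= lerD2l IHn orbT.
Qed.

Lemma maxS_homo f w : {homo maxS f ^~ w : m n / (m <= n)%N >-> m <= n}.
Proof. by apply: homo_leq => // [x y z|n]; [exact: le_trans|exact: maxS_leS]. Qed.

Lemma measurable_maxS f n : measurable_fun setT f ->
  measurable_fun setT (maxS f n).
Proof.
move=> mf; elim: n => [|n IHn]; first exact: measurable_cst.
apply: measurable_maxr => //; apply: measurable_funD => //.
exact: measurableT_comp IHn mth.
Qed.

Lemma ge0_integral_invariant (D : set W) (g : W -> \bar R) : measurable D ->
  measurable_fun setT g -> (forall x, 0 <= g x)%E ->
  (\int[P]_(x in th @^-1` D) g (th x) = \int[P]_(x in D) g x)%E.
Proof.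
move=> mD mg g0.
rewrite -[LHS](ge0_integral_pushforward mth) //; last exact: measurable_funTS.
by apply: eq_measure_integral => A mA _; exact: thP.
Qed.

Lemma integrable_maxS f n : P.-integrable setT (EFin \o f) ->
  P.-integrable setT (EFin \o maxS f n).
Proof.
move=> intf; have /measurable_EFinP mf := measurable_int _ intf.
elim: n => [|n IHn]; first exact: integrable0.
have mS k := measurable_maxS k mf.
have IHth : P.-integrable setT (EFin \o (maxS f n \o th)).
  apply/integrableP; split; first exact/measurable_EFinP/measurableT_comp.
  have -> : (\int[P]_x `|(EFin \o (maxS f n \o th)) x| =
             \int[P]_(x in th @^-1` setT) `|(maxS f n (th x))%:E|)%E.
    by rewrite preimage_setT.
  rewrite (@ge0_integral_invariant setT (fun x => `|(maxS f n x)%:E|%E))//.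
    by case/integrableP : IHn.
  by apply: measurableT_comp => //; exact/measurable_EFinP.
have := integrableD measurableT intf IHth.
apply: le_integrable => //; first exact/measurable_EFinP.
move=> w _ /=; rewrite lee_fin ger0_norm ?le_max ?lexx//.
by rewrite ge_max normr_ge0 /= ler_norm.
Qed.

(** Garsia's argument, localised to an invariant set. Let [F n] be [f] cut off to the set where
    [maxS f n.+1] is positive. The recursion gives [maxS f n.+1 <= F n + maxS f n \o th];
    integrating over [D], with invariance and monotonicity in n, yields a nonnegative integral of
    [F n]. By dominated convergence [F n] can be replaced by [f]. *)
Lemma maximal_ergodic f (D : set W) : P.-integrable setT (EFin \o f) ->
  measurable D -> th @^-1` D = D ->
  (forall w, D w -> exists n, 0 < maxS f n w) ->
  (0 <= \int[P]_(x in D) (f x)%:E)%E.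
Proof.
move=> intf mD Dth Dpos; have /measurable_EFinP mf := measurable_int _ intf.
have mS k := measurable_maxS k mf.
pose F n := fun x => if 0 < maxS f n.+1 x then f x else 0.
have mF n : measurable_fun setT (F n).
  by apply: measurable_fun_ifT => //; exact: measurable_fun_ltr.
have leF n x : `|F n x| <= `|f x|.
  by rewrite /F; case: ifP; rewrite ?normr0.
have intD g : P.-integrable setT (EFin \o g) -> P.-integrable D (EFin \o g).
  exact: integrableS.
have intF n : P.-integrable D (EFin \o F n).
  apply: le_integrable (intD _ intf) => //; last by move=> w _ /=; rewrite lee_fin.
  exact/measurable_EFinP/measurable_funTS.
have F0 n : (0 <= \int[P]_(x in D) (F n x)%:E)%E.
  have intSth : P.-integrable D (EFin \o (maxS f n \o th)).
    apply/integrableP; split.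
      by apply/measurable_EFinP/measurable_funTS; exact: measurableT_comp.
    have := ge0_integral_invariant (g := fun x => `|(maxS f n x)%:E|%E) mD.
    rewrite Dth => ->//.
      by case/integrableP : (intD _ (integrable_maxS n intf)).
    by apply: measurableT_comp => //; exact/measurable_EFinP.
  have : (\int[P]_(x in D) (maxS f n.+1 x)%:E <=
      \int[P]_(x in D) ((F n x)%:E + (maxS f n (th x))%:E))%E.
    apply: le_integral => //; first exact: (intD _ (integrable_maxS n.+1 intf)).
      exact: (integrableD _ (intF n) intSth).
    move=> x _ /=; rewrite -EFinD lee_fin /F /=.
    case: ifP => [h|/negbT]; last first.
      by rewrite -leNgt => h; rewrite (le_trans h)// add0r maxS_ge0.
    by move: h; rewrite lt_max ltxx /= => /ltW /max_r ->.
  rewrite (integralD mD (intF n) intSth).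
  have := ge0_integral_invariant (g := EFin \o maxS f n) mD.
  rewrite Dth => /= ->; first last.
  - by move=> x; rewrite lee_fin maxS_ge0.
  - exact/measurable_EFinP.
  have : (\int[P]_(x in D) (maxS f n x)%:E <= \int[P]_(x in D) (maxS f n.+1 x)%:E)%E.
    apply: le_integral => //; [exact: (intD _ (integrable_maxS n intf))|
      exact: (intD _ (integrable_maxS n.+1 intf))|].
    by move=> x _; rewrite lee_fin maxS_leS.
  move=> h1 /(le_trans h1).
  rewrite -[leLHS]add0e leeD2rE//.
  exact: integrable_fin_num (intD _ (integrable_maxS n intf)).
have cF : {ae P, forall x, D x -> (EFin \o F n) x @[n --> \oo] --> (f x)%:E}.
  apply: aeW => w Dw; have [n0 n0P] := Dpos w Dw.
  apply: (@cvg_near_cst _ _ _ (fun n => (EFin \o F n) w) \oo); exists n0 => // n /= n0n.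
  rewrite /= /F ifT// (lt_le_trans n0P)//; apply: maxS_homo.
  exact: leqW.
have bF : {ae P, forall x n, D x -> (`|(EFin \o F n) x| <= `|(f x)%:E|)%E}.
  by apply: aeW => w n _; rewrite lee_fin.
have [_ _ h] := dominated_convergence mD
  (fun n => measurable_funTS (iffRL (measurable_EFinP _ _) (mF n)))
  (measurable_int _ (intD _ intf)) cF (integrable_abse (intD _ intf)) bF.
apply: (cvge_to_ge h); apply: nearW => n; exact: F0.
Qed.

(** Unlike the positivity of a single [maxS f n], unboundedness of the whole sequence is unaffected
    by dropping the first term, so this set can serve as the invariant set of the maximal
    inequality. *)
Let diverge (f : W -> R) := [set w | forall k : nat, exists n, k%:R < maxS f n w].

Lemma measurable_diverge f : measurable_fun setT f -> measurable (diverge f).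
Proof.
move=> mf.
have -> : diverge f = \bigcap_k \bigcup_n [set w | k%:R < maxS f n w].
  apply/seteqP; split => [w h k _|w h k]; first by have [n] := h k; exists n.
  by have [n] := h k I; exists n.
apply: bigcapT_measurable => k; apply: bigcupT_measurable => n.
rewrite -[X in measurable X]setTI.
exact: (@measurable_fun_ltr _ _ _ setT (cst k%:R) (maxS f n) (measurable_cst _)
  (measurable_maxS n mf) measurableT [set true]).
Qed.

Lemma diverge_invariant f : th @^-1` diverge f = diverge f.
Proof.
apply/seteqP; split => w h k.
  have [n] := h (Num.bound `|k%:R - f w|).
  have := archi_boundP (normr_ge0 (k%:R - f w)) => mP nP; exists n.+1 => /=.
  rewrite lt_max; apply/orP; right.
  rewrite addrC -ltrBlDr (le_lt_trans _ nP)// (le_trans (ler_norm _))//.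
  exact: ltW.
have m0 : 0 <= `|f w| + k%:R by rewrite addr_ge0.
have [n] := h (Num.bound (`|f w| + k%:R)); have := archi_boundP m0.
case: n => [|n] mP /=; first by rewrite ltNge ltW// (le_lt_trans _ mP).
rewrite lt_max => /orP[|nP]; first by rewrite ltNge ltW// (le_lt_trans _ mP).
exists n; rewrite -(ltrD2l (f w)) (le_lt_trans _ nP)// (le_trans _ (ltW mP))//.
by rewrite lerD2r ler_norm.
Qed.

(** On the invariant set [diverge f] the maximal inequality makes the integral of [f] nonnegative,
    while the product formula makes it negative unless the set is null. The product formula takes
    the place of ergodicity: it asks only that [f] be uncorrelated with invariant sets. *)
Lemma ae_maxS_bounded f : P.-integrable setT (EFin \o f) ->
  (forall D, measurable D -> th @^-1` D = D ->
    \int[P]_(x in D) (f x)%:E = P D * \int[P]_x (f x)%:E)%E ->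
  (\int[P]_x (f x)%:E < 0)%E ->
  {ae P, forall w, exists k : nat, forall n, maxS f n w <= k%:R}.
Proof.
move=> intf mixf f0; have /measurable_EFinP mf := measurable_int _ intf.
have mD := measurable_diverge mf.
exists (diverge f); split => //; last first.
  move=> w /= h k; apply: contrapT => h'; apply: h; exists k => n.
  by rewrite leNgt; apply/negP => h; apply: h'; exists n.
have := maximal_ergodic intf mD (diverge_invariant f).
rewrite mixf//; last exact: diverge_invariant.
have pos w : diverge f w -> exists n, 0 < maxS f n w by move=> /(_ 0%N).
move=> /(_ pos) h.
apply/eqP; rewrite eq_le measure_ge0 andbT leNgt; apply/negP => PD0.
by move: h; rewrite leNgt mule_gt0_lt0.
Qed.

Lemma maxS_sum f n w : \sum_(i < n) f (iter i th w) <= maxS f n w.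
Proof.
elim: n w => [|n IHn] w; first by rewrite big_ord0.
rewrite big_ord_recl /= le_max; apply/orP; right; rewrite lerD2l.
by under eq_bigr do rewrite -iterS iterSr.
Qed.

(** The functions [a * f - (a * c + 1/(m+1))] with [a = 1] and [a = -1] have mean [- 1/(m+1)], so
    their Birkhoff sums are almost surely bounded above. Division by n pinches the averages of [f]
    between [c - 1/(m+1)] and [c + 1/(m+1)] in the limit. *)
Lemma strong_law f : P.-integrable setT (EFin \o f) ->
  (forall D, measurable D -> th @^-1` D = D ->
    \int[P]_(x in D) (f x)%:E = P D * \int[P]_x (f x)%:E)%E ->
  {ae P, forall w, (fun n : nat => n%:R^-1 * \sum_(i < n) f (iter i th w))
     @ \oo --> fine (\int[P]_x (f x)%:E)}.
Proof.
move=> intf mixf; set c := fine _.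
have cE : (\int[P]_x (f x)%:E)%E = c%:E.
  by rewrite /c fineK//; exact: integrable_fin_num intf.
have bnd (a : R) (m : nat) : {ae P, forall w, exists k : nat, forall n,
    maxS (fun x => a * f x - (a * c + m.+1%:R^-1)) n w <= k%:R}.
  set b := a * c + _.
  have int1 : P.-integrable setT (EFin \o (fun x => a * f x)).
    by have := integrableZl measurableT a intf.
  have int2 : P.-integrable setT (EFin \o (fun=> b)).
    by apply: finite_measure_integrable_cst.
  have intg D : measurable D -> th @^-1` D = D ->
      (\int[P]_(x in D) (a * f x - b)%:E = P D * (a * c - b)%:E)%E.
    move=> mD Dth; have intD g : P.-integrable setT (EFin \o g) ->
      P.-integrable D (EFin \o g) by exact: integrableS.
    have -> : (\int[P]_(x in D) (a * f x - b)%:E =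
        a%:E * (P D * c%:E) - b%:E * P D)%E.
      have := integralB mD (intD _ int1) (intD _ int2).
      have /= -> := integralZl mD (intD _ intf) a.
      by rewrite /= integral_cst// mixf//= cE.
    rewrite -[P D]fineK ?fin_num_measure//.
    by rewrite -!EFinM -EFinB; congr EFin; ring.
  apply: ae_maxS_bounded.
  - by have := integrableB measurableT int1 int2.
  - move=> D mD Dth; rewrite !intg//.
    by rewrite probability_setT mul1e.
  - rewrite intg// probability_setT mul1e lte_fin /b.
    by rewrite opprD addrA subrr add0r oppr_lt0 invr_gt0.
have {bnd} B a : {ae P, forall w m, exists k : nat, forall n,
    maxS (fun x => a * f x - (a * c + m.+1%:R^-1)) n w <= k%:R}.
  exact/ae_foralln.
have := B 1; have := B (-1); apply: filterS2 => w Bm Bp.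
have sumE (a b : R) n : \sum_(i < n) (a * f (iter i th w) - b) =
    a * \sum_(i < n) f (iter i th w) - n%:R * b.
  by rewrite sumrB -mulr_sumr sumr_const card_ord mulr_natl.
apply/cvgrPdist_le => e e0.
have [m mP] : exists m : nat, m.+1%:R^-1 <= e / 2.
  exists (Num.bound (2 / e)); rewrite -(invrK (e / 2)) lef_pV2 ?posrE ?invr_gt0 ?divr_gt0//.
  have e2 : 0 <= 2 / e by rewrite divr_ge0// ltW.
  rewrite invf_div (le_trans (ltW (archi_boundP e2)))// ler_nat; exact: leqnSn.
have [k1 k1P] := Bp m; have [k2 k2P] := Bm m.
near=> n.
have n0 : 0 < n%:R :> R by near: n; exists 1%N => // j /=; rewrite ltr0n.
have nk : k1%:R + k2%:R <= n%:R * (e / 2).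
  rewrite -ler_pdivrMr ?divr_gt0//.
  have : 0 <= (k1%:R + k2%:R) / (e / 2) by rewrite divr_ge0// ?addr_ge0// ltW// divr_gt0.
  move=> /archi_boundP /ltW /le_trans; apply; rewrite ler_nat.
  by near: n; exact: nbhs_infty_ge.
have h1 := le_trans (maxS_sum _ n w) (k1P n); rewrite sumE mul1r in h1.
have h2 := le_trans (maxS_sum _ n w) (k2P n); rewrite sumE in h2.
rewrite distrC ler_norml; set S := \sum_(_ < _) _ in h1 h2 *.
set q := m.+1%:R^-1 in mP h1 h2.
have nq : n%:R * q <= n%:R * (e / 2) by rewrite ler_pM2l.
have k10 : 0 <= k1%:R :> R by []. have k20 : 0 <= k2%:R :> R by [].
rewrite -(ler_pM2l n0) -[X in _ && X](ler_pM2l n0) mulrBr mulVKf ?gt_eqF//.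
by apply/andP; split; nra.
Unshelve. all: by end_near. Qed.

End MaximalErgodic.

Lemma esumZl (R : realType) (U : countType) (A : set U) (c : R) (a : U -> \bar R) :
  0 <= c -> (forall u, A u -> 0 <= a u)%E ->
  (\esum_(u in A) (c%:E * a u) = c%:E * \esum_(u in A) a u)%E.
Proof.
move=> c0 a0; rewrite !(esum_mkcond A) !esum_pickle.
- rewrite -nneseriesZl; last by move=> n _; case: pickle_inv => //= u; case: ifPn => // /set_mem /a0.
  apply: eq_eseriesr => n _; case: pickle_inv => [u|] /=; last by rewrite mule0.
  by case: ifPn; rewrite ?mule0.
- by move=> u; case: ifPn => // /set_mem /a0.
- by move=> u; case: ifPn => // /set_mem /a0 ?; rewrite mule_ge0// lee_fin.
Qed.

(** * Shifts and events that depend on finitely many coordinates *)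

Definition shift {U : Type} n (f : nat -> U) : nat -> U := fun k => f (n + k)%N.

Definition local_at {U : Type} n (Q : set (nat -> U)) :=
  forall f g : nat -> U, (forall k, (k <= n)%N -> f k = g k) -> Q f -> Q g.

Section PathMeasurability.
Context (U : countType) (u0 : U).

Lemma local_nth n (Q : set (nat -> U)) : local_at n Q ->
  Q = (fun f : pathspace u0 => mkseq f n.+1) @^-1` [set s | Q (nth u0 s)].
Proof.
by move=> Qn; apply/seteqP; split => f /=; apply: Qn => k kn; rewrite nth_mkseq.
Qed.

Lemma local_measurable n (Q : set (pathspace u0)) :
  local_at n Q -> measurable Q.
Proof.
move=> Qn; rewrite (local_nth Qn).
exact: (dmeas_mkseq (f := fun k (f : pathspace u0) => f k)) (@dmeas_coord U u0) _.
Qed.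

Lemma dmeas_shift n k : dmeas (fun f : pathspace u0 => shift n f k).
Proof. exact: dmeas_coord. Qed.

Lemma shift_measurable n (B : set (pathspace u0)) :
  measurable B -> measurable (shift n @^-1` B : set (pathspace u0)).
Proof.
move=> mB; rewrite -[X in measurable X]setTI.
exact: (@path_measurable_fun U u0 _ (pathspace u0) (shift n) (dmeas_shift n)).
Qed.

Lemma shift_shift m n (f : nat -> U) : shift m (shift n f) = shift (n + m)%N f.
Proof. by apply/funext => k; rewrite /shift addnA. Qed.

Lemma shift_local n m (Q : set (nat -> U)) :
  local_at m Q -> local_at (n + m)%N (shift n @^-1` Q).
Proof. by move=> Qm f g fg; apply: Qm => k km; apply: fg; rewrite leq_add2l. Qed.

Lemma localI n (Q Q' : set (nat -> U)) :
  local_at n Q -> local_at n Q' -> local_at n (Q `&` Q').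
Proof. by move=> a b f g fg [? ?]; split; [exact: a fg _|exact: b fg _]. Qed.

Lemma local_coord n (A : set U) : local_at n [set f | A (f n)].
Proof. by move=> f g fg /=; rewrite fg. Qed.

End PathMeasurability.

(** * Law on path space and Markov property *)

Section MarkovProperty.
Context (R : realType) (S : countType) (s0 : S) (d : measure_display)
  (W : measurableType d) (p : S -> S -> R).
Context (P : S -> probability W R) (X : nat -> W -> S).
Hypothesis hX : markov_family p P X.

Definition path_of (w : W) : pathspace s0 := fun n => X n w.

Lemma dmeas_path_of n : dmeas (path_of ^~ n).
Proof. by apply: dmeas_fibers => u; case: hX => + _ _; apply. Qed.

Lemma measurable_path_of : measurable_fun setT path_of.
Proof. exact/path_measurable_fun/dmeas_path_of. Qed.

Lemma path_law_exists : exists mu : S -> {measure set (pathspace s0) -> \bar R},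
  forall x Q, mu x Q = P x (path_of @^-1` Q).
Proof.
pose mu x : {measure set (pathspace s0) -> \bar R} := pushforward (P x) path_of.
by exists (mu measurable_path_of).
Qed.

Definition path_law : S -> {measure set (pathspace s0) -> \bar R} :=
  projT1 (cid path_law_exists).

Lemma path_lawE x Q : path_law x Q = P x (path_of @^-1` Q).
Proof. exact: (projT2 (cid path_law_exists)). Qed.

Lemma le_path_law x A B : measurable A -> measurable B -> A `<=` B ->
  (path_law x A <= path_law x B)%E.
Proof. by move=> mA mB AB; apply: le_measure => //; rewrite inE. Qed.

Lemma path_law_setT x : path_law x setT = 1%E.
Proof. by rewrite path_lawE preimage_setT probability_setT. Qed.

Lemma path_law_le1 x Q : measurable Q -> (path_law x Q <= 1)%E.
Proof. by move=> mQ; rewrite -(path_law_setT x); exact: le_path_law. Qed.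

Lemma path_law_fin x Q : measurable Q -> path_law x Q \is a fin_num.
Proof.
by move=> mQ; rewrite ge0_fin_numE// (le_lt_trans (path_law_le1 x mQ))// ltry.
Qed.

Lemma path_law_start x : path_law x [set f : pathspace s0 | f 0%N = x] = 1%E.
Proof. by rewrite path_lawE; case: hX => _ + _; exact. Qed.

Lemma measurable_at n (A : set S) : measurable [set f : pathspace s0 | A (f n)].
Proof. exact: (@dmeas_coord S s0 n A). Qed.

Lemma path_law_setI_full x A Q : measurable A -> measurable Q ->
  path_law x (~` A) = 0%E -> path_law x (Q `&` A) = path_law x Q.
Proof.
move=> mA mQ A0.
rewrite -[in RHS](setIT Q) -(setUv A) setIUr measureU; last 3 first.
- exact: measurableI.
- by apply: measurableI => //; exact: measurableC.
- by rewrite setIACA setICr setI0.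
rewrite [X in (_ + X)%E](_ : _ = 0%E) ?adde0//.
apply/eqP; rewrite eq_le measure_ge0 andbT -A0.
by apply: le_path_law => //; [apply: measurableI => //|]; exact: measurableC.
Qed.

Lemma path_law_setC x A : measurable A -> path_law x A = 1%E -> path_law x (~` A) = 0%E.
Proof.
move=> mA A1; rewrite path_lawE -preimage_setC probability_setC.
  by rewrite -path_lawE A1 subee.
by rewrite -[X in measurable X]setTI; exact: measurable_path_of.
Qed.

Lemma path_law_ae_start x Q : measurable Q ->
  path_law x (Q `&` [set f : pathspace s0 | f 0%N = x]) = path_law x Q.
Proof.
have m0 : measurable [set f : pathspace s0 | f 0%N = x].
  exact: (@measurable_at 0%N [set x]).
by move=> mQ; apply: path_law_setI_full => //; exact/path_law_setC/path_law_start.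
Qed.

Lemma path_law_cylS x n (g : nat -> S) :
  path_law x (cyl s0 n.+2 g) = (path_law x (cyl s0 n.+1 g) * (p (g n) (g n.+1))%:E)%E.
Proof.
case: hX => _ _ /(_ x n g (g n.+1)) E; rewrite !path_lawE.
rewrite [X in (X * _)%E](_ : _ = P x [set w | forall k, (k <= n)%N -> X k w = g k])//.
rewrite -E; congr (P x _).
apply/seteqP; split => [w h|w [h h'] k].
  by split => [k kn|]; [apply: h; rewrite ltnS (leq_trans kn)|apply: h].
by rewrite ltnS leq_eqVlt => /predU1P[->//|]; exact: h.
Qed.

Lemma path_law_cyl_add x n m (g : nat -> S) :
  path_law x (cyl s0 (n + m).+1 g) =
  (path_law x (cyl s0 n.+1 g) * path_law (g n) (cyl s0 m.+1 (shift n g)))%E.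
Proof.
elim: m => [|m IHm].
  rewrite addn0 [X in (_ * X)%E](_ : _ = 1%E) ?mule1// -(path_law_start (g n)).
  congr (path_law _ _); apply/seteqP; split => [f /(_ 0%N)|f /= f0 [|]//].
    by rewrite /shift addn0; apply.
  by rewrite f0 /shift addn0.
by rewrite addnS path_law_cylS IHm path_law_cylS muleA /shift addnS.
Qed.

(** By uniqueness of measures it suffices to take a cylinder for [B]. If its first state differs
    from [g n], both sides vanish; otherwise the two cylinders glue to a longer one, whose mass
    factorises. *)
Lemma path_law_markov_cyl x n (g : nat -> S) (B : set (pathspace s0)) :
  measurable B ->
  path_law x (cyl s0 n.+1 g `&` shift n @^-1` B) = (path_law x (cyl s0 n.+1 g) * path_law (g n) B)%E.
Proof.
have mD : measurable (cyl s0 n.+1 g : set (pathspace s0)) by exact: cyl_measurable.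
have c0 : 0 <= fine (path_law x (cyl s0 n.+1 g)) by rewrite fine_ge0.
rewrite -[X in (X * _)%E]fineK ?path_law_fin// -[X in path_law (g n) X]setTI.
move=> mB.
apply: (path_measure_unique (phi2 := id) c0 mD measurableT
  (@dmeas_shift S s0 n) (@dmeas_coord S s0)) => //.
  by rewrite (le_lt_trans (path_law_le1 x mD))// ltry.
move=> [|m] h; first by rewrite !cyl0 !preimage_setT !setIT path_law_setT mule1 fineK// path_law_fin.
rewrite setTI fineK ?path_law_fin//.
have [h0|h0] := eqVneq (h 0%N) (g n); last first.
  rewrite [X in X = _](_ : _ = 0%E); last first.
    rewrite -(measure0 (path_law x)); congr (path_law x _); apply/seteqP; split => // f [fg fh].
    move/eqP: h0; apply; rewrite -fg//.
    by have := fh 0%N isT; rewrite /shift addn0.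
  rewrite [X in (_ * X)%E](_ : _ = 0%E) ?mule0//.
  rewrite -path_law_ae_start//; last exact: cyl_measurable.
  rewrite (_ : _ `&` _ = set0) ?measure0//; apply/seteqP; split => // f [/= fh f0].
  by move/eqP: h0; apply; rewrite -f0 fh.
(* The two trajectories overlap in coordinate [n], where they agree by [h0]. *)
pose g' k := if (k <= n)%N then g k else h (k - n)%N.
have g'n k : (k <= n)%N -> g' k = g k by rewrite /g' => ->.
have g'h k : g' (n + k)%N = h k.
  rewrite /g'; case: ifPn => [|_]; last by rewrite addKn.
  by rewrite -[X in (_ <= X)%N]addn0 leq_add2l leqn0 => /eqP ->; rewrite addn0.
have -> : cyl s0 n.+1 g `&` shift n @^-1` cyl s0 m.+1 h = cyl s0 (n + m).+1 g'.
  apply/seteqP; split => [f [fg fh] k|f fg'].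
    rewrite ltnS => knm; case: (leqP k n) => kn; first by rewrite fg// g'n.
    rewrite -(subnKC (ltnW kn)) g'h -fh// ltnS leq_subLR//.
  split => k km.
    by rewrite fg' ?g'n// (leq_trans km)// ltnS leq_addr.
  by rewrite /shift fg' ?g'h// ltnS leq_add2l.
rewrite path_law_cyl_add g'n//; congr (path_law x _ * path_law (g n) _)%E.
  by apply/seteqP; split => f fg k kn; rewrite fg// g'n.
by apply/seteqP; split => f fg k kn; rewrite fg// /shift g'h.
Qed.

(** A local event is a countable disjoint union of cylinders of length n + 1 ending at [y], and the
    future factor is the same for each of them. *)
Lemma path_law_markov x n (Q : set (nat -> S)) y (B : set (pathspace s0)) :
  local_at n Q -> measurable B ->
  path_law x (Q `&` [set f | f n = y] `&` shift n @^-1` B) =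
  (path_law x (Q `&` [set f | f n = y]) * path_law y B)%E.
Proof.
move=> Qn mB.
pose F (f : pathspace s0) := mkseq f n.+1.
have mF : dmeas F.
  exact: (dmeas_mkseq (f := fun k (f : pathspace s0) => f k)) (@dmeas_coord S s0).
pose A := [set s | Q (nth s0 s) /\ nth s0 s n = y].
have QA : Q `&` [set f | f n = y] = F @^-1` A.
  apply: (@local_nth S s0 n (Q `&` [set f | f n = y])); apply: localI => //.
  exact: (@local_coord _ n [set y]).
have mD := @shift_measurable S s0 n B mB.
rewrite QA [in LHS]setIC measure_fibers// -[in RHS](setTI (F @^-1` A)) measure_fibers//.
rewrite -[X in (_ * X)%E]fineK ?path_law_fin// muleC -esumZl ?fine_ge0//.
rewrite fineK ?path_law_fin//; apply: eq_esum => s [Qs sy].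
rewrite setTI.
have [sn|sn] := eqVneq (size s) n.+1.
  have -> : [set f | F f = s] = cyl s0 n.+1 (nth s0 s).
    apply/seteqP; split => [f <- k kn|f fs]; first by rewrite nth_mkseq.
    apply: (@eq_from_nth _ s0); rewrite ?size_mkseq// => k kn.
    by rewrite nth_mkseq// fs.
  by rewrite setIC path_law_markov_cyl// sy muleC.
have -> : [set f | F f = s] = set0.
  by apply/seteqP; split => // f fs; move/eqP: sn; rewrite -fs size_mkseq.
by rewrite setI0 measure0 mule0.
Qed.

Lemma path_law_step x y : path_law x [set f | f 1%N = y] = (p x y)%:E.
Proof.
rewrite -path_law_ae_start; last exact: (@measurable_at 1%N [set y]).
pose g k := if k is 0%N then x else y.
have -> : [set f | f 1%N = y] `&` [set f : pathspace s0 | f 0%N = x] = cyl s0 2 g.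
  apply/seteqP; split => [f [/= f1 f0] [|[|k]]//|f fg].
  by split; [exact: (fg 1%N)|exact: (fg 0%N)].
rewrite (path_law_cylS _ 0) [X in (X * _)%E](_ : _ = 1%E) ?mul1e//.
rewrite -(path_law_start x); congr (path_law x _); apply/seteqP; split => [f /(_ 0%N)|f f0 [|]//].
exact.
Qed.

Lemma path_law_markov_step x n (Q : set (nat -> S)) y z : local_at n Q ->
  path_law x (Q `&` [set f | f n = y] `&` [set f | f n.+1 = z]) =
  (path_law x (Q `&` [set f | f n = y]) * (p y z)%:E)%E.
Proof.
move=> Qn; rewrite -path_law_step -(path_law_markov x y Qn (@measurable_at 1%N [set z])).
by congr (path_law x (_ `&` _)); apply/seteqP; split => f; rewrite /= /shift addn1.
Qed.

Lemma path_law_Chapman x y z n m :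
  (path_law x [set f | f n = y] * path_law y [set f | f m = z] <=
   path_law x [set f | f (n + m)%N = z])%E.
Proof.
have lT : local_at n (setT : set (nat -> S)) by [].
have := path_law_markov x y lT (@measurable_at m [set z]); rewrite setTI => <-.
have mA k A := @measurable_at k A.
apply: le_path_law => //.
- apply: measurableI; first exact: (mA _ [set y]).
  exact: (@shift_measurable S s0 n _ (mA m [set z])).
- exact: (mA _ [set z]).
Qed.

Lemma path_law_null_steps x :
  path_law x (~` [set f : pathspace s0 | forall n, p (f n) (f n.+1) != 0]) = 0%E.
Proof.
have mF n : dmeas (fun f : pathspace s0 => (f n, f n.+1)).
  by apply: dmeas_pair; exact: dmeas_coord.
pose Z := [set u : S * S | p u.1 u.2 = 0].
apply/eqP; rewrite eq_le measure_ge0 andbT.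
have -> : ~` [set f : pathspace s0 | forall n, p (f n) (f n.+1) != 0] =
    \bigcup_n (fun f : pathspace s0 => (f n, f n.+1)) @^-1` Z.
  apply/seteqP; split => [f /= /existsNP[n /negP/negPn/eqP]|f [n _ /= h] h'].
    by exists n.
  by have := h' n; rewrite h eqxx.
have m0 n : path_law x ((fun f : pathspace s0 => (f n, f n.+1)) @^-1` Z) = 0%E.
  rewrite -[X in path_law x X]setTI measure_fibers//; apply: esum1 => -[y z] /= yz0.
  have lT : local_at n (setT : set (nat -> S)) by [].
  have := path_law_markov_step x y z lT; rewrite yz0 mule0 => <-; congr (path_law x _).
  by rewrite -setIA; congr (_ `&` _); apply/seteqP; split => f /= [-> ->].
apply: (@le_trans _ _ (\sum_(n <oo) path_law x ((fun f : pathspace s0 => (f n, f n.+1)) @^-1` Z))%E).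
  apply: measure_sigma_subadditive => //; first by move=> n; exact: mF.
  by apply: bigcupT_measurable => n; exact: mF.
by rewrite eseries0// => n _ _; exact: m0.
Qed.

Definition legal (x : S) : set (pathspace s0) :=
  [set f | f 0%N = x /\ forall n, p (f n) (f n.+1) != 0].

Lemma measurable_pos_steps :
  measurable [set f : pathspace s0 | forall n, p (f n) (f n.+1) != 0].
Proof.
have -> : [set f : pathspace s0 | forall n, p (f n) (f n.+1) != 0] =
    \bigcap_n [set f : pathspace s0 | p (f n) (f n.+1) != 0].
  by apply/seteqP; split => [f h n _|f h n]; exact: h.
apply: bigcapT_measurable => n; apply: (@local_measurable S s0 n.+1).
by move=> f g fg /=; rewrite !fg.
Qed.

Lemma measurable_legal x : measurable (legal x).
Proof.
exact: measurableI (@measurable_at 0%N [set x]) measurable_pos_steps.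
Qed.

(** Allows two events to be compared path by path, under the assumption that the start is [x] and
    that every step is an admissible one. *)
Lemma path_law_legal x Q : measurable Q -> path_law x (Q `&` legal x) = path_law x Q.
Proof.
move=> mQ; rewrite -(path_law_ae_start x mQ).
have mQ0 := measurableI _ _ mQ (@measurable_at 0%N [set x]).
rewrite -(path_law_setI_full measurable_pos_steps mQ0 (path_law_null_steps x)).
by congr (path_law x _); rewrite -setIA.
Qed.

End MarkovProperty.

(** * The directed cover *)

Section Tree.
Context (G : countType) (edge : rel G) (i0 : G).
Let T := dcover edge i0.
Implicit Types (x y : T) (j : G).

(** Falls back to the root when there is no edge from the label of [x] to [j]; this is where the
    edge hypotheses of the following lemmas come from. *)
Definition chd x j : T := insubd dc_root (rcons (val x) j).
Definition cone x y := prefix (val x) (val y).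
Definition hgt x := size (val x).

Lemma label_rcons x s j : val x = rcons s j -> dc_label x = j.
Proof. by rewrite /dc_label => ->; rewrite last_rcons. Qed.

Lemma val_chd x j : edge (dc_label x) j -> val (chd x j) = rcons (val x) j.
Proof.
by move=> e; rewrite /chd val_insubd /= rcons_path (valP x) e.
Qed.

Lemma label_chd x j : edge (dc_label x) j -> dc_label (chd x j) = j.
Proof. by move=> /val_chd /label_rcons. Qed.

Lemma hgt_chd x j : edge (dc_label x) j -> hgt (chd x j) = (hgt x).+1.
Proof. by move=> e; rewrite /hgt val_chd// size_rcons. Qed.

Lemma hgt_eq0 x : (hgt x == 0%N) = (x == dc_root).
Proof.
apply/eqP/eqP => [/size0nil x0|->//]; exact/val_inj.
Qed.

Lemma chd_neq_root x j : edge (dc_label x) j -> chd x j != dc_root.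
Proof. by move=> e; rewrite -hgt_eq0 hgt_chd. Qed.

Lemma dc_anc_chd x j : edge (dc_label x) j -> dc_anc (chd x j) = x.
Proof.
move=> e; apply/val_inj => /=.
by rewrite val_chd// size_rcons /= -cats1 take_size_cat.
Qed.

Lemma chd_dc_anc x : x != dc_root ->
  edge (dc_label (dc_anc x)) (dc_label x) /\ x = chd (dc_anc x) (dc_label x).
Proof.
rewrite -hgt_eq0 /hgt; case E : (val x) / lastP => [//|s j] _.
have Ha : val (dc_anc x) = s.
  by rewrite /= E size_rcons /= -cats1 take_size_cat.
have lj : dc_label x = j by exact: label_rcons E.
have e : edge (dc_label (dc_anc x)) j.
  by rewrite /dc_label Ha; have := valP x; rewrite E rcons_path => /andP[].
by rewrite lj; split => //; apply/val_inj; rewrite val_chd// Ha E.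
Qed.

Lemma hgt_anc x : x != dc_root -> hgt x = (hgt (dc_anc x)).+1.
Proof. by move=> /chd_dc_anc[e {1}->]; rewrite hgt_chd. Qed.

Lemma tree_ind (Q : T -> Prop) : Q dc_root ->
  (forall x j, edge (dc_label x) j -> Q x -> Q (chd x j)) -> forall x, Q x.
Proof.
move=> Q0 QS x; have [n] := ubnP (hgt x); elim: n x => // n IHn x xn.
have [->//|x0] := eqVneq x dc_root; have [e ->] := chd_dc_anc x0.
by apply: QS => //; apply: IHn; move: xn; rewrite (hgt_anc x0).
Qed.

Lemma cone_refl x : cone x x. Proof. exact: prefix_refl. Qed.

Lemma cone_trans y x z : cone x y -> cone y z -> cone x z.
Proof. exact: prefix_trans. Qed.

Lemma cone_hgt x y : cone x y -> (hgt x <= hgt y)%N.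
Proof. exact: size_prefix. Qed.

Lemma cone_eq x y : cone x y -> hgt x = hgt y -> x = y.
Proof.
rewrite /cone prefixE => /eqP + e; rewrite -[size _]/(hgt x) e take_size => e'.
exact/val_inj.
Qed.

Lemma cone_chd x j : edge (dc_label x) j -> cone x (chd x j).
Proof. by move=> e; rewrite /cone val_chd// -cats1 prefix_prefix. Qed.

Lemma cone_anc x y : cone x y -> x != y -> cone x (dc_anc y).
Proof.
move=> xy nxy; have ltxy : (hgt x < hgt y)%N.
  by rewrite ltn_neqAle cone_hgt// andbT; apply: contra nxy => /eqP/(cone_eq xy)->.
have y0 : y != dc_root by rewrite -hgt_eq0 -lt0n (leq_ltn_trans _ ltxy).
have [e yE] := chd_dc_anc y0; move: xy ltxy; rewrite {1 2}yE hgt_chd// ltnS.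
rewrite /cone !prefixE val_chd// => /eqP xE le; rewrite -{2}xE -cats1.
by rewrite takel_cat.
Qed.

Context (R : realType) (pG : G -> G -> R) (pb : G -> R).
Hypothesis hpG : graph_transitions edge pG.
Hypothesis hpb : backward_probabilities pb.
Let p := ptree (edge := edge) (i0 := i0) pG pb.

Lemma pfwd_ge0 i j : 0 <= pfwd pG pb i j.
Proof.
case: hpG => g0 _ _; case: hpb => /(_ i)/andP[b0 b1] _.
by rewrite mulr_ge0// subr_ge0 ltW.
Qed.

Lemma pfwd_gt0 i j : (0 < pfwd pG pb i j) = edge i j.
Proof.
case: hpG => _ e _; case: hpb => /(_ i)/andP[b0 b1] _.
by rewrite /pfwd pmulr_rgt0 ?subr_gt0//; apply/idP/idP => /e.
Qed.

Lemma pfwd_eq0 i j : ~~ edge i j -> pfwd pG pb i j = 0.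
Proof.
rewrite -pfwd_gt0 -leNgt => h; apply/eqP; rewrite eq_le h.
exact: pfwd_ge0.
Qed.

Lemma ptree_chd x j : edge (dc_label x) j ->
  p x (chd x j) = pfwd pG pb (dc_label x) j.
Proof. by move=> e; rewrite /p /ptree chd_neq_root// dc_anc_chd// eqxx label_chd. Qed.

Lemma ptree_anc x : x != dc_root -> p x (dc_anc x) = pb (dc_label x).
Proof.
move=> x0; rewrite /p /ptree x0 eqxx andTb; case: ifPn => //= /andP[a0 /eqP].
by move=> /(congr1 hgt)/eqP; rewrite (hgt_anc x0) (hgt_anc a0) ltn_eqF.
Qed.

Lemma ptree_ge0 x y : 0 <= p x y.
Proof.
have b0 i : 0 <= pb i by case: hpb => /(_ i)/andP[/ltW].
rewrite /p /ptree; case: ifP => _; first exact: pfwd_ge0.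
by case: ifP => // _; case: ifP.
Qed.

Variant step_spec x y : Prop :=
| StepDown j of edge (dc_label x) j & y = chd x j
| StepUp of x != dc_root & y = dc_anc x
| StepLoop of x = dc_root & y = dc_root.

Lemma ptree_step x y : p x y != 0 -> step_spec x y.
Proof.
rewrite /p /ptree; case: ifPn => [/andP[y0 /eqP <-] _|_].
  by have [e yE] := chd_dc_anc y0; apply: (StepDown e).
case: ifPn => [/andP[x0 /eqP yE] _|_]; first exact: StepUp.
by case: ifPn => [/andP[/eqP xE /eqP yE] _|]; [exact: StepLoop|rewrite eqxx].
Qed.

Lemma step_hgt x y : step_spec x y -> (hgt y <= (hgt x).+1)%N /\ (hgt x <= (hgt y).+1)%N.
Proof.
case => [j e ->|x0 ->|-> ->//]; first by rewrite hgt_chd//; split; lia.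
by rewrite (hgt_anc x0); split; lia.
Qed.

(* A step out of a cone goes from its apex to the ancestor of the apex. *)
Lemma step_cone x y z : cone x y -> step_spec y z -> ~~ cone x z ->
  y = x /\ z = dc_anc x.
Proof.
move=> xy st nxz; suff yx : y = x.
  split => //; case: st nxz => [j e ->|y0 -> _|yE ->].
  - by rewrite -yx cone_chd.
  - by rewrite yx.
  - by rewrite -yx yE cone_refl.
case: st xy nxz => [j e ->|y0 ->|-> ->] xy; last by rewrite xy.
  by rewrite (cone_trans xy)// cone_chd.
by apply: contraNeq => nyx; apply: cone_anc => //; rewrite eq_sym.
Qed.

End Tree.

(** If [a > 1], Bernoulli's inequality makes the powers grow at least linearly. This removes
    multiplicative constants from exponential estimates. *)
Lemma expn_bounded_le1 (R : realType) (a C : R) :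
  0 <= a -> (forall k, a ^+ k <= C) -> a <= 1.
Proof.
move=> a0 aC; rewrite leNgt; apply/negP => a1.
have B k : 1 + k%:R * (a - 1) <= a ^+ k.
  elim: k => [|k IHk]; first by rewrite expr0 mul0r addr0.
  rewrite exprS; apply: le_trans (ler_wpM2l a0 IHk).
  have k0 : 0 <= k%:R :> R by [].
  have -> : a * (1 + k%:R * (a - 1)) =
      1 + k.+1%:R * (a - 1) + k%:R * (a - 1) ^+ 2 by rewrite -natr1; ring.
  by rewrite lerDl mulr_ge0// sqr_ge0.
have d0 : 0 < a - 1 by rewrite subr_gt0.
have C0 : 0 <= C / (a - 1).
  by rewrite divr_ge0 ?(ltW d0)// (le_trans _ (aC 0%N))// expr0.
have := archi_boundP C0; set k := Num.bound _ => kP.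
have := le_trans (B k) (aC k); rewrite leNgt => /negP; apply.
by move: kP; rewrite ltr_pdivrMr//; lra.
Qed.

Lemma nneseries_geometric (R : realType) (a z : R) : 0 <= z -> z < 1 ->
  (\sum_(n <oo) (a * z ^+ n)%:E = (a * (1 - z)^-1)%:E)%E.
Proof.
move=> z0 z1; have cg : series (geometric a z) @ \oo --> a * (1 - z)^-1.
  by apply: cvg_geometric_series; rewrite ger0_norm.
rewrite -(cvg_lim _ cg)// -EFin_lim; last exact: cvgP cg.
by apply: congr_lim; apply/funext => n; rewrite /series /= -sumEFin.
Qed.

(** * Exponential decay and escape *)

Section Walk.
Context (R : realType) (G : countType) (edge : rel G) (i0 : G).
Context (pG : G -> G -> R) (pb : G -> R).
Context (d : measure_display) (W : measurableType d).
Let T := dcover edge i0.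
Context (P : T -> probability W R) (X : nat -> W -> T).
Hypothesis hpG : graph_transitions edge pG.
Hypothesis hpb : backward_probabilities pb.
Hypothesis hX : markov_family (ptree pG pb) P X.
Variable eps : R.
Hypothesis eps0 : 0 < eps.
Hypothesis eps_pb : forall i, eps <= pb i.
Hypothesis eps_pfwd : forall i j, edge i j -> eps <= pfwd pG pb i j.

Let root : T := dc_root.
Let PT := path_law root hX.
Let o : T := dc_root.
Let path := pathspace root.

Lemma measurable_hgt n l : measurable [set f : path | hgt (f n) = l].
Proof. exact: (@measurable_at T root n [set y | hgt y = l]). Qed.

Lemma reach_down x : ((eps ^+ hgt x)%:E <= PT x [set f | f (hgt x) = o])%E.
Proof.
elim/tree_ind: x => [|y j e IH]; first by rewrite /PT path_law_start expr0.
rewrite hgt_chd// -add1n.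
apply: le_trans (path_law_Chapman root hX (chd y j) y o 1 (hgt y)).
rewrite path_law_step add1n exprS EFinM lee_pmul// ?lee_fin ?exprn_ge0 ?(ltW eps0)//.
by rewrite -{2}(dc_anc_chd e) ptree_anc//; exact: chd_neq_root.
Qed.

Lemma reach_up x : ((eps ^+ hgt x)%:E <= PT o [set f | f (hgt x) = x])%E.
Proof.
elim/tree_ind: x => [|y j e IH]; first by rewrite /PT path_law_start expr0.
rewrite hgt_chd// -addn1.
apply: le_trans (path_law_Chapman root hX o y (chd y j) (hgt y) 1).
rewrite path_law_step addn1 exprSr EFinM lee_pmul// ?lee_fin ?exprn_ge0 ?(ltW eps0)//.
by rewrite ptree_chd//; exact: eps_pfwd.
Qed.

Section Spectral.
Hypothesis rho1 : (spectral_radius P X dc_root < 1)%E.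

(** A radius of convergence above 1 gives a convergent power series at some |z| > 1. Its terms tend
    to 0, hence are bounded, and r = 1/|z|. *)
Lemma spectral_bound : exists C r : R, [/\ 0 < C, 0 < r, r < 1 &
  forall n, (PT o [set f | f n = o] <= (C * r ^+ n)%:E)%E].
Proof.
pose a n := law P X o n o.
have aE n : PT o [set f | f n = o] = (a n)%:E.
  by rewrite -[LHS]fineK ?path_law_fin//; first (by rewrite path_lawE); exact: (@measurable_at T root n [set o]).
have a0 n : 0 <= a n by rewrite fine_ge0.
have c0 : (0 <= convergence_radius a)%E.
  apply: ereal_sup_ubound; exists 0 => /=; last by rewrite normr0.
  apply/cvg_ex; exists (a 0%N); apply: (@cvg_near_cst _ _ _ (pseries a 0) \oo).
  exists 1%N => // -[//|n] _; rewrite /pseries /series /= big_nat_recl//=.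
  by rewrite big1 ?addr0 ?expr0 ?mulr1// => i _; rewrite exprS mul0r mulr0.
have : (1 < convergence_radius a)%E.
  have := rho1; rewrite /spectral_radius -/(convergence_radius a).
  by rewrite inve_plt ?inve1// inE.
move=> /ereal_sup_gt[_ [z zcv <-]]; rewrite lte_fin => z1.
have z0 : 0 < `|z| by rewrite (lt_trans _ z1).
have /cvg_series_cvg_0 := zcv.
move=> /cvgrPdist_lt/(_ 1 ltr01)[N _ HN].
(* The 1 bounds the terms from [N] on, and the sum bounds each of the earlier ones. *)
pose C := 1 + \sum_(i < N) a i * `|z| ^+ i.
have s0 : 0 <= \sum_(i < N) a i * `|z| ^+ i.
  by rewrite sumr_ge0// => i _; rewrite mulr_ge0.
exists C, `|z|^-1; split => //; rewrite ?invr_gt0 ?invf_lt1//.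
  by rewrite /C ltr_pwDl.
move=> n; rewrite aE lee_fin exprVn ler_pdivlMr ?exprn_gt0//.
have [Nn|nN] := leqP N n.
  have := HN n Nn; rewrite sub0r normrN normrM normrX (ger0_norm (a0 n)) => /ltW h.
  by rewrite (le_trans h)// /C lerDl.
rewrite /C (bigD1 (Ordinal nN))//= addrCA lerDl addr_ge0// sumr_ge0// => i _.
by rewrite mulr_ge0.
Qed.

End Spectral.

Section Decay.
Variables (C r : R).
Hypotheses (C0 : 0 < C) (r0 : 0 < r) (r1 : r < 1).
Hypothesis decay : forall n, (PT o [set f | f n = o] <= (C * r ^+ n)%:E)%E.

Lemma PT_fine x n y : PT x [set f | f n = y] = (fine (PT x [set f | f n = y]))%:E.
Proof. by rewrite fineK// path_law_fin//; exact: (@measurable_at T root n [set y]). Qed.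

(** The rate at the root carries over to every vertex without any constant. Going from the root to
    [x], making k loops of length n, and going back costs only the fixed factor [eps ^ (2 * hgt x)]
    besides the k-th power of the loop probability [u]. Hence the powers of [u / r ^ n] are bounded,
    and this ratio is at most 1. *)
Lemma return_le x n : (PT x [set f | f n = x] <= (r ^+ n)%:E)%E.
Proof.
rewrite PT_fine lee_fin; set u := fine _.
have u0 : 0 <= u by rewrite fine_ge0.
have uk k : ((u ^+ k)%:E <= PT x [set f | f (k * n)%N = x])%E.
  elim: k => [|k IHk]; first by rewrite /PT path_law_start expr0.
  rewrite mulSn; apply: le_trans (path_law_Chapman root hX x x x n (k * n)).
  by rewrite exprS EFinM lee_pmul ?lee_fin ?exprn_ge0// -PT_fine.
have eh : 0 < eps ^+ hgt x by rewrite exprn_gt0.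
have rn : 0 < r ^+ n by rewrite exprn_gt0.
rewrite -(ler_pM2r (_ : 0 < (r ^+ n)^-1)) ?invr_gt0// mulfV ?gt_eqF//.
apply: (@expn_bounded_le1 _ _ (C * r ^+ (hgt x) * r ^+ (hgt x) / (eps ^+ hgt x * eps ^+ hgt x))).
  by rewrite divr_ge0// ltW.
move=> k; rewrite expr_div_n ler_pdivlMr ?mulr_gt0// mulrAC ler_pdivrMr ?exprn_gt0//.
have -> : C * r ^+ hgt x * r ^+ hgt x * (r ^+ n) ^+ k =
    C * r ^+ (hgt x + (k * n + hgt x)) by rewrite -exprM mulnC !exprD; ring.
have -> : u ^+ k * (eps ^+ hgt x * eps ^+ hgt x) =
    eps ^+ hgt x * (u ^+ k * eps ^+ hgt x) by ring.
rewrite -lee_fin.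
apply: le_trans (decay _).
apply: le_trans (path_law_Chapman root hX o x o (hgt x) (k * n + hgt x)).
rewrite EFinM lee_pmul// ?lee_fin ?mulr_ge0 ?exprn_ge0 ?(ltW eps0)//.
  exact: reach_up.
apply: le_trans (path_law_Chapman root hX x x o (k * n) (hgt x)).
by rewrite EFinM lee_pmul// ?lee_fin ?exprn_ge0 ?(ltW eps0)//; exact: reach_down.
Qed.

(** From any vertex of height [l] the root is reached in [l] steps with probability at least
    [eps ^ l], so the event is at most [eps ^ - l] times as likely as a return to the root at time n
    + l. *)
Lemma height_bound n l :
  (PT o [set f | hgt (f n) = l] <= (C * r ^+ n / eps ^+ l)%:E)%E.
Proof.
have el : 0 < eps ^+ l by rewrite exprn_gt0.
have mo : measurable [set f : path | f (n + l)%N = o].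
  exact: (@measurable_at T root (n + l) [set o]).
have h : ((eps ^+ l)%:E * PT o [set f | hgt (f n) = l] <= (C * r ^+ (n + l))%:E)%E.
  apply: le_trans (decay _).
  have mF : dmeas (fun f : path => f n) by exact: dmeas_coord.
  have -> : [set f : path | hgt (f n) = l] =
      setT `&` (fun f : path => f n) @^-1` [set y | hgt y = l] by rewrite setTI.
  rewrite measure_fibers// -esumZl ?(ltW el)//.
  apply: (@le_trans _ _ (PT o ([set f | f (n + l)%N = o] `&`
      (fun f : path => f n) @^-1` [set y | hgt y = l]))); last first.
    apply: le_path_law => //; first exact: measurableI mo (mF _).
  rewrite measure_fibers//; apply: le_esum => y /= yl.
  have lT : local_at n (setT : set (nat -> T)) by [].
  have mol : measurable [set f : path | f l = o].
    exact: (@measurable_at T root l [set o]).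
  have -> : PT o ([set f : path | f (n + l)%N = o] `&` [set f | f n = y]) =
      (PT o [set f | f n = y] * PT y [set f | f l = o])%E.
    by rewrite setIC -[[set f | f n = y]]setTI; exact: path_law_markov.
  rewrite setTI muleC; apply: lee_pmul => //; first by rewrite lee_fin ltW.
  by rewrite -yl; exact: reach_down.
have -> : C * r ^+ n / eps ^+ l = (eps ^+ l)^-1 * (C * r ^+ n) by rewrite mulrC.
rewrite EFinM lee_pdivlMl//; apply: le_trans h _; rewrite lee_fin.
by rewrite exprD mulrA ler_piMr ?mulr_ge0 ?exprn_ge0 ?(ltW C0) ?(ltW r0)// exprn_ile1 ?(ltW r0) ?(ltW r1).
Qed.

Definition escaping : set path :=
  [set f | forall l, exists N, forall n, (N <= n)%N -> (l < hgt (f n))%N].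

Lemma measurable_escaping : measurable escaping.
Proof.
have -> : escaping = \bigcap_l \bigcup_N \bigcap_(n in [set n | (N <= n)%N])
    [set f : path | (l < hgt (f n))%N].
  apply/seteqP; split => [f h l _|f h l].
    by have [N NP] := h l; exists N.
  by have [N _ NP] := h l I; exists N.
apply: bigcapT_measurable => l; apply: bigcupT_measurable => N.
apply: bigcap_measurableType => n _.
exact: (@measurable_at T root n [set y | (l < hgt y)%N]).
Qed.

(** Borel-Cantelli, with the geometric bound of [height_bound], shows that each level is visited
    finitely often; by induction on the level, the path is eventually above all of them. *)
Lemma ae_escaping : PT o (~` escaping) = 0%E.
Proof.
pose F l n := [set f : path | hgt (f n) = l].
have F0 l : PT o (lim_sup_set (F l)) = 0%E.
  apply: lim_sup_set_cvg0; first by move=> n; exact: measurable_hgt.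
  apply: (@le_lt_trans _ _ (\sum_(n <oo) (C * r ^+ n / eps ^+ l)%:E)%E).
    by apply: lee_nneseries => // n _; exact: height_bound.
  have g0 : 0 <= C / eps ^+ l by rewrite divr_ge0 ?exprn_ge0 ?ltW.
  have -> : (\sum_(n <oo) (C * r ^+ n / eps ^+ l)%:E =
      ((C / eps ^+ l) * (1 - r)^-1)%:E)%E.
    rewrite -nneseries_geometric ?(ltW r0)//.
    by apply: eq_eseriesr => n _; congr EFin; ring.
  by rewrite ltry.
have mL l : measurable (lim_sup_set (F l)).
  apply: bigcapT_measurable => n; apply: bigcup_measurable => m _.
  exact: measurable_hgt.
have sub : ~` escaping `<=` \bigcup_l lim_sup_set (F l).
  move=> f; apply: contra_notP => h.
  have nh l : exists N, forall n, (N <= n)%N -> hgt (f n) != l.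
    apply: contrapT => h'; apply: h; exists l => // N _.
    apply: contrapT => h''; apply: h'; exists N => n Nn.
    by apply/negP => /eqP fl; apply: h''; exists n.
  elim=> [|l [N NP]].
    by have [N NP] := nh 0%N; exists N => n /NP; rewrite lt0n.
  have [M MP] := nh l.+1; exists (maxn N M) => n; rewrite geq_max => /andP[Nn Mn].
  by rewrite ltn_neqAle eq_sym MP// NP.
have mU : measurable (\bigcup_l lim_sup_set (F l)) by exact: bigcupT_measurable.
apply/eqP; rewrite eq_le measure_ge0 andbT.
apply: (@le_trans _ _ (PT o (\bigcup_l lim_sup_set (F l)))).
  by apply: le_path_law => //; apply: measurableC; exact: measurable_escaping.
apply: (@le_trans _ _ (\sum_(l <oo) PT o (lim_sup_set (F l)))%E).
  exact: measure_sigma_subadditive.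
by rewrite eseries0// => l _ _; exact: F0.
Qed.

End Decay.
End Walk.

(** * Last exits from cones *)

Section Translation.
Context (G : countType) (edge : rel G) (i0 : G).
Let T := dcover edge i0.
Implicit Types (x y : T) (u v : seq G).

Definition xcat x u : T := insubd dc_root (val x ++ u).

Lemma val_xcat x u : path edge (dc_label x) u -> val (xcat x u) = val x ++ u.
Proof. by move=> e; rewrite val_insubd /= cat_path (valP x) e. Qed.

Lemma xcat_nil x : xcat x [::] = x.
Proof. by apply: val_inj; rewrite val_xcat// cats0. Qed.

Lemma label_xcat x u : path edge (dc_label x) u ->
  dc_label (xcat x u) = last (dc_label x) u.
Proof. by move=> e; rewrite /dc_label val_xcat// last_cat. Qed.

Lemma xcat_inj x u v : path edge (dc_label x) u -> path edge (dc_label x) v ->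
  xcat x u = xcat x v -> u = v.
Proof.
move=> eu ev /(congr1 val); rewrite !val_xcat// => /eqP.
by rewrite eqseq_cat// eqxx => /eqP.
Qed.

Lemma cone_xcat x u : path edge (dc_label x) u -> cone x (xcat x u).
Proof. by move=> e; rewrite /cone val_xcat// prefix_prefix. Qed.

Lemma xcat_cone x z : cone x z ->
  path edge (dc_label x) (drop (hgt x) (val z)) /\
  xcat x (drop (hgt x) (val z)) = z.
Proof.
rewrite /cone prefixE => /eqP xz.
have zE : val z = val x ++ drop (hgt x) (val z) by rewrite -{1}xz cat_take_drop.
have e : path edge (dc_label x) (drop (hgt x) (val z)).
  by have /= := valP z; rewrite {1}zE cat_path => /andP[_].
by split => //; apply: val_inj; rewrite val_xcat.
Qed.

Context (R : realType) (pG : G -> G -> R) (pb : G -> R).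
Let p := ptree (edge := edge) (i0 := i0) pG pb.

(* One-step transition probabilities inside a cone, in coordinates relative to
   the apex, which has label [i]. *)
Definition prel (i : G) (u v : seq G) : R :=
  if (v != [::]) && (take (size v).-1 v == u) then pfwd pG pb (last i u) (last i v)
  else if (u != [::]) && (v == take (size u).-1 u) then pb (last i u)
  else 0.

Let anc_xcat x u : path edge (dc_label x) u -> u != [::] ->
  dc_anc (xcat x u) = xcat x (take (size u).-1 u).
Proof.
case/lastP: u => // u j e _; have := e; rewrite rcons_path => /andP[e1 _].
apply: val_inj; rewrite [LHS]/= !val_xcat//; last first.
  by rewrite size_rcons /= -cats1 take_size_cat.
by rewrite -rcons_cat !size_rcons /= -!cats1 !take_size_cat.
Qed.

Let xcat_eq_root x u : path edge (dc_label x) u ->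
  (xcat x u == dc_root) = (x == dc_root) && (u == [::]).
Proof.
by move=> e; rewrite -!hgt_eq0 /hgt val_xcat// size_cat addn_eq0 -(size_eq0 u).
Qed.

Let anc_neq x u : path edge (dc_label x) u -> x != dc_root ->
  (dc_anc x == xcat x u) = false.
Proof.
move=> e x0; apply/eqP => /(congr1 (@hgt _ _ _)).
by have := hgt_anc x0; rewrite /hgt val_xcat// size_cat; lia.
Qed.

(** The side condition excludes exactly the loop at the root, the one transition that depends on
    more than the label and the relative positions. *)
Lemma ptree_xcat x u v : path edge (dc_label x) u -> path edge (dc_label x) v ->
  [|| u != [::], v != [::] | x != dc_root] ->
  p (xcat x u) (xcat x v) = prel (dc_label x) u v.
Proof.
move=> eu ev uvx; rewrite /p /ptree /prel !xcat_eq_root// !label_xcat//.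
have etake w : path edge (dc_label x) w -> path edge (dc_label x) (take (size w).-1 w).
  exact: take_path.
have [v0|v0] := eqVneq v [::].
  rewrite andbT andFb.
  have -> : (x != dc_root) && (dc_anc (xcat x v) == xcat x u) = false.
    rewrite v0 xcat_nil; have [//|x0] /= := eqVneq x dc_root.
    by rewrite anc_neq.
  have [u0|u0] := eqVneq u [::].
    rewrite u0 v0 !andbT !xcat_nil; move: uvx; rewrite u0 v0 /= => x0.
    by rewrite (negbTE x0) /= eq_sym -{2}(xcat_nil x) anc_neq.
  rewrite !andbF !andTb anc_xcat//.
  have -> : (xcat x v == xcat x (take (size u).-1 u)) = (v == take (size u).-1 u).
    apply/eqP/eqP => [/xcat_inj->//|<-//]; exact: etake.
  by case: ifP.
rewrite andbF /= anc_xcat//.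
have -> : (xcat x (take (size v).-1 v) == xcat x u) = (take (size v).-1 v == u).
  apply/eqP/eqP => [/xcat_inj->//|<-//]; exact: etake.
case: ifPn => // _.
have [u0|u0] := eqVneq u [::].
  rewrite andbT u0 xcat_nil; have [->|x0] /= := eqVneq x dc_root; first by [].
  by rewrite eq_sym anc_neq.
rewrite andbF /= anc_xcat//.
have -> : (xcat x v == xcat x (take (size u).-1 u)) = (v == take (size u).-1 u).
  apply/eqP/eqP => [/xcat_inj->//|<-//]; exact: etake.
by [].
Qed.

End Translation.

Section ConeLaws.
Context (R : realType) (G : countType) (edge : rel G) (i0 : G).
Context (pG : G -> G -> R) (pb : G -> R).
Context (d : measure_display) (W : measurableType d).
Let T := dcover edge i0.
Context (P : T -> probability W R) (X : nat -> W -> T).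
Hypothesis hpG : graph_transitions edge pG.
Hypothesis hpb : backward_probabilities pb.
Hypothesis hX : markov_family (ptree pG pb) P X.
Let root : T := dc_root.
Let PT := path_law root hX.
Let path_ := pathspace root.

Lemma cone_cylinder_eq x y n (us : nat -> seq G) :
  dc_label x = dc_label y -> us 0%N = [::] ->
  (forall k, (k <= n)%N -> path edge (dc_label x) (us k)) ->
  (forall k, (k < n)%N -> [|| us k != [::], us k.+1 != [::] |
     (x != dc_root) && (y != dc_root)]) ->
  PT x (cyl root n.+1 (xcat x \o us)) = PT y (cyl root n.+1 (xcat y \o us)).
Proof.
move=> xy us0; elim: n => [|n IHn] v c.
  have E z : PT z (cyl root 1 (xcat z \o us)) = 1%E.
    rewrite -(path_law_start root hX z); congr (path_law _ _ _ _).
    apply/seteqP; split => [f /(_ 0%N isT)|f /= f0 [|//] _].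
      by rewrite /= us0 xcat_nil.
    by rewrite /= us0 xcat_nil.
  by rewrite !E.
have vn := v n (leqnSn n); have vS := v n.+1 (leqnn _).
rewrite /PT !path_law_cylS -!/PT IHn => [|k kn|k kn]; last 2 first.
- by apply: v; exact: leqW.
- by apply: c; exact: leqW.
have := c n (ltnSn n) => cn; congr (_ * _%:E)%E => /=.
have cx : [|| us n != [::], us n.+1 != [::] | x != dc_root].
  by move: cn => /or3P[->|->|/andP[->]]; rewrite ?orbT.
have cy : [|| us n != [::], us n.+1 != [::] | y != dc_root].
  by move: cn => /or3P[->|->|/andP[_ ->]]; rewrite ?orbT.
by rewrite !ptree_xcat -?xy.
Qed.

(** Summation of [cone_cylinder_eq] over relative trajectories. Standing still at the apex is
    allowed only when neither apex is the root. *)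
Lemma cone_event_eq x y n (A : set (seq (seq G))) :
  dc_label x = dc_label y ->
  (forall us, A us -> [/\ size us = n.+1, nth [::] us 0 = [::],
     (forall k, (k <= n)%N -> path edge (dc_label x) (nth [::] us k)) &
     (forall k, (k < n)%N -> [|| nth [::] us k != [::], nth [::] us k.+1 != [::] |
     (x != dc_root) && (y != dc_root)])]) ->
  PT x [set f | (map (xcat x) @` A) (mkseq f n.+1)] =
  PT y [set f | (map (xcat y) @` A) (mkseq f n.+1)].
Proof.
move=> xy hA.
have mF : dmeas (fun f : path_ => mkseq f n.+1).
  exact: (dmeas_mkseq (f := fun k (f : path_) => f k)) (@dmeas_coord T root).
have E z : dc_label z = dc_label x ->
    PT z [set f | (map (xcat z) @` A) (mkseq f n.+1)] =
    (\esum_(us in A) PT z (cyl root n.+1 (xcat z \o nth [::] us)))%E.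
  move=> zx.
  have -> : [set f : path_ | (map (xcat z) @` A) (mkseq f n.+1)] =
     setT `&` (fun f : path_ => mkseq f n.+1) @^-1` (map (xcat z) @` A).
    by rewrite setTI.
  rewrite measure_fibers// esum_image; last first.
    move=> us vs; rewrite !inE => /hA[su _ hu _] /hA[sv _ hv _] e.
    apply: (@eq_from_nth _ [::]); first by rewrite su sv.
    move=> k; rewrite su ltnS => kn.
    apply: (@xcat_inj G edge i0 z); rewrite ?zx ?hu ?hv//.
    by rewrite -!(nth_map _ dc_root) ?su ?sv ?ltnS// e.
  apply: eq_esum => us /hA[su _ _ _]; rewrite setTI; congr (PT z _).
  apply/seteqP; split => [f /= fus k kn|f fus].
    rewrite /= -(nth_map _ dc_root) ?su// -fus nth_mkseq//.
  apply: (@eq_from_nth _ dc_root); first by rewrite size_mkseq size_map su.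
  move=> k; rewrite size_mkseq => kn; rewrite nth_mkseq// fus// (nth_map [::])//.
  by rewrite su.
rewrite !E//; apply: eq_esum => us /hA[su u0 hu hc].
exact: cone_cylinder_eq.
Qed.

(* Excursions from [x] back to [x]; their total mass over all durations is
   [Gbar (dc_label x)]. *)
Definition bubble (x : T) (s : nat) : set path_ :=
  [set f | f s = x /\ forall m, (m <= s)%N -> cone x (f m)].

Definition gb x s : R := fine (PT x (bubble x s)).

Definition last_exit (x : T) : set path_ :=
  [set f | f 0%N = x /\ forall m, cone x (f m.+1) /\ f m.+1 != x].

Definition es x : R := fine (PT x (last_exit x)).

Lemma bubble_local x s : local_at s (bubble x s).
Proof.
move=> f g fg [fs fm]; rewrite /bubble /= -fg//; split => // m ms.
by rewrite -fg// fm.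
Qed.

Lemma measurable_bubble x s : measurable (bubble x s).
Proof. exact: (local_measurable (@bubble_local x s)). Qed.

Let surv x n : set path_ :=
  [set f | f 0%N = x /\ forall m, (m < n)%N -> cone x (f m.+1) /\ f m.+1 != x].

Let surv_measurable x n : measurable (surv x n).
Proof.
apply: (@local_measurable T root n) => f g fg [f0 fm]; split; first by rewrite -fg.
by move=> m mn; rewrite -fg//; exact: fm.
Qed.

Let last_exitE x : last_exit x = \bigcap_n surv x n.
Proof.
apply/seteqP; split => [f [f0 fm] n _|f h]; first by split.
by split => [|m]; [have [] := h 0%N I|have [_ /(_ m (ltnSn m))] := h m.+1 I].
Qed.

Lemma measurable_last_exit x : measurable (last_exit x).
Proof. by rewrite last_exitE; apply: bigcapT_measurable. Qed.

Lemma gbE x s : PT x (bubble x s) = (gb x s)%:E.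
Proof. by rewrite fineK// path_law_fin//; exact: measurable_bubble. Qed.

Lemma esE x : PT x (last_exit x) = (es x)%:E.
Proof. by rewrite fineK// path_law_fin//; exact: measurable_last_exit. Qed.

Lemma gb_ge0 x s : 0 <= gb x s. Proof. exact: fine_ge0. Qed.

Lemma es_ge0 x : 0 <= es x. Proof. exact: fine_ge0. Qed.

Let relpaths i n (Q : set (seq (seq G))) : set (seq (seq G)) :=
  [set us | [/\ size us = n.+1, nth [::] us 0 = [::],
    forall k, (k <= n)%N -> path edge i (nth [::] us k) & Q us]].

(* Describing an event inside the cone of [x] by relative coordinates. *)
Let cone_eventE x n (Q : set (seq (seq G))) (E : set path_) :
  (forall f, E f -> f 0%N = x /\ forall k, (k <= n)%N -> cone x (f k)) ->
  (forall f us, (forall k, (k <= n)%N -> f k = xcat x (nth [::] us k)) ->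
     relpaths (dc_label x) n setT us -> E f <-> Q us) ->
  E = [set f | (map (xcat x) @` relpaths (dc_label x) n Q) (mkseq f n.+1)].
Proof.
move=> EC EQ; apply/seteqP; split => [f Ef|f [us [su u0 hu Qu] e]].
  have [f0 fC] := EC f Ef.
  pose us := mkseq (fun k => drop (hgt x) (val (f k))) n.+1.
  have uf k : (k <= n)%N -> f k = xcat x (nth [::] us k).
    by move=> kn; rewrite nth_mkseq//; have [_ ->] := xcat_cone (fC k kn).
  have rus : relpaths (dc_label x) n setT us.
    split => //; first by rewrite size_mkseq.
      by rewrite nth_mkseq// f0 drop_size.
    by move=> k kn; rewrite nth_mkseq//; have [] := xcat_cone (fC k kn).
  exists us; first by case: rus => ? ? ? _; split => //; apply/(EQ f us).
  apply: (@eq_from_nth _ dc_root); first by rewrite size_map !size_mkseq.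
  move=> k; rewrite size_map size_mkseq => kn.
  by rewrite (nth_map [::]) ?size_mkseq// -uf// [RHS]nth_mkseq.
apply/(EQ f us) => // k kn.
by rewrite -(nth_map _ dc_root) ?su// e nth_mkseq.
Qed.

(** The root is excluded because its excursions may use the loop. *)
Lemma gb_label x y s : x != dc_root -> y != dc_root ->
  dc_label x = dc_label y -> gb x s = gb y s.
Proof.
move=> x0 y0 xy; rewrite /gb; congr fine.
have A z : PT z (bubble z s) = PT z (bubble z s `&` [set f : path_ | f 0%N = z]).
  by rewrite /PT path_law_ae_start//; exact: measurable_bubble.
rewrite !A.
pose Q : set (seq (seq G)) := [set us | nth [::] us s = [::]].
have E z : bubble z s `&` [set f : path_ | f 0%N = z] =
    [set f | (map (xcat z) @` relpaths (dc_label z) s Q) (mkseq f s.+1)].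
  apply: cone_eventE => [f [[fs fm] f0]|f us fu [su u0 hu _]]; first by split.
  split => [[[fs _] _]|us0].
    apply: (@xcat_inj G edge i0 z) => //; first exact: hu.
    by rewrite -fu// fs xcat_nil.
  split; last by rewrite /= fu// u0 xcat_nil.
  split => [|m ms]; rewrite fu// ?us0 ?xcat_nil//.
  by apply: cone_xcat; exact: hu.
rewrite !E xy; apply: cone_event_eq => // us [su u0 hu _]; split => //.
  by rewrite xy.
by move=> k _; rewrite x0 y0 !orbT.
Qed.

(** A path that never comes back to its starting vertex cannot use the loop, so here the root may be
    included. The event is not local; it is the decreasing limit of its finite-horizon versions
    [surv], to which the comparison by relative trajectories applies. *)
Lemma es_label x y : dc_label x = dc_label y -> es x = es y.
Proof.
move=> xy; rewrite /es; congr fine.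
have S n : PT x (surv x n) = PT y (surv y n).
  pose Q : set (seq (seq G)) := [set us | forall m, (m < n)%N -> nth [::] us m.+1 != [::]].
  have E z : surv z n =
      [set f | (map (xcat z) @` relpaths (dc_label z) n Q) (mkseq f n.+1)].
    apply: cone_eventE => [f [f0 fm]|f us fu [su u0 hu _]].
      by split => // -[|k] kn; [rewrite f0 cone_refl|have [] := fm k kn].
    split => [[f0 fm] m mn|us0].
      have [_] := fm m mn; apply: contra => /eqP u; apply/eqP.
      by rewrite fu// u xcat_nil.
    split => [|m ms]; first by rewrite fu// u0 xcat_nil.
    rewrite fu//; split; first by apply: cone_xcat; exact: hu.
    apply: contra (us0 m ms) => /eqP e; apply/eqP.
    by apply: (@xcat_inj G edge i0 z); rewrite ?xcat_nil//; exact: hu.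
  rewrite !E xy; apply: cone_event_eq => // us [su u0 hu Qu]; split => //.
    by rewrite xy.
  by move=> k kn; rewrite Qu// orbT.
have L z : PT z (surv z n) @[n --> \oo] --> PT z (last_exit z).
  rewrite last_exitE; apply: nonincreasing_cvg_mu.
  - by rewrite (le_lt_trans (path_law_le1 _ _ _))// ltry.
  - by [].
  - by rewrite -last_exitE; exact: measurable_last_exit.
  - move=> m n mn; apply/subsetPset => f [f0 fm]; split => // k km.
    by apply: fm; exact: leq_trans km mn.
rewrite -(cvg_lim _ (L x))// -(cvg_lim _ (L y))//.
by under eq_fun do rewrite S.
Qed.

End ConeLaws.

(** * Excursions, escapes and last-exit words as functions of labels *)

Section LabelLaws.
Context (R : realType) (G : countType) (edge : rel G) (i0 : G).
Context (pG : G -> G -> R) (pb : G -> R).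
Context (d : measure_display) (W : measurableType d).
Let T := dcover edge i0.
Context (P : T -> probability W R) (X : nat -> W -> T).
Hypothesis Gconn : strongly_connected edge.
Hypothesis hpG : graph_transitions edge pG.
Hypothesis hpb : backward_probabilities pb.
Hypothesis hX : markov_family (ptree pG pb) P X.
Let root : T := dc_root.
Let PT := path_law root hX.
Let path_ := pathspace root.
Let sv (i : G) : T := some_vertex edge i0 i.

Lemma out_edge i : exists j, edge i j.
Proof.
case: hpG => _ e s; apply: contrapT => h.
have : (\esum_(j in [set: G]) (pG i j)%:E = 0)%E.
  apply: esum1 => j _; congr EFin; apply/eqP; rewrite eq_le.
  case: hpG => -> _ _; rewrite andbT leNgt; apply/negP => /e ij.
  by apply: h; exists j.
by rewrite s => /eqP; rewrite onee_eq0.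
Qed.

Lemma some_vertexP i : sv i <> root /\ dc_label (sv i) = i.
Proof.
apply: (@xgetPex _ root [set x : T | x <> dc_root /\ dc_label x = i]).
have [j ej] := out_edge i0; have [s es ls] := Gconn j i.
exists (xcat dc_root (j :: s)).
have e : path edge (@dc_label G edge i0 dc_root) (j :: s) by rewrite /= ej.
split; last by rewrite label_xcat.
by move=> /(congr1 val); rewrite val_xcat.
Qed.

Lemma sv_neq_root i : sv i != root. Proof. by apply/eqP; case: (some_vertexP i). Qed.

Lemma label_sv i : dc_label (sv i) = i. Proof. by case: (some_vertexP i). Qed.

(* Excursion and escape probabilities, as functions of the label alone. *)
Definition gl (i : G) (s : nat) : R := gb hX (sv i) s.
Definition el (i : G) : R := es hX (sv i).

Lemma gb_gl x s : x != dc_root -> gb hX x s = gl (dc_label x) s.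
Proof. by move=> x0; apply: gb_label => //; rewrite ?sv_neq_root ?label_sv. Qed.

Lemma es_el x : es hX x = el (dc_label x).
Proof. by apply: es_label; rewrite label_sv. Qed.

Lemma gl_ge0 i s : 0 <= gl i s. Proof. exact: gb_ge0. Qed.

Lemma el_ge0 i : 0 <= el i. Proof. exact: es_ge0. Qed.

Lemma gl0 i : gl i 0 = 1.
Proof.
apply/EFin_inj; rewrite -gbE -(path_law_start root hX (sv i)); congr (path_law _ _ _ _).
apply/seteqP; split => [f [] //|f /= f0]; split => // -[|//] _.
by rewrite f0 cone_refl.
Qed.

(** [Gbar] is defined by avoiding the ancestor, a bubble by staying in the cone. On legal paths
    these conditions agree, since a cone can be left only through the ancestor of its apex. *)
Lemma Gbar_esum i : Gbar P X i = fine (\sum_(n <oo) (gl i n)%:E)%E.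
Proof.
rewrite /Gbar -/sv; congr fine; apply: eq_eseriesr => n _.
rewrite /gl -gbE.
pose E : set path_ := [set f | f n = sv i /\
  forall m, (m < n)%N -> f m <> dc_anc (sv i)].
have mE : measurable E.
  apply: (@local_measurable T root n) => f g fg [fn fm]; split; first by rewrite -fg.
  by move=> m mn; rewrite -fg ?(ltnW mn)//; exact: fm.
transitivity (PT (sv i) E); first by rewrite path_lawE.
rewrite /PT -(path_law_legal hX _ mE) -(path_law_legal hX _ (measurable_bubble _ _)).
congr (path_law _ _ _ _); apply/seteqP; split => f [[fn fm] fl]; split => //; split => //.
  elim=> [|m IHm] mn; first by case: fl => -> _; exact: cone_refl.
  have := IHm (ltnW mn) => cm; apply/negPn/negP => ncm.
  case: fl => _ /(_ m) /ptree_step st; have [_ fS] := step_cone cm st ncm.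
  move: mn; rewrite leq_eqVlt => /predU1P[mn|mn]; last exact: fm _ mn fS.
  by move: ncm; rewrite mn fn cone_refl.
move=> m mn fa; have := cone_hgt (fm m (ltnW mn)).
by rewrite fa (hgt_anc (sv_neq_root i)) ltnn.
Qed.

Section Decay.
Variable eps : R.
Hypothesis eps0 : 0 < eps.
Hypothesis eps_pb : forall i, eps <= pb i.
Hypothesis eps_pfwd : forall i j, edge i j -> eps <= pfwd pG pb i j.
Variables (C r : R).
Hypotheses (C0 : 0 < C) (r0 : 0 < r) (r1 : r < 1).
Hypothesis decay : forall n, (PT root [set f | f n = root] <= (C * r ^+ n)%:E)%E.

Lemma gl_le i s : gl i s <= r ^+ s.
Proof.
rewrite -lee_fin -gbE; have h := return_le eps0 eps_pb eps_pfwd r0 decay (sv i) s.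
apply: le_trans h; apply: le_path_law.
- exact: measurable_bubble.
- exact: (@measurable_at T root s [set sv i]).
- by move=> f [].
Qed.

Lemma sum_gl i : (\sum_(s <oo) (gl i s)%:E = (Gbar P X i)%:E)%E.
Proof.
rewrite Gbar_esum fineK// ge0_fin_numE; last first.
  by apply: nneseries_ge0 => s _; rewrite lee_fin gl_ge0.
apply: (@le_lt_trans _ _ (\sum_(s <oo) (1 * r ^+ s)%:E)%E).
  by apply: lee_nneseries => s _; rewrite ?lee_fin ?gl_ge0// mul1r gl_le.
by rewrite nneseries_geometric ?(ltW r0)// ltry.
Qed.

Lemma Gbar_ge1 i : 1 <= Gbar P X i.
Proof.
rewrite -lee_fin -sum_gl nneseries_recl => [|k _|//]; last by rewrite lee_fin gl_ge0.
rewrite gl0 leeDl//; apply: nneseries_ge0 => s _ _; rewrite lee_fin; exact: gl_ge0.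
Qed.

Lemma Gbar_le i : Gbar P X i <= (1 - r)^-1.
Proof.
rewrite -lee_fin -sum_gl -[X in (_ <= X%:E)%E]mul1r -nneseries_geometric ?(ltW r0)//.
by apply: lee_nneseries => s _; rewrite ?lee_fin ?gl_ge0// mul1r gl_le.
Qed.

(** Mean excursion lengths are bounded uniformly in the label. With [r = a * q] and both factors
    below 1, the polynomial factor is absorbed by [a]: [(s+1) * a ^ s] is at most the geometric sum
    of [a], and [q ^ s] remains summable. *)
Lemma sum_gl_time : exists K : R, forall i,
  (\sum_(s <oo) (s.+1%:R * gl i s)%:E <= K%:E)%E.
Proof.
pose q := (1 + r) / 2; have [q0 q1 rq] : [/\ 0 < q, q < 1 & r < q].
  by split; rewrite /q; move: r0 r1; lra.
pose a := r / q; have a0 : 0 < a by rewrite divr_gt0.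
have a1 : a < 1 by rewrite ltr_pdivrMr// mul1r.
exists ((1 - a)^-1 * (1 - q)^-1) => i.
rewrite -nneseries_geometric ?(ltW q0)//; apply: lee_nneseries => s _.
  by rewrite lee_fin mulr_ge0// gl_ge0.
rewrite lee_fin; apply: (@le_trans _ _ (s.+1%:R * r ^+ s)).
  by rewrite ler_wpM2l// gl_le.
have -> : r = a * q by rewrite /a divfK// gt_eqF.
rewrite exprMn mulrA ler_wpM2r ?exprn_ge0 ?(ltW q0)//.
have := @geometric_le_lim R s.+1 1 a ler01 a0; rewrite ger0_norm ?(ltW a0)// mul1r.
move=> /(_ a1); apply: le_trans; rewrite /series /= big_mkord.
rewrite -[X in X%:R](card_ord s.+1) -sum1_card natr_sum mulr_suml.
apply: ler_sum => k _; rewrite !mul1r; apply: ler_wiXn2l; rewrite ?(ltW a0) ?(ltW a1)//.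
by rewrite -ltnS.
Qed.

End Decay.

Fixpoint wt (i : G) (v : seq (G * nat)) : R :=
  if v is (j, s) :: v' then pfwd pG pb i j * gl j s * wt j v' else 1.

Fixpoint endv (x : T) (v : seq (G * nat)) : T :=
  if v is (j, s) :: v' then endv (chd x j) v' else x.

(* The path starts at [x], and its successive last exits from the vertices of
   the ray towards infinity happen along the labels and after the bubble
   lengths recorded in [v]. *)
Fixpoint follows (x : T) (v : seq (G * nat)) : set path_ :=
  if v is (j, s) :: v' then
    [set f | [/\ edge (dc_label x) j, f 0%N = x,
       bubble (chd x j) s (shift 1 f) & follows (chd x j) v' (shift s.+1 f)]]
  else last_exit x.

Lemma measurable_follows x v : measurable (follows x v).
Proof.
elim: v x => [|[j s] v IHv] x; first exact: measurable_last_exit.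
have [e|e] := boolP (edge (dc_label x) j); last first.
  rewrite (_ : follows _ _ = set0)//; apply/seteqP; split => // f [+ _ _ _].
  exact/negP.
have -> : follows x ((j, s) :: v) = [set f : path_ | f 0%N = x] `&`
    (shift 1 @^-1` bubble (chd x j) s `&` shift s.+1 @^-1` follows (chd x j) v).
  by apply/seteqP; split => f /=; [case|case=> ? []].
apply: measurableI; first exact: (@measurable_at T root 0 [set x]).
apply: measurableI.
  exact: (@shift_measurable T root 1 _ (measurable_bubble (chd x j) s)).
exact: (@shift_measurable T root s.+1 _ (IHv (chd x j))).
Qed.

(** The Markov property at time [s + 1], the end of the first bubble, splits off the factor of the
    first letter. Only the escape from the final vertex survives at the end of the induction. *)
Lemma follows_law x v : PT x (follows x v) =
  (wt (dc_label x) v * el (dc_label (endv x v)))%:E.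
Proof.
elim: v x => [|[j s] v IHv] x; first by rewrite mul1r -es_el -esE.
have [e|e] := boolP (edge (dc_label x) j); last first.
  have -> : follows x ((j, s) :: v) = set0.
    by apply/seteqP; split => // f [+ _ _ _]; exact/negP.
  by rewrite measure0 /= (pfwd_eq0 hpG hpb e) !mul0r.
set y := chd x j.
pose Q : set (nat -> T) := [set f | f 0%N = x] `&` shift 1 @^-1` bubble y s.
have lQ : local_at s.+1 Q.
  apply: localI; first by move=> f g fg /=; rewrite fg.
  have lb : local_at s (bubble y s) by exact: bubble_local.
  rewrite -add1n; exact: shift_local lb.
have -> : follows x ((j, s) :: v) =
    Q `&` [set f | f s.+1 = y] `&` shift s.+1 @^-1` follows y v.
  apply/seteqP; split => [f [_ f0 fb fv]|f [[[f0 fb] fy] fv]]; last by split.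
  by split => //; split => //; case: fb.
rewrite /PT path_law_markov//; last exact: measurable_follows.
rewrite -/PT IHv /= label_chd//.
suff -> : PT x (Q `&` [set f | f s.+1 = y]) = (pfwd pG pb (dc_label x) j * gl j s)%:E.
  by rewrite -EFinM; congr EFin; ring.
pose Q1 : set (nat -> T) := setT.
have lQ1 : local_at 1 Q1 by [].
have mB := measurable_bubble y s.
have := path_law_markov hX x y lQ1 mB; rewrite setTI path_law_step gbE gb_gl ?chd_neq_root//.
rewrite ptree_chd// -EFinM label_chd// => <-; rewrite -/PT.
have mL : measurable ([set f : path_ | f 1%N = y] `&` shift 1 @^-1` bubble y s).
  apply: measurableI; first exact: (@measurable_at T root 1 [set y]).
  exact: (@shift_measurable T root 1 _ mB).
have mQ : measurable ((Q `&` [set f | f s.+1 = y]) : set path_).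
  apply: (@local_measurable T root s.+1); apply: localI lQ _.
  exact: (@local_coord T s.+1 [set y]).
(* The bubble condition only says that the path is in the cone of [y] at time 1. On a legal path
   from [x] the height is then at most that of [y], which forces the position to be [y] itself. *)
rewrite /PT -(path_law_legal hX _ mQ) -[RHS](path_law_legal hX _ mL); congr (path_law _ _ _ _).
apply/seteqP; split => f [fQ fl]; split => //.
  case: fQ => -[f0 fb] _; split => //=.
  have c1 : cone y (f 1%N) by have [_ /(_ 0%N isT)] := fb.
  have [h1 _] := step_hgt (ptree_step (fl.2 0%N)).
  apply/esym/(cone_eq c1)/eqP; rewrite eqn_leq cone_hgt//=.
  by move: h1; rewrite f0 /y hgt_chd.
by case: fQ => f1 fb; split; [split=> //; exact: fl.1|case: fb].
Qed.

End LabelLaws.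

Lemma ge0_integral_discrete (R : realType) d (W : measurableType d)
    (mu : {measure set W -> \bar R}) (U : countType) (f : W -> U) (F : U -> R)
    (D : set W) : measurable D -> dmeas f -> (forall u, 0 <= F u) ->
  (\int[mu]_(x in D) (F (f x))%:E =
   \esum_(u in setT) ((F u)%:E * mu (D `&` [set w | f w = u])))%E.
Proof.
move=> mD mf F0.
pose E n := if pickle_inv n is Some u then D `&` [set w | f w = u] else set0.
have mE n : measurable (E n).
  by rewrite /E; case: pickle_inv => // u; apply: measurableI => //; exact: (mf [set u]).
have DE : D = \bigcup_n E n.
  apply/seteqP; split => [w Dw|w [n _]].
    by exists (pickle (f w)) => //; rewrite /E pickleK_inv.
  by rewrite /E; case: pickle_inv => // u [].
have mFf : measurable_fun setT (fun x => (F (f x))%:E).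
  exact: (@dmeas_measurable_fun _ _ _ _ _ f (fun u => (F u)%:E) mf).
rewrite esum_pickle; last by move=> u; rewrite mule_ge0// lee_fin.
rewrite {1}DE ge0_integral_bigcup//.
- apply: eq_eseriesr => n _; rewrite /E; case: pickle_inv => [u|] /=; last exact: integral_set0.
  rewrite -integral_cst; last by apply: measurableI => //; exact: (mf [set u]).
  by apply: eq_integral => w; rewrite inE => -[_ /= ->].
- exact: measurable_funTS.
- by move=> x _; rewrite lee_fin.
- apply/trivIsetP => i j _ _ ij; apply/seteqP; split => // w [].
  rewrite /E; have := @pickle_invK U i; have := @pickle_invK U j.
  case: pickle_inv => [u|]//=; case: pickle_inv => [v|]//= uj vi [_ /= fv] [_ /= fu].
  by move: ij; rewrite -uj -vi -fu -fv eqxx.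
Qed.

(** * Strong law along cycles *)

Section Cycles.
Context (R : realType) (G : countType) (a : G).
Let S : countType := (G * nat)%type.
Let s0 : S := (a, 0%N).
Let Om := pathspace s0.
Variable (wgt : G -> G -> nat -> R) (h : G -> R).
Hypothesis wgt_ge0 : forall i j s, 0 <= wgt i j s.

Fixpoint word_weight (i : G) (v : seq S) : R :=
  if v is (j, s) :: v' then wgt i j s * word_weight j v' else 1.

Definition last_label (i : G) (v : seq S) : G := last i (map fst v).

Lemma word_weight_ge0 i v : 0 <= word_weight i v.
Proof. by elim: v i => [|[j s] v IHv] i //=; rewrite mulr_ge0. Qed.

Lemma word_weight_cat i u v :
  word_weight i (u ++ v) = word_weight i u * word_weight (last_label i u) v.
Proof.
elim: u i => [|[j s] u IHu] i /=; first by rewrite mul1r.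
by rewrite IHu mulrA.
Qed.

Lemma last_label_cat i u v :
  last_label i (u ++ v) = last_label (last_label i u) v.
Proof. by rewrite /last_label map_cat last_cat. Qed.

Definition starts_with (v : seq S) : set Om := [set f | mkseq f (size v) = v].

Lemma starts_withE v : starts_with v = cyl s0 (size v) (nth s0 v).
Proof.
apply/seteqP; split => [f fv k kv|f fv]; first by rewrite -[in RHS]fv nth_mkseq.
apply: (@eq_from_nth _ s0); rewrite ?size_mkseq// => k kv.
by rewrite nth_mkseq// fv.
Qed.

Lemma cyl_starts_with n g : cyl s0 n g = starts_with (mkseq g n).
Proof.
rewrite starts_withE size_mkseq; apply/seteqP.
by split => f fg k kn; rewrite fg// nth_mkseq.
Qed.

Lemma starts_with_cat u v : starts_with (u ++ v) =
  starts_with u `&` shift (size u) @^-1` starts_with v.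
Proof.
have E (f : nat -> S) : mkseq f (size (u ++ v)) = mkseq f (size u) ++ mkseq (shift (size u) f) (size v).
  rewrite size_cat /mkseq iotaD map_cat add0n -[X in iota X (size v)](addn0 (size u)).
  by rewrite iotaDl -map_comp.
apply/seteqP; split => f; rewrite /starts_with /= E.
  by move/eqP; rewrite eqseq_cat ?size_mkseq// => /andP[/eqP ? /eqP ?].
by move=> [-> ->].
Qed.

Lemma measurable_starts_with v : measurable (starts_with v).
Proof. by rewrite starts_withE; exact: cyl_measurable. Qed.

Variable Q : probability Om R.
Hypothesis h0 : h a != 0.
Hypothesis QE : forall v, Q (starts_with v) =
  ((h a)^-1 * (word_weight a v * h (last_label a v)))%:E.

(** Words list the labels that are reached and omit the starting label [a], so these are the
    first-return words: [a] occurs only as the last label. *)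
Fixpoint is_cycle (v : seq S) : bool :=
  if v is x :: v' then if x.1 == a then v' == [::] else is_cycle v' else false.

Lemma is_cycleP v : is_cycle v ->
  exists v' s, v = rcons v' (a, s) /\ all (fun x => x.1 != a) v'.
Proof.
elim: v => // -[j s] v IHv /=; case: eqVneq => [-> /eqP ->|ja /IHv[v' [t [-> al]]]].
  by exists [::], s.
by exists ((j, s) :: v'), t; rewrite /= ja.
Qed.

Lemma cycle_last v : is_cycle v -> last_label a v = a.
Proof. by move=> /is_cycleP[v' [s [-> _]]]; rewrite /last_label map_rcons last_rcons. Qed.

(** A cycle leads from [a] back to [a], so the factor [h (last_label a _)] of a longer word does not
    see it and the weights multiply: after a cycle the sequence starts afresh with law [Q]. *)
Lemma cycle_markov v (B : set Om) : is_cycle v -> measurable B ->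
  Q (starts_with v `&` shift (size v) @^-1` B) = ((word_weight a v)%:E * Q B)%E.
Proof.
move=> cv mB; rewrite -[in RHS](setTI B).
apply: (path_measure_unique (phi2 := id) (word_weight_ge0 a v)
  (measurable_starts_with v) measurableT (@dmeas_shift S s0 (size v))
  (@dmeas_coord S s0)) => //.
  by rewrite (le_lt_trans (probability_le1 _ _))// ?ltry//; exact: measurable_starts_with.
move=> n g; rewrite setTI preimage_id.
have E : Q (starts_with v `&` shift (size v) @^-1` cyl s0 n g) =
    ((word_weight a v)%:E * Q (cyl s0 n g))%E.
  rewrite cyl_starts_with -starts_with_cat !QE word_weight_cat last_label_cat.
  by rewrite cycle_last// -EFinM; congr EFin; ring.
exact: E.
Qed.

(* The value 1 when there is no return is irrelevant. *)
Definition ret_time (f : Om) : nat :=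
  if pselect (exists k, (f k).1 == a) is left e then (ex_minn e).+1 else 1%N.

Definition theta (f : Om) : Om := shift (ret_time f) f.

Definition cycle0 (f : Om) : seq S := mkseq f (ret_time f).

Lemma cycle0_eq v f : is_cycle v -> (cycle0 f = v) <-> starts_with v f.
Proof.
move=> /is_cycleP[v' [s [-> al]]]; split => [<-|fv].
  by rewrite /starts_with /= /cycle0 size_mkseq.
rewrite /cycle0; suff -> : ret_time f = size (rcons v' (a, s)) by [].
have fn : (f (size v')).1 == a.
  have := congr1 (nth s0 ^~ (size v')) fv.
  by rewrite size_rcons nth_mkseq// nth_rcons ltnn eqxx => ->.
rewrite /ret_time; case: pselect => [e|[]]; last by exists (size v').
rewrite size_rcons; congr _.+1; case: ex_minnP => m fm hm; apply/eqP.
rewrite eqn_leq hm//= leqNgt; apply/negP => mv.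
have := congr1 (nth s0 ^~ m) fv.
rewrite size_rcons nth_mkseq ?ltnS ?(ltnW mv)// nth_rcons mv => fmv.
by move/(all_nthP s0)/(_ m mv): al; rewrite -fmv fm.
Qed.

Lemma dmeas_ret_time : dmeas ret_time.
Proof.
apply: dmeas_fibers => -[|[|n]].
- rewrite (_ : [set _ | _] = set0)//; apply/seteqP; split => // f /=.
  by rewrite /ret_time; case: pselect.
(* Through the default value this fibre also contains the sequences without return. *)
- have -> : [set f | ret_time f = 1%N] = [set f : Om | (f 0%N).1 == a] `|`
      \bigcap_k [set f : Om | (f k).1 != a].
    apply/seteqP; split => f /=; rewrite /ret_time.
      case: pselect => [e|ne _]; first by case: ex_minnP => m fm _ [m0]; left; rewrite -m0.
      by right => k _; apply/negP => fk; apply: ne; exists k.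
    case: pselect => // e; case: ex_minnP => m fm hm [/hm|/(_ m I)/=].
      by rewrite leqn0 => /eqP ->.
    by rewrite fm.
  apply: measurableU; first exact: (@measurable_at S s0 0 [set u | u.1 == a]).
  apply: bigcapT_measurable => k; exact: (@measurable_at S s0 k [set u | u.1 != a]).
- apply: (@local_measurable S s0 n.+1) => f g fg /=; rewrite /ret_time.
  case: pselect => // e; case: ex_minnP => m fm hm [mn].
  rewrite mn in fm hm.
  have gn : (g n.+1).1 == a by rewrite -fg.
  case: pselect => [e'|[]]; last by exists n.+1.
  case: ex_minnP => m' gm hm'; congr _.+1; apply/eqP; rewrite eqn_leq hm'//=.
  have [//|mn'] := leqP n.+1 m'.
  by have := hm m'; rewrite fg ?(ltnW mn')// gm => /(_ isT); rewrite leqNgt mn'.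
Qed.

Lemma dmeas_cycle0 : dmeas cycle0.
Proof.
apply: dmeas_fibers => v.
have -> : [set f | cycle0 f = v] = ret_time @^-1` [set size v] `&` starts_with v.
  apply/seteqP; split => f; rewrite /starts_with /cycle0 /preimage /=.
    by move=> <-; rewrite size_mkseq.
  by move=> [-> ->].
by apply: measurableI; [exact: dmeas_ret_time|exact: measurable_starts_with].
Qed.

Lemma measurable_theta : measurable_fun setT theta.
Proof.
move=> _ B mB; rewrite setTI.
have -> : theta @^-1` B = \bigcup_n (ret_time @^-1` [set n] `&` shift n @^-1` B).
  apply/seteqP; split => [f fB|f [n _ [/= <-]]//].
  by exists (ret_time f).
apply: bigcupT_measurable => n; apply: measurableI; first exact: dmeas_ret_time.
exact: (@shift_measurable S s0 n B mB).
Qed.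

Hypothesis cycle_total : (\esum_(v in [set v | is_cycle v]) (word_weight a v)%:E = 1)%E.

Lemma cycle0_theta v (B : set Om) : is_cycle v -> measurable B ->
  Q ([set f | cycle0 f = v] `&` theta @^-1` B) = ((word_weight a v)%:E * Q B)%E.
Proof.
move=> cv mB; rewrite -(cycle_markov cv mB); congr (Q _).
have E f : cycle0 f = v -> theta f = shift (size v) f.
  by move=> <-; rewrite /theta /cycle0 size_mkseq.
apply/seteqP; split => f [fv fB]; split; [exact/(cycle0_eq f cv)| |exact/(cycle0_eq f cv)|].
  by rewrite /= -(E f fv).
by rewrite /= (E f)//; exact/(cycle0_eq f cv).
Qed.

Lemma cycle0_law v : is_cycle v ->
  Q [set f | cycle0 f = v] = (word_weight a v)%:E.
Proof.
move=> cv; have := cycle0_theta cv measurableT.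
by rewrite preimage_setT setIT probability_setT mule1.
Qed.

(** The fibres of [cycle0] over cycles are disjoint, and by [cycle_total] their masses add up to 1;
    hence a return to [a] occurs almost surely. *)
Lemma ae_cycle0 : Q (cycle0 @^-1` [set v | is_cycle v]) = 1%E.
Proof.
rewrite -[X in Q X]setTI measure_fibers//; last exact: dmeas_cycle0.
rewrite -[RHS]cycle_total; apply: eq_esum => v cv; rewrite setTI; exact: cycle0_law.
Qed.

Lemma measure_cycle0 (D : set Om) : measurable D ->
  Q D = (\esum_(v in [set v | is_cycle v]) Q (D `&` [set f | cycle0 f = v]))%E.
Proof.
move=> mD; rewrite -measure_fibers//; last exact: dmeas_cycle0.
set A := cycle0 @^-1` _; have mA : measurable A by exact: dmeas_cycle0.
have A0 : Q (~` A) = 0%E by rewrite probability_setC// ae_cycle0 subee.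
rewrite -[in LHS](setIT D) -(setUv A) setIUr measureU; last 3 first.
- exact: measurableI.
- by apply: measurableI => //; exact: measurableC.
- by rewrite setIACA setICr setI0.
rewrite [X in (_ + X)%E](_ : _ = 0%E) ?adde0//.
by apply: (subset_measure0 _ _ _ A0) => //; [apply: measurableI => //; exact: measurableC|exact: measurableC].
Qed.

Lemma theta_invariant (B : set Om) : measurable B -> Q (theta @^-1` B) = Q B.
Proof.
move=> mB; have mtB : measurable (theta @^-1` B).
  by rewrite -[X in measurable X]setTI; exact: measurable_theta.
rewrite measure_cycle0//; transitivity (\esum_(v in [set v | is_cycle v])
    ((fine (Q B))%:E * (word_weight a v)%:E))%E.
  by apply: eq_esum => v cv; rewrite setIC cycle0_theta// muleC fineK// fin_num_measure.
rewrite esumZl ?fine_ge0// => [|v _]; last by rewrite lee_fin word_weight_ge0.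
by rewrite cycle_total mule1 fineK// fin_num_measure.
Qed.

Lemma cycle0_null v : ~~ is_cycle v -> Q [set f | cycle0 f = v] = 0%E.
Proof.
move=> ncv; rewrite measure_cycle0; last exact: (dmeas_cycle0 [set v]).
apply: esum1 => u cu; rewrite (_ : _ `&` _ = set0) ?measure0//.
by apply/seteqP; split => // f [/= -> vu]; move: ncv; rewrite vu cu.
Qed.

(** An invariant set is its own preimage under [theta], so it is determined by what follows the
    first cycle and is independent of that cycle. *)
Lemma cycle0_indep (D : set Om) v : measurable D -> theta @^-1` D = D ->
  Q (D `&` [set f | cycle0 f = v]) = (Q D * Q (setT `&` [set f | cycle0 f = v]))%E.
Proof.
move=> mD Dth; rewrite setTI; have [cv|ncv] := boolP (is_cycle v).
  by rewrite -{1}Dth setIC cycle0_theta// cycle0_law// muleC.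
have mv : measurable [set f | cycle0 f = v] by exact: (dmeas_cycle0 [set v]).
have Qv := cycle0_null ncv.
rewrite Qv mule0; apply: (subset_measure0 _ _ _ Qv) => //.
by apply: measurableI.
Qed.

Lemma ae_all_cycles : {ae Q, forall f m, is_cycle (cycle0 (iter m theta f))}.
Proof.
apply/ae_foralln => m.
have mA : measurable (cycle0 @^-1` [set v | is_cycle v]) by exact: dmeas_cycle0.
have [mB Bm] : measurable ((fun f => cycle0 (iter m theta f)) @^-1` [set v | is_cycle v]) /\
    Q ((fun f => cycle0 (iter m theta f)) @^-1` [set v | is_cycle v]) = 1%E.
  elim: m => [|m [mB IHm]]; first by split => //; exact: ae_cycle0.
  have -> : (fun f => cycle0 (iter m.+1 theta f)) @^-1` [set v | is_cycle v] =
      theta @^-1` ((fun f => cycle0 (iter m theta f)) @^-1` [set v | is_cycle v]).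
    by apply/seteqP; split => f; rewrite /preimage /= -iterS iterSr.
  rewrite theta_invariant//; split => //.
  by rewrite -[X in measurable X]setTI; exact: measurable_theta.
have B0 : Q (~` ((fun f => cycle0 (iter m theta f)) @^-1` [set v | is_cycle v])) = 0%E.
  by rewrite probability_setC// Bm subee.
exists (~` ((fun f => cycle0 (iter m theta f)) @^-1` [set v | is_cycle v])).
by split => //; exact: measurableC.
Qed.

(** Independence of the first cycle from invariant sets gives the product formula that [strong_law]
    asks for. Nonnegativity of [F] lets all integrals be computed as countable sums. *)
Theorem cycle_strong_law (F : seq S -> R) : (forall v, 0 <= F v) ->
  (\esum_(v in [set v | is_cycle v]) ((F v * word_weight a v)%:E) < +oo)%E ->
  exists c : R,
  (\esum_(v in [set v | is_cycle v]) ((F v * word_weight a v)%:E) = c%:E)%E /\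
  {ae Q, forall f, (fun n : nat => n%:R^-1 *
    \sum_(i < n) F (cycle0 (iter i theta f))) @ \oo --> c}.
Proof.
move=> F0 Ffin.
pose g f := F (cycle0 f).
have EE D : measurable D -> (\int[Q]_(x in D) (g x)%:E =
    \esum_(v in setT) ((F v)%:E * Q (D `&` [set f | cycle0 f = v])))%E.
  by move=> mD; apply: ge0_integral_discrete => //; exact: dmeas_cycle0.
have ET : (\int[Q]_x (g x)%:E =
    \esum_(v in [set v | is_cycle v]) ((F v * word_weight a v)%:E))%E.
  rewrite EE// [RHS]esum_mkcond; apply: eq_esum => v _.
  rewrite setTI; case: ifPn => [/set_mem cv|]; first by rewrite cycle0_law// EFinM.
  by rewrite notin_setE => /= /negP ncv; rewrite cycle0_null// mule0.
have mg : measurable_fun setT g by exact: (@dmeas_measurable_fun _ _ _ _ _ cycle0 F dmeas_cycle0).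
have intg : Q.-integrable setT (EFin \o g).
  apply/integrableP; split; first exact/measurable_EFinP.
  have -> : (\int[Q]_x `|(EFin \o g) x| = \int[Q]_x (g x)%:E)%E.
    by apply: eq_integral => x _ /=; rewrite ger0_norm// /g.
  by rewrite ET.
have cfin : (\int[Q]_x (g x)%:E)%E \is a fin_num by exact: integrable_fin_num intg.
exists (fine (\int[Q]_x (g x)%:E)%E); rewrite fineK//; split => //.
apply: (strong_law measurable_theta theta_invariant intg).
move=> D mD Dth; rewrite !EE// -[Q D]fineK ?fin_num_measure// -esumZl ?fine_ge0//.
  by apply: eq_esum => v _; rewrite cycle0_indep// fineK ?fin_num_measure// muleCA.
by move=> v _; rewrite mule_ge0// lee_fin.
Qed.

End Cycles.

(** * Total weight and mean duration of cycles *)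

Lemma esum_le_term (R : realType) (U : choiceType) (A : set U) (f : U -> \bar R) u :
  A u -> (0 <= f u)%E -> (f u <= \esum_(u in A) f u)%E.
Proof.
move=> Au fu; apply: esum_ge; exists [set u]; last by rewrite fsbig_set1.
by split => // v ->.
Qed.

(** The factor may be infinite, since first-passage sums are extended reals whose finiteness is not
    known beforehand. *)
Lemma esumZr (R : realType) (U : countType) (A : set U) (f : U -> \bar R) (y : \bar R) :
  (0 <= y)%E -> (forall u, 0 <= f u)%E ->
  (\esum_(u in A) (f u * y) = (\esum_(u in A) f u) * y)%E.
Proof.
move=> y0 f0; case: y y0 => [y||//] y0.
  rewrite muleC -esumZl//; by apply: eq_esum => u _; rewrite muleC.
have [[u Au fu]|h] := pselect (exists2 u, A u & (0 < f u)%E).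
  have s0 : (0 < \esum_(u in A) f u)%E by exact: lt_le_trans (esum_le_term Au (f0 u)).
  rewrite (gt0_muley s0); apply/eqP; rewrite -leye_eq -{1}(gt0_muley fu).
  by apply: (esum_le_term (f := fun u => f u * +oo)%E) => //; rewrite mule_ge0.
have z u : A u -> f u = 0%E.
  move=> Au; apply/eqP; rewrite eq_le f0 andbT leNgt; apply/negP => fu.
  by apply: h; exists u.
by rewrite !esum1 ?mul0e// => u /z ->; rewrite mul0e.
Qed.

Section CycleSums.
Context (R : realType) (G : countType) (a : G).
Let S : countType := (G * nat)%type.
Variables (q : G -> G -> R) (wgt : G -> G -> nat -> R) (wsum : G -> G -> R).
Variables (c : G -> R) (K : R).
Hypothesis wgt_ge0 : forall i j s, 0 <= wgt i j s.
Hypothesis wgt_sum : forall i j, (\esum_(s in [set: nat]) (wgt i j s)%:E = (wsum i j)%:E)%E.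
Hypothesis c0 : forall i, 0 < c i.
Hypothesis qE : forall i j, q i j = wsum i j * c j / c i.
Hypothesis K0 : 0 <= K.
Hypothesis wgt_time : forall i j,
  (\esum_(s in [set: nat]) (s.+1%:R * wgt i j s)%:E <= (K * wsum i j)%:E)%E.

Let W := word_weight wgt.

(** The shift by one matches [first_passage], where index n stands for a return at time n + 1. *)
Definition cycles_of_size n : set (seq S) :=
  [set v | is_cycle a v /\ size v = n.+1].

Definition word_time (v : seq S) : R := (\sum_(x <- v) x.2.+1)%N%:R.

Lemma word_time_ge0 v : 0 <= word_time v. Proof. exact: ler0n. Qed.

Let W_ge0 i v : 0 <= W i v. Proof. exact: word_weight_ge0. Qed.

Let wsum_ge0 i j : 0 <= wsum i j.
Proof. by rewrite -lee_fin -wgt_sum; apply: esum_ge0 => s _; rewrite lee_fin. Qed.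

Lemma cycles_of_size0 (f : seq S -> \bar R) :
  (\esum_(v in cycles_of_size 0) f v = \esum_(s in [set: nat]) f [:: (a, s)])%E.
Proof.
have -> : cycles_of_size 0 = (fun s => [:: (a, s)]) @` [set: nat].
  apply/seteqP; split => [v [cv sv]|_ [s _ <-]]; last by split; rewrite //= eqxx.
  case: v cv sv => [//|[j s] [|//]] /=; case: eqVneq => // -> _ _.
  by exists s.
by rewrite esum_image// => s t _ _ [].
Qed.

Lemma cycles_of_sizeS n (f : seq S -> \bar R) : (forall v, 0 <= f v)%E ->
  (\esum_(v in cycles_of_size n.+1) f v =
   \esum_(j in [set~ a]) \esum_(s in [set: nat])
     \esum_(v in cycles_of_size n) f ((j, s) :: v))%E.
Proof.
move=> f0.
pose A : set (G * (nat * seq S)) := [set~ a] `*` ([set: nat] `*` cycles_of_size n).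
have -> : cycles_of_size n.+1 = (fun x => (x.1, x.2.1) :: x.2.2) @` A.
  apply/seteqP; split => [v|_ [[j [s v]] [/= ja [_ [cv sv]]] <-]]; last first.
    by split; rewrite /= ?sv// ifN//; exact/eqP.
  case: v => [[]//|[j s] v] [/= cv [sv]]; exists (j, (s, v)) => //; split => /=.
    by move=> ja; move: cv; rewrite ja eqxx => /eqP v0; rewrite v0 in sv.
  by split => //; split => //; move: cv; case: ifP => // _ /eqP v0; rewrite v0 in sv.
rewrite esum_image; last by move=> [j [s v]] [j' [s' v']] _ _ [-> -> ->].
pose B : set (nat * seq S) := [set: nat] `*` cycles_of_size n.
rewrite -[A]/([set~ a] `*`` (fun=> B)).
have := @esum_esum R _ _ [set~ a] (fun=> B) (fun j sv => f ((j, sv.1) :: sv.2)).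
move=> <- //; apply: eq_esum => j _; rewrite -[B]/([set: nat] `*`` (fun=> cycles_of_size n)).
have := @esum_esum R _ _ [set: nat] (fun=> cycles_of_size n) (fun s v => f ((j, s) :: v)).
by move=> <-.
Qed.

Let fp_ge0 n i : (0 <= first_passage q n i a)%E.
Proof.
have q0 j k : 0 <= q j k by rewrite qE divr_ge0 ?mulr_ge0 ?wsum_ge0 ?(ltW (c0 _)).
elim: n i => [|n IHn] i /=; first by rewrite lee_fin.
by apply: esum_ge0 => k _; rewrite mule_ge0// lee_fin.
Qed.

(* [Q] is the conjugate of the weights by [c], so that over a closed cycle the
   factors of [c] cancel. *)
Lemma cycle_weight_sum n i :
  (\esum_(v in cycles_of_size n) (W i v)%:E =
   (c i / c a)%:E * first_passage q n i a)%E.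
Proof.
elim: n i => [|n IHn] i.
  rewrite cycles_of_size0 /= -EFinM qE.
  under eq_esum do rewrite mulr1.
  rewrite wgt_sum; congr EFin; field.
  by rewrite !gt_eqF.
rewrite cycles_of_sizeS => [|v]; last by rewrite lee_fin.
have cia : 0 <= c i / c a by rewrite divr_ge0 ?(ltW (c0 _)).
rewrite /= -esumZl// => [|k _]; last first.
  by rewrite mule_ge0// lee_fin qE divr_ge0 ?mulr_ge0 ?wsum_ge0 ?(ltW (c0 _)).
apply: eq_esum => j _.
have -> : (\esum_(s in [set: nat]) \esum_(v in cycles_of_size n) (W i ((j, s) :: v))%:E =
    \esum_(s in [set: nat]) ((wgt i j s)%:E * ((c j / c a)%:E * first_passage q n j a)))%E.
  apply: eq_esum => s _; rewrite -IHn -esumZl// => v _.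
  by rewrite lee_fin.
have cja : 0 <= c j / c a by rewrite divr_ge0 ?(ltW (c0 _)).
rewrite esumZr ?wgt_sum ?mule_ge0//; last by move=> s; rewrite lee_fin.
rewrite !muleA -!EFinM qE; congr (_%:E * _)%E; field.
by rewrite !gt_eqF.
Qed.

Let W0 n i : (0 <= \esum_(v in cycles_of_size n) (W i v)%:E)%E.
Proof. by apply: esum_ge0 => v _; rewrite lee_fin. Qed.

(** Given the labels, each letter lasts at most [K] on average, so a cycle of n + 1 letters lasts at
    most [K * (n + 1)] on average, irrespective of its labels. *)
Lemma cycle_time_sum n i :
  (\esum_(v in cycles_of_size n) (word_time v * W i v)%:E <=
   (K * n.+1%:R)%:E * \esum_(v in cycles_of_size n) (W i v)%:E)%E.
Proof.
elim: n i => [|n IHn] i.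
  rewrite !cycles_of_size0 mulr1.
  have -> : (\esum_(s in [set: nat]) (W i [:: (a, s)])%:E = (wsum i a)%:E)%E.
    by rewrite -wgt_sum; apply: eq_esum => s _; rewrite /= mulr1.
  rewrite -EFinM; apply: le_trans (wgt_time i a); apply: le_esum => s _.
  by rewrite /word_time big_seq1 /= mulr1.
rewrite !cycles_of_sizeS; last 2 first.
- by move=> v; rewrite lee_fin.
- by move=> v; rewrite lee_fin mulr_ge0// word_time_ge0.
rewrite -esumZl ?mulr_ge0//; last by move=> j _; do 2 apply: esum_ge0 => ? _; rewrite lee_fin.
apply: le_esum => j _.
pose EW := (\esum_(v in cycles_of_size n) (W j v)%:E)%E.
pose ET := (\esum_(v in cycles_of_size n) (word_time v * W j v)%:E)%E.
have EW0 : (0 <= EW)%E by exact: W0.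
have T0 : (0 <= ET)%E.
  by apply: esum_ge0 => v _; rewrite lee_fin mulr_ge0// word_time_ge0.
have wtn s := wgt_ge0 i j s.
have E1 : (\esum_(s in [set: nat]) \esum_(v in cycles_of_size n) (W i ((j, s) :: v))%:E =
    (wsum i j)%:E * EW)%E.
  rewrite -wgt_sum -esumZr ?EW0 ?T0//; try by move=> s; rewrite lee_fin.
  by apply: eq_esum => s _; rewrite -esumZl// => v _; rewrite lee_fin.
(* The duration is split into that of the first letter and that of the remaining word. *)
have E2 : (\esum_(s in [set: nat]) \esum_(v in cycles_of_size n)
      (word_time ((j, s) :: v) * W i ((j, s) :: v))%:E =
    (\esum_(s in [set: nat]) (s.+1%:R * wgt i j s)%:E) *
      EW +
    (wsum i j)%:E * ET)%E.
  rewrite -wgt_sum -!esumZr ?EW0 ?T0//; try by move=> s; rewrite lee_fin ?mulr_ge0.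
  rewrite -esumD; last 2 first.
  - by move=> s _; rewrite mule_ge0 ?EW0// lee_fin mulr_ge0.
  - by move=> s _; rewrite mule_ge0// lee_fin.
  apply: eq_esum => s _; rewrite -!esumZl ?mulr_ge0//;
    try by move=> v _; rewrite lee_fin ?mulr_ge0 ?word_time_ge0.
  rewrite -esumD; last 2 first.
  - by move=> v _; rewrite lee_fin !mulr_ge0.
  - by move=> v _; rewrite lee_fin !mulr_ge0 ?word_time_ge0.
  apply: eq_esum => v _; rewrite -!EFinM -EFinD; congr EFin.
  rewrite /word_time big_cons natrD /= -/W; ring.
rewrite E1 E2.
have -> : ((K * n.+2%:R)%:E * ((wsum i j)%:E * EW) =
   (K * wsum i j)%:E * EW +
   (wsum i j)%:E * ((K * n.+1%:R)%:E * EW))%E.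
  rewrite !muleA -!EFinM -ge0_muleDl ?lee_fin ?mulr_ge0//.
  by rewrite -EFinD; congr (_%:E * _)%E; rewrite -(natr1 n.+1); ring.
apply: leeD; first by apply: lee_wpmul2r.
by apply: lee_wpmul2l; [rewrite lee_fin wsum_ge0|exact: IHn].
Qed.

Hypothesis pos_rec1 : (\sum_(n <oo) first_passage q n a a = 1)%E.
Hypothesis pos_rec2 : (\sum_(n <oo) (n.+1%:R%:E * first_passage q n a a) < +oo)%E.

Lemma esum_cycles (f : seq S -> \bar R) : (forall v, 0 <= f v)%E ->
  (\esum_(v in [set v | is_cycle a v]) f v =
   \sum_(n <oo) \esum_(v in cycles_of_size n) f v)%E.
Proof.
move=> f0; rewrite -nneseries_sum_bigcup//.
  congr (esum _ _); apply/seteqP; split => [v cv|v [n _ []]//].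
  exists (size v).-1 => //; split => //.
  by rewrite prednK//; case: v cv.
apply/trivIsetP => m n _ _ mn; apply/seteqP; split => // v [[_ sm] [_ sn]].
by move: mn; rewrite -eqSS -sm -sn eqxx.
Qed.

Lemma cycle_weights_total : (\esum_(v in [set v | is_cycle a v]) (W a v)%:E = 1)%E.
Proof.
rewrite esum_cycles => [|v]; last by rewrite lee_fin.
rewrite -pos_rec1; apply: eq_eseriesr => n _.
by rewrite cycle_weight_sum divff ?mul1e// gt_eqF.
Qed.

Lemma cycle_time_fin :
  (\esum_(v in [set v | is_cycle a v]) (word_time v * W a v)%:E < +oo)%E.
Proof.
rewrite esum_cycles => [|v]; last by rewrite lee_fin mulr_ge0// word_time_ge0.
apply: (@le_lt_trans _ _ (\sum_(n <oo) (K%:E * (n.+1%:R%:E * first_passage q n a a)))%E).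
  apply: lee_nneseries => [n _ _|n _].
    by apply: esum_ge0 => v _; rewrite lee_fin mulr_ge0// word_time_ge0.
  rewrite muleA -EFinM; apply: le_trans (cycle_time_sum n a) _.
  by rewrite cycle_weight_sum divff ?mul1e// gt_eqF.
rewrite nneseriesZl => [|n _]; last by rewrite mule_ge0// lee_fin.
by rewrite lte_mul_pinfty.
Qed.

End CycleSums.

(** * Coding of the limit ray *)

Section Ray.
Context (R : realType) (G : countType) (edge : rel G) (i0 : G).
Context (pG : G -> G -> R) (pb : G -> R).
Let T := dcover edge i0.
Hypothesis hpG : graph_transitions edge pG.
Hypothesis hpb : backward_probabilities pb.
Let root : T := dc_root.
Let path_ := pathspace root.
Let p := ptree (edge := edge) (i0 := i0) pG pb.

Definition exit_at (f : path_) n := last_exit (f n) (shift n f).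

Lemma exit_atP f n m : exit_at f n -> (n < m)%N ->
  cone (f n) (f m) /\ (hgt (f n) < hgt (f m))%N.
Proof.
move=> [_ h] nm; have [c ne] := h (m - n.+1)%N.
have E : shift n f (m - n.+1).+1 = f m by rewrite /shift; congr f; lia.
rewrite E in c ne; split => //; rewrite ltn_neqAle cone_hgt// andbT.
by apply: contra ne => /eqP/(cone_eq c) ->.
Qed.

Lemma exit_at_inj f n n' : exit_at f n -> exit_at f n' ->
  hgt (f n) = hgt (f n') -> n = n'.
Proof.
move=> h h' e; have [/(exit_atP h)[_]|/(exit_atP h')[_]|//] := ltngtP n n';
  by rewrite e ltnn.
Qed.

Let hgt_anc_le (x : T) : (hgt (dc_anc x) <= hgt x)%N.
Proof.
have [->//|x0] := eqVneq x root; by rewrite (hgt_anc x0).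
Qed.

(** The cone of [x] can only be left towards [dc_anc x], which lies strictly below [x] unless [x] is
    the root, whose [dc_anc] is itself. Hence weak height bounds suffice away from the root and
    strict ones suffice everywhere. *)
Lemma stay_in_cone f x n N : (forall m, p (f m) (f m.+1) != 0) -> f n = x ->
  (forall m, (n < m <= N)%N -> (hgt x <= hgt (f m))%N) -> x != root \/
  (forall m, (n < m <= N)%N -> (hgt x < hgt (f m))%N) ->
  forall m, (n <= m <= N)%N -> cone x (f m).
Proof.
move=> leg fn hm x0; elim => [|m IHm] /andP[nm mN].
  by move: nm; rewrite leqn0 => /eqP n0; rewrite -n0 fn cone_refl.
move: nm; rewrite leq_eqVlt => /predU1P[<-|nm]; first by rewrite fn cone_refl.
have cm : cone x (f m) by apply: IHm; rewrite -ltnS nm ltnW.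
apply/negPn/negP => nc; have [_ fS] := step_cone cm (ptree_step (leg m)) nc.
have H : (n < m.+1 <= N)%N by rewrite nm.
case: x0 => [x0|/(_ _ H)]; last by rewrite fS ltnNge hgt_anc_le.
by have := hm _ H; rewrite fS (hgt_anc x0) ltnn.
Qed.

Definition good : set path_ := legal p root `&` @escaping G edge i0.

Section Good.
Variable f : path_.
Hypothesis fgood : good f.

Let leg m : p (f m) (f m.+1) != 0. Proof. by case: fgood => -[_ h] _; exact: h. Qed.
Let f0 : f 0%N = root. Proof. by case: fgood => -[]. Qed.

Let hstep m : (hgt (f m.+1) <= (hgt (f m)).+1)%N.
Proof. by case: (step_hgt (ptree_step (leg m))). Qed.

(** The time is the last one at height at most [k], which exists because the path escapes. The
    height there is exactly [k], since a step raises the height by at most one. *)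
Lemma exit_exists k : exists n, exit_at f n /\ hgt (f n) = k.
Proof.
case: fgood => _ /(_ k)[N NP].
have e : exists n, (hgt (f n) <= k)%N by exists 0%N; rewrite f0.
have b n : (hgt (f n) <= k)%N -> (n <= N)%N.
  by move=> h; rewrite leqNgt; apply/negP => /ltnW/NP; rewrite ltnNge h.
case: (ex_maxnP e b) => n hn nmax.
have gt m : (n < m)%N -> (k < hgt (f m))%N.
  by move=> nm; rewrite ltnNge; apply/negP => /nmax; rewrite leqNgt nm.
have nk : hgt (f n) = k.
  apply/eqP; rewrite eqn_leq hn -ltnS; exact: leq_trans (gt _ (ltnSn n)) (hstep n).
exists n; split => //; split; first by rewrite /shift addn0.
move=> m; have nm : (n < n + m.+1)%N by rewrite addnS ltnS leq_addr.
rewrite /shift; split; last by apply: contraTneq (gt _ nm) => ->; rewrite nk ltnn.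
apply: (@stay_in_cone f (f n) n (n + m.+1)) => //.
- by move=> l /andP[/gt + _]; rewrite nk; exact: ltnW.
- by right => l /andP[/gt + _]; rewrite nk.
- by rewrite ltnW//=.
Qed.

Definition exit_time k : nat := xget 0%N [set n | exit_at f n /\ hgt (f n) = k].

Lemma exit_timeP k : exit_at f (exit_time k) /\ hgt (f (exit_time k)) = k.
Proof. exact: (xgetPex 0%N (exit_exists k)). Qed.

Lemma exit_time_eq k n : exit_at f n -> hgt (f n) = k -> exit_time k = n.
Proof.
move=> e h; have [e' h'] := exit_timeP k.
by apply: (exit_at_inj e' e); rewrite h h'.
Qed.

Lemma exit_time_lt k : (exit_time k < exit_time k.+1)%N.
Proof.
have [e h] := exit_timeP k; have [e' h'] := exit_timeP k.+1.
rewrite ltnNge; apply/negP; rewrite leq_eqVlt => /predU1P[E|/(exit_atP e')[_]].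
  by move: h'; rewrite E h => /eqP; rewrite ltn_eqF.
by rewrite h h' ltnNge leqnSn.
Qed.

Definition ray k : T := f (exit_time k).

Lemma hgt_ray k : hgt (ray k) = k. Proof. by case: (exit_timeP k). Qed.

Lemma ray0 : ray 0 = root.
Proof. by apply/eqP; rewrite -hgt_eq0 hgt_ray. Qed.

Lemma ray_bubble k : let y := ray k.+1 in
  edge (dc_label (ray k)) (dc_label y) /\
  y = chd (ray k) (dc_label y) /\
  bubble y (exit_time k.+1 - exit_time k).-1 (shift 1 (shift (exit_time k) f)).
Proof.
move=> y; have [e h] := exit_timeP k; have [e' h'] := exit_timeP k.+1.
have lt := exit_time_lt k.
have gt m : (exit_time k < m)%N -> (k < hgt (f m))%N.
  by move=> /(exit_atP e)[_]; rewrite h.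
have h1 : hgt (f (exit_time k).+1) = k.+1.
  apply/eqP; rewrite eqn_leq gt// andbT -{2}h; exact: hstep.
have [j ej fj] : exists2 j, edge (dc_label (ray k)) j & f (exit_time k).+1 = chd (ray k) j.
  case: (ptree_step (leg (exit_time k))) => [j ? ?|x0 E|_ E]; first by exists j.
    by have := hgt_anc x0; rewrite -E h1 h => /eqP; rewrite eqn_leq ltnNge leqnSn andbF.
  by move: h1; rewrite E.
have x0 : chd (ray k) j != root by exact: chd_neq_root.
have C m : (exit_time k < m)%N -> cone (chd (ray k) j) (f m).
  move=> km; apply: (@stay_in_cone f _ (exit_time k).+1 m) => //.
  - by rewrite -fj h1 => l /andP[/ltnW/gt + _].
  - by left.
  - by rewrite km leqnn.
have yE : chd (ray k) j = y.
  by apply: (cone_eq (C _ lt)); rewrite hgt_ray hgt_chd// hgt_ray.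
have lj : dc_label y = j by rewrite -yE label_chd.
rewrite lj yE; split => //; split => //; split.
  by rewrite /shift /y /ray; congr f; lia.
by move=> m _; rewrite -yE; apply: C; rewrite /shift; lia.
Qed.

(** Of the time between two last exits one unit is the step to the child; the predecessor is
    therefore the length of the bubble at the child. *)
Definition ray_code k : G * nat :=
  (dc_label (ray k.+1), (exit_time k.+1 - exit_time k).-1).

Lemma follows_last_exit (x : T) v g : follows x v g -> last_exit x g.
Proof.
elim: v x g => [//|[j s] v IHv] x g [e g0 [gs gb] /IHv[_ h]].
split => // m; set y := chd x j in gs gb h.
suff cy : cone y (g m.+1).
  split; first exact: cone_trans (cone_chd e) cy.
  apply: contraTneq (cone_hgt cy) => ->; by rewrite /y hgt_chd// ltnn.
have [ms|ms] := leqP m s; first by have := gb m ms; rewrite /shift add1n.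
have [+ _] := h (m - s.+1)%N; rewrite /shift; congr (cone _ (g _)); lia.
Qed.

(** From left to right, the end of the first bubble is a last exit at height [k + 1], so it must be
    [exit_time k.+1] because last exits at a given height are unique. *)
Lemma follows_ray k v :
  follows (ray k) v (shift (exit_time k) f) <->
  mkseq (shift k ray_code) (size v) = v.
Proof.
elim: v k => [|[j s] v IHv] k.
  by split => // _; case: (exit_timeP k).
have mkS : mkseq (shift k ray_code) (size v).+1 =
    ray_code k :: mkseq (shift k.+1 ray_code) (size v).
  rewrite /mkseq /= /shift addn0; congr cons; rewrite (iotaDl 1 0) -map_comp.
  by apply: eq_map => l /=; congr ray_code; lia.
rewrite [size _]/= mkS; split => [[e _ [gs gb] fv]|[rj rs rv]].
  have := follows_last_exit fv; rewrite shift_shift => le.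
  have fy : f (exit_time k + s.+1)%N = chd (ray k) j.
    by move: gs; rewrite /shift => <-; congr f; lia.
  have xE : exit_time k.+1 = (exit_time k + s.+1)%N.
    by apply: exit_time_eq; rewrite /exit_at fy// hgt_chd// hgt_ray.
  have rE : ray k.+1 = chd (ray k) j by rewrite /ray xE fy.
  have -> : ray_code k = (j, s).
    by rewrite /ray_code rE label_chd// xE addKn.
  congr cons; apply/IHv; rewrite rE xE.
  by move: fv; rewrite shift_shift.
have [e [yE yb]] := ray_bubble k; rewrite rj in e yE; rewrite rs in yb.
have [[r0 _] _] := exit_timeP k.
split => //; first by rewrite -yE.
rewrite -yE shift_shift -rs (_ : (_ + _)%N = exit_time k.+1); last first.
  by have := exit_time_lt k; lia.
by apply/IHv.
Qed.

(** The code does not record the last visit time [n] to the root; summation over it is what produces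
    the factor [Goo]. *)
Lemma starts_with_ray v :
  mkseq ray_code (size v) = v <-> exists n, f n = root /\ follows root v (shift n f).
Proof.
split => [h|[n [fn fv]]].
  by exists (exit_time 0); split; [exact: ray0|rewrite -ray0; apply/follows_ray].
have e := follows_last_exit fv.
have nE : exit_time 0 = n by apply: exit_time_eq; rewrite /exit_at fn.
by apply/(follows_ray 0); rewrite ray0 nE.
Qed.

Lemma exit_time_sum k n :
  (exit_time (k + n) = exit_time k + \sum_(x <- mkseq (shift k ray_code) n) x.2.+1)%N.
Proof.
elim: n => [|n IHn]; first by rewrite big_nil !addn0.
have -> : mkseq (shift k ray_code) n.+1 =
    rcons (mkseq (shift k ray_code) n) (ray_code (k + n)).
  by rewrite /mkseq -addn1 iotaD map_cat /= cats1 add0n.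
rewrite -cats1 big_cat big_seq1 /= addnA -IHn addnS.
by have := exit_time_lt (k + n); lia.
Qed.

Lemma val_ray k : val (ray k) = map fst (mkseq ray_code k).
Proof.
elim: k => [|k IHk]; first by rewrite ray0.
have [e [yE _]] := ray_bubble k.
rewrite yE val_chd// IHk /mkseq -{2}addn1 iotaD !map_cat /= add0n cats1.
by [].
Qed.

End Good.

End Ray.

(** * Law of the coded ray *)

Section RayLaw.
Context (R : realType) (G : countType) (edge : rel G) (i0 : G).
Context (pG : G -> G -> R) (pb : G -> R).
Context (d : measure_display) (W : measurableType d).
Let T := dcover edge i0.
Context (P : T -> probability W R) (X : nat -> W -> T).
Hypothesis Gconn : strongly_connected edge.
Hypothesis hpG : graph_transitions edge pG.
Hypothesis hpb : backward_probabilities pb.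
Hypothesis hX : markov_family (ptree pG pb) P X.
Variable eps : R.
Hypothesis eps0 : 0 < eps.
Hypothesis eps_pb : forall i, eps <= pb i.
Hypothesis eps_pfwd : forall i j, edge i j -> eps <= pfwd pG pb i j.
Let root : T := dc_root.
Let PT := path_law root hX.
Let path_ := pathspace root.
Variables (C r : R).
Hypotheses (C0 : 0 < C) (r0 : 0 < r) (r1 : r < 1).
Hypothesis decay : forall n, (PT root [set f | f n = root] <= (C * r ^+ n)%:E)%E.
Let s0 : G * nat := (i0, 0%N).
Let good_ : set path_ := good pG pb.
Let gl_ := gl hX.
Let el_ := el hX.

Definition step_weight i j s : R := pfwd pG pb i j * gl_ j s.

Lemma step_weight_ge0 i j s : 0 <= step_weight i j s.
Proof. by rewrite mulr_ge0//; [exact: (pfwd_ge0 hpG hpb)|exact: gl_ge0]. Qed.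

Lemma wtE i v : wt hX i v = word_weight step_weight i v.
Proof. by elim: v i => [|[j s] v IHv] i //=; rewrite IHv. Qed.

(** If a letter does not follow an edge, [endv] runs into the default value of [chd] and the final
    labels may differ, but then the weight is 0. *)
Lemma wt_el (x : T) v : wt hX (dc_label x) v * el_ (dc_label (endv x v)) =
  word_weight step_weight (dc_label x) v * el_ (last_label (dc_label x) v).
Proof.
rewrite wtE; elim: v x => [|[j s] v IHv] x //=.
have [e|/(pfwd_eq0 hpG hpb) e] := boolP (edge (dc_label x) j); last first.
  by rewrite /step_weight e !mul0r.
by rewrite -!mulrA -{1 3}(label_chd e) IHv (label_chd e).
Qed.

Lemma measurable_good : measurable good_.
Proof. by apply: measurableI; [exact: measurable_legal|exact: measurable_escaping]. Qed.

Lemma PT_good Q : measurable Q -> PT root (Q `&` good_) = PT root Q.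
Proof.
move=> mQ; rewrite /good_ /good setIA.
rewrite path_law_setI_full ?path_law_legal//.
- exact: measurable_escaping.
- exact: measurableI mQ (measurable_legal _ _).
- exact: (ae_escaping eps0 eps_pb C0 r0 r1 decay).
Qed.

Definition Goo : R := fine (\sum_(n <oo) PT root [set f | f n = root])%E.

Lemma GooE : (\sum_(n <oo) PT root [set f | f n = root])%E = Goo%:E.
Proof.
rewrite fineK// ge0_fin_numE; last by apply: nneseries_ge0 => n _.
apply: (@le_lt_trans _ _ (\sum_(n <oo) (C * r ^+ n)%:E)%E).
  by apply: lee_nneseries => // n _; exact: decay.
by rewrite nneseries_geometric ?(ltW r0)// ltry.
Qed.

Lemma measurable_exit_at n : measurable [set f : path_ | exit_at f n].
Proof.
have -> : [set f : path_ | exit_at f n] =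
    \bigcap_m [set f : path_ | cone (f n) (f (n + m.+1)%N) /\ f (n + m.+1)%N != f n].
  apply/seteqP; split => [f [_ h] m _|f h]; first exact: h.
  by split => [|m]; [rewrite /shift addn0|exact: h].
apply: bigcapT_measurable => m; apply: (@local_measurable T root (n + m.+1)).
by move=> f g fg /=; rewrite !fg// leq_addr.
Qed.

(* [exit_time] is a junk value on paths that are not good, hence the constant
   default. *)
Definition safe_code (f : path_) : pathspace s0 :=
  fun k => if pselect (good_ f) then ray_code f k else s0.

Lemma safe_codeE f : good_ f -> safe_code f = ray_code f.
Proof. by move=> gf; apply/funext => k; rewrite /safe_code; case: pselect. Qed.

Lemma dmeas_safe_code k : dmeas (fun f : path_ => safe_code f k).
Proof.
apply: dmeas_fibers => u.
pose E := \bigcup_n \bigcup_n' [set f : path_ | [/\ exit_at f n, exit_at f n',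
  (hgt (f n) = k /\ hgt (f n') = k.+1) & (dc_label (f n'), (n' - n).-1) = u]].
have mE : measurable E.
  apply: bigcupT_measurable => n; apply: bigcupT_measurable => n'.
  have -> : [set f : path_ | [/\ exit_at f n, exit_at f n',
      (hgt (f n) = k /\ hgt (f n') = k.+1) & (dc_label (f n'), (n' - n).-1) = u]] =
    [set f : path_ | exit_at f n] `&` ([set f : path_ | exit_at f n'] `&`
     [set f : path_ | (hgt (f n) = k /\ hgt (f n') = k.+1) /\ (dc_label (f n'), (n' - n).-1) = u]).
    by apply/seteqP; split => [f [? ? ? ?]|f [? [? [? ?]]]].
  apply: measurableI; first exact: measurable_exit_at.
  apply: measurableI; first exact: measurable_exit_at.
  apply: (@local_measurable T root (maxn n n')) => f g fg /=.
  by rewrite !fg ?leq_maxl ?leq_maxr.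
have -> : [set f : path_ | safe_code f k = u] =
    (good_ `&` E) `|` (~` good_ `&` [set f | s0 = u]).
  apply/seteqP; split => [f /= fu|f [[gf [n _ [n' _ [e e' [h h'] <-]]]]|[ngf /= <-]]].
  - have [gf|ngf] := pselect (good_ f); last first.
      by right; split => //=; move: fu; rewrite /safe_code; case: pselect.
    left; split => //; exists (exit_time f k) => //; exists (exit_time f k.+1) => //.
    have [? ?] := exit_timeP gf k; have [? ?] := exit_timeP gf k.+1.
    by split => //; move: fu; rewrite safe_codeE.
  - by rewrite /= safe_codeE// /ray_code /ray (exit_time_eq gf e h) (exit_time_eq gf e' h').
  - by rewrite /safe_code; case: pselect.
apply: measurableU; first by apply: measurableI => //; exact: measurable_good.
apply: measurableI; first by apply: measurableC; exact: measurable_good.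
by have [su|su] := pselect (s0 = u); [rewrite (_ : [set _ | _] = setT)|
  rewrite (_ : [set _ | _] = set0)] => //; apply/seteqP; split.
Qed.

Definition code (w : W) : pathspace s0 := safe_code (path_of root X w).

Lemma measurable_code : measurable_fun setT code.
Proof.
apply: path_measurable_fun => n A.
have -> : (code ^~ n) @^-1` A =
  path_of root X @^-1` ((fun f : path_ => safe_code f n) @^-1` A) by [].
rewrite -[X in measurable X]setTI; apply: (measurable_path_of hX measurableT).
exact: dmeas_safe_code.
Qed.

Let mfun_code : {mfun W >-> pathspace s0} :=
  HB.pack code (isMeasurableFun.Build _ _ _ _ _ measurable_code).

Definition code_law : probability (pathspace s0) R :=
  distribution (P root) mfun_code.

Lemma code_lawE B : measurable B -> code_law B = PT root (good_ `&` safe_code @^-1` B).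
Proof.
move=> mB; rewrite /PT setIC PT_good ?path_lawE//.
rewrite -[X in measurable X]setTI; apply: path_measurable_fun => //.
exact: dmeas_safe_code.
Qed.

(** The event is the union over the last visit time n to the root; these pieces are disjoint because
    last exits are unique. The Markov property at time n turns the sum into the Green function at
    the root times the law of [follows]. *)
Lemma code_law_starts v : code_law (starts_with v) =
  (Goo * (word_weight step_weight i0 v * el_ (last_label i0 v)))%:E.
Proof.
rewrite code_lawE; last exact: measurable_starts_with.
pose D n := [set f : path_ | f n = root] `&` shift n @^-1` follows root v.
have mD n : measurable (D n).
  apply: measurableI; first exact: (@measurable_at T root n [set root]).
  exact: (@shift_measurable T root n _ (@measurable_follows G edge i0 root v)).
have -> : good_ `&` safe_code @^-1` starts_with v = (\bigcup_n D n) `&` good_.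
  apply/seteqP; split => [f [gf fv]|f [[n _ [fn fv]] gf]]; split => //.
    move: fv; rewrite /starts_with /preimage /= safe_codeE//.
    by move=> /(starts_with_ray gf)[n [? ?]]; exists n.
  rewrite /starts_with /preimage /= safe_codeE//.
  by apply/(starts_with_ray gf); exists n.
have mU : measurable (\bigcup_n D n) by exact: bigcupT_measurable.
rewrite PT_good// measure_semi_bigcup//; last first.
  apply/trivIsetP => m n _ _ mn; apply/seteqP; split => // f [[fm vm] [fn vn]].
  move/eqP: mn; apply; apply: (@exit_at_inj _ _ _ f); rewrite ?fm ?fn//.
    by rewrite /exit_at fm; exact: follows_last_exit vm.
  by rewrite /exit_at fn; exact: follows_last_exit vn.
have E n : PT root (D n) = (PT root [set f | f n = root] *
    (word_weight step_weight i0 v * el_ (last_label i0 v))%:E)%E.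
  have lT : local_at n (setT : set (nat -> T)) by [].
  have mF := @measurable_follows G edge i0 root v.
  have := path_law_markov hX root root lT mF; rewrite !setTI => ->.
  by rewrite -/PT (follows_law Gconn hpG hpb) wt_el.
under eq_eseriesr do rewrite E muleC.
rewrite nneseriesZl ?GooE; last by [].
by rewrite -EFinM mulrC.
Qed.

(** The empty word has probability 1: almost surely there is exactly one last visit to the root.
    This converts [Goo] into the normalisation used for cycles. *)
Lemma Goo_el : Goo * el_ i0 = 1.
Proof.
have := code_law_starts [::].
have -> : starts_with [::] = setT :> set (pathspace s0) by apply/seteqP; split.
by rewrite probability_setT mul1r => -[].
Qed.

Lemma el_i0_gt0 : 0 < el_ i0.
Proof.
rewrite lt_neqAle el_ge0 andbT eq_sym; apply/eqP => e0.
by have := Goo_el; rewrite e0 mulr0 => /esym/eqP; rewrite oner_eq0.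
Qed.

Lemma Goo_gt0 : 0 < Goo.
Proof.
have := Goo_el; have := el_i0_gt0; move=> e0 E.
by rewrite -(pmulr_lgt0 _ e0) E.
Qed.

Lemma code_law_cyl v : code_law (starts_with v) =
  ((el_ i0)^-1 * (word_weight step_weight i0 v * el_ (last_label i0 v)))%:E.
Proof.
rewrite code_law_starts; congr (_ * _)%:E.
by rewrite -[LHS]mulr1 -(mulfV (lt0r_neq0 el_i0_gt0)) mulrA Goo_el mul1r.
Qed.

End RayLaw.

(** Deterministic renewal argument: the two limits force the gaps [t m.+1 - t m] to be o(m), and
    since [y] has bounded increments, its deviation [z] from the line of slope [h] changes by only
    o(m) within a gap. *)
Lemma cvg_along_times (R : realType) (t : nat -> nat) (y : nat -> R) (K ct cl : R) :
  (forall m, (t m < t m.+1)%N) -> (forall n, `|y n.+1 - y n| <= K) -> 0 < ct ->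
  (fun m : nat => m%:R^-1 * (t m)%:R) @ \oo --> ct ->
  (fun m : nat => m%:R^-1 * y (t m)) @ \oo --> cl ->
  (fun n : nat => n%:R^-1 * y n) @ \oo --> cl / ct.
Proof.
move=> tS yK ct0 tc yc; set h := cl / ct.
have clE : cl = h * ct by rewrite /h divfK// gt_eqF.
have K0 : 0 <= K := le_trans (normr_ge0 _) (yK 0%N).
pose z n := y n - h * n%:R; pose K' := K + `|h|.
have K'0 : 0 <= K' by rewrite addr_ge0.
have zK a k : `|z (a + k)%N - z a| <= K' * k%:R.
  elim: k => [|k IHk]; first by rewrite addn0 subrr normr0 mulr0.
  rewrite addnS -natr1 mulrDr mulr1; apply: le_trans (lerD IHk (_ : `|z (a + k).+1 - z (a + k)%N| <= K')).
    apply: le_trans (ler_normD _ _); rewrite le_eqVlt; apply/orP; left; apply/eqP; congr `|_|; ring.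
  have -> : z (a + k).+1 - z (a + k)%N = (y (a + k).+1 - y (a + k)%N) - h.
    by rewrite /z -natr1; ring.
  by apply: le_trans (ler_normB _ _) _; rewrite lerD2r.
have tle m : (m <= t m)%N.
  by elim: m => // m IHm; exact: leq_ltn_trans IHm (tS m).
have tmono m n : (m <= n)%N -> (t m <= t n)%N.
  by move=> /subnK <-; elim: (n - m)%N => // k IHk; rewrite addSn (leq_trans IHk)// ltnW.
have small e : 0 < e -> exists N, forall n, (N <= n)%N -> `|z n| <= (1 + 4 * K') * e * n%:R.
  move=> e0.
  (* At time [t m] the errors of [y] and of [h * t] add up to [e' * (1 + |h|) * m], which must not
     exceed [e * m]. *)
  pose e' := Num.min e (e / (1 + `|h|)).
  have h1 : 0 < 1 + `|h| by rewrite ltr_pwDl.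
  have e'0 : 0 < e' by rewrite lt_min e0 divr_gt0.
  have e'e : e' <= e by rewrite ge_min lexx.
  have e'h : e' * (1 + `|h|) <= e by rewrite -ler_pdivlMr// ge_min lexx orbT.
  have [M1 _ M1P] := (iffLR (cvgrPdist_le _ _) tc) e' e'0.
  have [M2 _ M2P] := (iffLR (cvgrPdist_le _ _) yc) e' e'0.
  have q0 : 0 <= (ct + e) / e by rewrite divr_ge0 ?addr_ge0 ?ltW.
  (* From this index on [ct + e <= e * m], so the gap bound absorbs the constant coming from [m + 1]
     in place of [m]. *)
  pose M3 := Num.bound ((ct + e) / e).
  pose M := maxn 1 (maxn M1 (maxn M2 M3)).
  have tm m : (M <= m)%N -> `|(t m)%:R - ct * m%:R| <= e' * m%:R.
    rewrite !geq_max => /and4P[m1 mM1 _ _]; have m0 : 0 < m%:R :> R by rewrite ltr0n.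
    have := M1P m mM1; rewrite distrC -(ler_pM2r m0) -{2}(ger0_norm (ltW m0)) -normrM.
    by rewrite mulrBl mulrAC mulVf ?gt_eqF// mul1r.
  have ym m : (M <= m)%N -> `|y (t m) - cl * m%:R| <= e' * m%:R.
    rewrite !geq_max => /and4P[m1 _ mM2 _]; have m0 : 0 < m%:R :> R by rewrite ltr0n.
    have := M2P m mM2; rewrite distrC -(ler_pM2r m0) -{2}(ger0_norm (ltW m0)) -normrM.
    by rewrite mulrBl mulrAC mulVf ?gt_eqF// mul1r.
  have zm m : (M <= m)%N -> `|z (t m)| <= e * m%:R.
    move=> Mm; have -> : z (t m) = (y (t m) - cl * m%:R) - h * ((t m)%:R - ct * m%:R).
      by rewrite /z clE; ring.
    apply: le_trans (ler_normB _ _) _; rewrite normrM.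
    apply: le_trans (lerD (ym m Mm) (ler_wpM2l (normr_ge0 h) (tm m Mm))) _.
    have -> : e' * m%:R + `|h| * (e' * m%:R) = (e' * (1 + `|h|)) * m%:R by ring.
    by rewrite ler_wpM2r.
  have gap m : (M <= m)%N -> (t m.+1)%:R - (t m)%:R <= 4 * e * m%:R.
    move=> Mm; have a1 := tm _ Mm; have a2 := tm _ (leqW Mm).
    move: Mm; rewrite !geq_max => /and4P[_ _ _ mM3].
    have : (ct + e) / e <= m%:R.
      by apply: le_trans (ltW (archi_boundP q0)) _; rewrite ler_nat.
    rewrite ler_pdivrMr// => a3.
    move: a1 a2; rewrite !ler_norml -natr1 => /andP[a11 a12] /andP[a21 a22].
    have m0 : 0 <= m%:R :> R by [].
    have a4 : e' * m%:R <= e * m%:R by rewrite ler_wpM2r.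
    lra.
  exists (t M) => n tn.
  have ex : exists m, (t m <= n)%N by exists M.
  have bd m : (t m <= n)%N -> (m <= n)%N by exact: leq_trans.
  case: (ex_maxnP ex bd) => m tmn mmax.
  have Mm : (M <= m)%N by exact: mmax.
  have nS : (n < t m.+1)%N by rewrite ltnNge; apply/negP => /mmax; rewrite ltnn.
  have nE : n = (t m + (n - t m))%N by rewrite subnKC.
  have k1 : (n - t m)%:R <= 4 * e * m%:R.
    by apply: le_trans (gap m Mm); rewrite -natrB ?ler_nat ?leq_sub2r// ltnW.
  have mn : m%:R <= n%:R :> R by rewrite ler_nat bd.
  have := zK (t m) (n - t m)%N; rewrite -nE => zn.
  have -> : z n = z (t m) + (z n - z (t m)) by ring.
  apply: le_trans (ler_normD _ _) _.
  apply: le_trans (lerD (zm m Mm) zn) _.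
  apply: (@le_trans _ _ ((1 + 4 * K') * e * m%:R)).
    have := ler_wpM2l K'0 k1; lra.
  by rewrite ler_wpM2l// !mulr_ge0// ?addr_ge0 ?mulr_ge0// ltW.
apply/cvgrPdist_le => e e0.
have c0 : 0 < 1 + 4 * K' by rewrite ltr_pwDl// mulr_ge0.
have [N NP] := small (e / (1 + 4 * K')) (divr_gt0 e0 c0).
exists (maxn 1 N) => // n /=; rewrite geq_max => /andP[n1 /NP].
have n0 : 0 < n%:R :> R by rewrite ltr0n.
rewrite [_ * (e / _)]mulrC divfK ?gt_eqF// => zn.
have -> : h - n%:R^-1 * y n = - (n%:R^-1 * z n) by rewrite /z; field; rewrite gt_eqF.
by rewrite normrN normrM ger0_norm ?invr_ge0 ?(ltW n0)// ler_pdivrMl// mulrC.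
Qed.

Section Iterates.
Context (G : countType) (a : G).
Variable c : pathspace (a, 0%N).
Let th := theta (a := a).

Definition cycle_index m := (\sum_(i < m) ret_time (iter i th c))%N.

Lemma iter_theta m : iter m th c = shift (cycle_index m) c.
Proof.
elim: m => [|m IHm]; first by rewrite /cycle_index big_ord0.
rewrite iterS /cycle_index big_ord_recr /= -/(cycle_index m) /th /theta -/th.
by rewrite {2}IHm shift_shift.
Qed.

Lemma cycle_indexS m : cycle_index m.+1 = (cycle_index m + ret_time (iter m th c))%N.
Proof. by rewrite /cycle_index big_ord_recr. Qed.

Lemma cycle0_iter m : cycle0 (iter m th c) =
  mkseq (shift (cycle_index m) c) (ret_time (iter m th c)).
Proof. by rewrite /cycle0 {1}iter_theta. Qed.

Lemma ret_time_gt0 (f : pathspace (a, 0%N)) : (0 < ret_time f)%N.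
Proof. by rewrite /ret_time; case: pselect. Qed.

End Iterates.

(** * Linear growth of the logarithmic Green function *)

Section Drift.
Context (R : realType) (G : countType) (edge : rel G) (i0 : G).
Context (pG : G -> G -> R) (pb : G -> R).
Context (d : measure_display) (W : measurableType d).
Let T := dcover edge i0.
Context (P : T -> probability W R) (X : nat -> W -> T).
Hypothesis Gconn : strongly_connected edge.
Hypothesis hpG : graph_transitions edge pG.
Hypothesis hpb : backward_probabilities pb.
Hypothesis hX : markov_family (ptree pG pb) P X.
Variable eps : R.
Hypothesis eps0 : 0 < eps.
Hypothesis eps_pb : forall i, eps <= pb i.
Hypothesis eps_pfwd : forall i j, edge i j -> eps <= pfwd pG pb i j.
Let root : T := dc_root.
Let PT := path_law root hX.
Let path_ := pathspace root.
Variables (C r : R).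
Hypotheses (C0 : 0 < C) (r0 : 0 < r) (r1 : r < 1).
Hypothesis decay : forall n, (PT root [set f | f n = root] <= (C * r ^+ n)%:E)%E.
Hypothesis Qpos : positive_recurrent (Qmat pG pb P X).
Let s0 : G * nat := (i0, 0%N).
Let good_ : set path_ := good pG pb.
Let Gb i := Gbar P X i.
Let gl_ := gl hX.
Let el_ := el hX.
Let wgt := step_weight hX.
Let Q := code_law hX.

Definition lgt i j : R := - ln (pfwd pG pb i j * Gb j).

Fixpoint ysum i (s : seq G) : R := if s is j :: s' then lgt i j + ysum j s' else 0.

(* Up to an additive constant, the negative logarithm of the Green function
   from the root. *)
Definition green_height (x : T) : R := ysum i0 (val x).

Lemma ysum_cat i u v : ysum i (u ++ v) = ysum i u + ysum (last i u) v.
Proof.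
elim: u i => [|j u IHu] i /=; first by rewrite add0r.
by rewrite IHu addrA.
Qed.

Lemma green_height_chd x j : edge (dc_label x) j ->
  green_height (chd x j) = green_height x + lgt (dc_label x) j.
Proof.
by move=> e; rewrite /green_height val_chd// -cats1 ysum_cat /= addr0.
Qed.

Let B := (1 - r)^-1.
Let B1 : 1 <= B. Proof. by rewrite /B -[leLHS]invr1 lef_pV2 ?posrE ?subr_gt0// gerBl ltW. Qed.

Lemma eps_le1 : eps <= 1.
Proof. by case: hpb => /(_ i0)/andP[_ /ltW h] _; exact: le_trans (eps_pb i0) h. Qed.

Lemma pfwd_le1 i j : pfwd pG pb i j <= 1.
Proof.
have pG1 : pG i j <= 1.
  case: hpG => p0 _ /(_ i) s1; rewrite -lee_fin -s1.
  by apply: (esum_le_term (f := fun j => (pG i j)%:E)) => //; rewrite lee_fin.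
case: hpG => /(_ i j) p0 _ _; case: hpb => /(_ i)/andP[b0 b1] _.
apply: mulr_ile1 => //; first by rewrite subr_ge0 ltW.
by rewrite gerBl ltW.
Qed.

Definition lgt_bound : R := ln B - ln eps.

(** On an edge the argument of the logarithm lies between [eps] and [B], because [Gbar] is between 1
    and [B]; off the edges it is 0, where [ln] is 0. The bound makes [green_height] Lipschitz along
    the walk. *)
Lemma lgt_le i j : `|lgt i j| <= lgt_bound.
Proof.
have lB : 0 <= ln B by rewrite ln_ge0.
have le : ln eps <= 0 by rewrite ln_le0// eps_le1.
have [e|/(pfwd_eq0 hpG hpb) e] := boolP (edge i j); last first.
  by rewrite /lgt e mul0r ln0// oppr0 normr0 /lgt_bound; lra.
have G1 : 1 <= Gb j := Gbar_ge1 Gconn hpG eps0 eps_pb eps_pfwd r0 r1 decay j.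
have G2 : Gb j <= B := Gbar_le Gconn hpG eps0 eps_pb eps_pfwd r0 r1 decay j.
have p1 := pfwd_le1 i j; have pe := eps_pfwd e.
have p0 : 0 < pfwd pG pb i j := lt_le_trans eps0 pe.
set v := pfwd pG pb i j * Gb j.
have v1 : eps <= v.
  by apply: le_trans pe _; rewrite /v ler_peMr// ltW.
have v2 : v <= B.
  by apply: le_trans G2; rewrite /v ler_piMl// (le_trans _ G1).
have v0 : 0 < v := lt_le_trans eps0 v1.
have l1 : ln eps <= ln v by rewrite ler_ln.
have l2 : ln v <= ln B by rewrite ler_ln// posrE (lt_le_trans _ v2).
rewrite /lgt -/v normrN ler_norml /lgt_bound; apply/andP; split; lra.
Qed.

Let K0 : 0 <= lgt_bound := le_trans (normr_ge0 _) (lgt_le i0 i0).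

Lemma ysum_le i s : `|ysum i s| <= lgt_bound * (size s)%:R.
Proof.
elim: s i => [|j s IHs] i /=; first by rewrite normr0 mulr0.
apply: le_trans (ler_normD _ _) _.
by rewrite -natr1 mulrDr mulr1 addrC lerD// lgt_le.
Qed.

Lemma green_height_step (x y : T) : step_spec x y ->
  `|green_height y - green_height x| <= lgt_bound.
Proof.
case => [j e ->|x_ ->|-> ->]; last by rewrite subrr normr0.
  by rewrite green_height_chd// addrAC subrr add0r lgt_le.
have [e xE] := chd_dc_anc x_; rewrite {2}xE green_height_chd//.
by rewrite opprD addrA subrr add0r normrN lgt_le.
Qed.

(** If F(-i) were 1, the division by zero in [Qmat] would make row i vanish, and the chain could
    never return to i, against recurrence. *)
Lemma Fback_lt1 i : Fback P X i < 1.
Proof.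
have F1 : Fback P X i <= 1.
  rewrite /Fback; set x := some_vertex edge i0 i.
  have mF : measurable [set w | exists n, X n w = dc_anc x].
    have -> : [set w | exists n, X n w = dc_anc x] = \bigcup_n [set w | X n w = dc_anc x].
      by apply/seteqP; split => [w [n h]|w [n _ h]]; exists n.
    by apply: bigcupT_measurable => n; case: hX => + _ _; apply.
  by rewrite -lee_fin fineK ?fin_num_measure//; exact: probability_le1.
rewrite lt_neqAle F1 andbT; apply/negP => /eqP Fi.
have q0 k : Qmat pG pb P X i k = 0.
  by rewrite /Qmat Fi subrr invr0 mulr0 !mul0r.
have fp0 n k : first_passage (Qmat pG pb P X) n i k = 0%E.
  case: n => [|n] /=; first by rewrite q0.
  by apply: esum1 => l _; rewrite q0 mul0e.
have [+ _] := Qpos i; rewrite eseries0 => [/esym/eqP|n _ _]; last exact: fp0.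
by rewrite onee_eq0.
Qed.

Let wsum i j : R := pfwd pG pb i j * Gb j.

Let Gb_gt0 i : 0 < Gb i.
Proof. exact: lt_le_trans ltr01 (Gbar_ge1 Gconn hpG eps0 eps_pb eps_pfwd r0 r1 decay i). Qed.

Lemma wgt_sum i j : (\esum_(s in [set: nat]) (wgt i j s)%:E = (wsum i j)%:E)%E.
Proof.
rewrite -nneseries_esumT => [|s]; last first.
  by rewrite lee_fin; exact: step_weight_ge0.
under eq_eseriesr do rewrite /wgt /step_weight EFinM.
rewrite nneseriesZl => [|s _]; last by rewrite lee_fin; exact: gl_ge0.
by rewrite (sum_gl Gconn hpG eps0 eps_pb eps_pfwd r0 r1 decay).
Qed.

Lemma wgt_time : exists K, 0 <= K /\ forall i j,
  (\esum_(s in [set: nat]) (s.+1%:R * wgt i j s)%:E <= (K * wsum i j)%:E)%E.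
Proof.
have [K KP] := sum_gl_time eps0 eps_pb eps_pfwd r0 r1 decay.
have K0' : 0 <= K.
  rewrite -lee_fin; apply: le_trans (KP i0); apply: nneseries_ge0 => s _ _.
  by rewrite lee_fin mulr_ge0//; exact: gl_ge0.
exists K; split => // i j.
have p0 : 0 <= pfwd pG pb i j := pfwd_ge0 hpG hpb i j.
rewrite -nneseries_esumT => [|s]; last first.
  by rewrite lee_fin mulr_ge0//; exact: step_weight_ge0.
apply: (@le_trans _ _ ((pfwd pG pb i j)%:E * \sum_(s <oo) (s.+1%:R * gl_ j s)%:E)%E).
  rewrite -nneseriesZl => [|s _]; last by rewrite lee_fin mulr_ge0//; exact: gl_ge0.
  apply: lee_nneseries => [s _ _|s _].
    by rewrite lee_fin mulr_ge0//; exact: step_weight_ge0.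
  by rewrite -EFinM lee_fin /wgt /step_weight mulrCA.
apply: (@le_trans _ _ ((pfwd pG pb i j)%:E * K%:E)%E).
  by apply: lee_wpmul2l; [rewrite lee_fin|exact: KP].
(* [K] bounds the time-weighted sum itself; since [Gbar] is at least 1, it also bounds it relative
   to [wsum]. *)
rewrite -EFinM lee_fin mulrC /wsum ler_wpM2l// ler_peMr//.
exact: (Gbar_ge1 Gconn hpG eps0 eps_pb eps_pfwd r0 r1 decay).
Qed.

Let cc i : R := (1 - Fback P X i) / Gb i.

Let cc0 i : 0 < cc i.
Proof. by rewrite divr_gt0// subr_gt0 Fback_lt1. Qed.

Let qE i j : Qmat pG pb P X i j = wsum i j * cc j / cc i.
Proof.
have Fi : 1 - Fback P X i != 0 by rewrite gt_eqF// subr_gt0 Fback_lt1.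
have Fj : 1 - Fback P X j != 0 by rewrite gt_eqF// subr_gt0 Fback_lt1.
rewrite /Qmat /wsum /cc -!/(Gb _).
have gi : Gb i != 0 by rewrite gt_eqF.
have gj : Gb j != 0 by rewrite gt_eqF.
by field; rewrite gi gj Fi.
Qed.

Let wgt0 i j s : 0 <= wgt i j s. Proof. exact: step_weight_ge0. Qed.

Lemma cycle_total : (\esum_(v in [set v | is_cycle i0 v]) (word_weight wgt i0 v)%:E = 1)%E.
Proof. exact: (cycle_weights_total wgt0 wgt_sum cc0 qE (Qpos i0).1). Qed.

Lemma cycle_time_lty :
  (\esum_(v in [set v | is_cycle i0 v]) (word_time R v * word_weight wgt i0 v)%:E < +oo)%E.
Proof.
have [K [K1 KP]] := wgt_time.
exact: (cycle_time_fin wgt0 wgt_sum cc0 qE K1 KP (Qpos i0).2).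
Qed.

Section GoodPath.
Variable f : path_.
Hypothesis gf : good_ f.
Hypothesis cyc : forall m, is_cycle i0 (cycle0 (iter m (theta (a := i0)) (ray_code f))).

Let c : pathspace s0 := ray_code f.
Let kap m := cycle_index c m.
Let tm m := exit_time f (kap m).

Lemma ray_val_add k n : val (ray f (k + n)) =
  val (ray f k) ++ map fst (mkseq (shift k (ray_code f)) n).
Proof.
rewrite !(val_ray gf) /mkseq iotaD map_cat map_cat; congr (_ ++ _).
by rewrite add0n -[X in iota X n](addn0 k) iotaDl -!map_comp.
Qed.

Lemma label_ray_cycle m : dc_label (ray f (kap m)) = i0.
Proof.
elim: m => [|m IHm].
  by rewrite /kap /cycle_index big_ord0 (ray0 gf).
have E := cycle_last (cyc m); rewrite cycle0_iter in E.
rewrite /kap cycle_indexS /dc_label ray_val_add last_cat -/(dc_label _).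
by rewrite -/(kap m) IHm; exact: E.
Qed.

Lemma time_cycle m : (tm m)%:R = (tm 0)%:R +
  \sum_(i < m) word_time R (cycle0 (iter i (theta (a := i0)) c)).
Proof.
elim: m => [|m IHm]; first by rewrite big_ord0 addr0.
rewrite big_ord_recr /= addrA -IHm /tm /kap cycle_indexS (exit_time_sum gf) natrD.
by rewrite cycle0_iter.
Qed.

Lemma height_cycle m : green_height (f (tm m)) =
  \sum_(i < m) ysum i0 (map fst (cycle0 (iter i (theta (a := i0)) c))).
Proof.
elim: m => [|m IHm].
  rewrite big_ord0 /tm /kap /cycle_index big_ord0 -/(ray f 0) (ray0 gf).
  by rewrite /green_height.
rewrite big_ord_recr /= -IHm /tm /kap cycle_indexS -!/(ray f _).
rewrite /green_height ray_val_add ysum_cat -/(dc_label _) label_ray_cycle.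
by rewrite cycle0_iter.
Qed.

Lemma tm_lt m : (tm m < tm m.+1)%N.
Proof.
have E k n : (exit_time f k < exit_time f (k + n.+1))%N.
  elim: n => [|n IHn]; first by rewrite addn1; exact: (exit_time_lt gf).
  by apply: ltn_trans IHn _; rewrite [X in (_ < exit_time f X)%N]addnS; exact: (exit_time_lt gf).
rewrite /tm /kap cycle_indexS -(prednK (ret_time_gt0 _)); exact: E.
Qed.

Lemma drift_along_path (c1 c2 : R) : 0 < c1 ->
  (fun n : nat => n%:R^-1 * \sum_(i < n) word_time R (cycle0 (iter i (theta (a := i0)) c)))
     @ \oo --> c1 ->
  (fun n : nat => n%:R^-1 * \sum_(i < n) ysum i0 (map fst (cycle0 (iter i (theta (a := i0)) c))))
     @ \oo --> c2 ->
  (fun n : nat => n%:R^-1 * green_height (f n)) @ \oo --> c2 / c1.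
Proof.
move=> c10 h1 h2.
apply: (@cvg_along_times R tm (fun n => green_height (f n)) lgt_bound c1 c2) => //.
- exact: tm_lt.
- move=> n; apply: green_height_step; apply: ptree_step.
  by case: gf => -[_ +] _; exact.
- have inv0 : (fun m : nat => m%:R^-1 : R) @ \oo --> (0 : R).
    by rewrite -cvg_shiftS; exact: cvg_harmonic.
  have t0 : (fun m : nat => m%:R^-1 * (tm 0)%:R : R) @ \oo --> (0 * (tm 0)%:R : R).
    exact: cvgMr_tmp.
  under eq_fun do rewrite time_cycle mulrDr.
  by have := cvgD t0 h1; rewrite mul0r add0r; exact.
- by under eq_fun do rewrite height_cycle.
Qed.

End GoodPath.

Theorem ae_drift : exists hh : R, {ae P root, forall w,
  (fun n : nat => n%:R^-1 * green_height (X n w)) @ \oo --> hh}.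
Proof.
pose F1 (v : seq (G * nat)) := word_time R v; pose Fy (v : seq (G * nat)) := ysum i0 (map fst v).
(* The law for cycles needs nonnegative functionals; adding this multiple of the duration makes the
   height increment nonnegative, and the multiple is subtracted from the limit at the end. *)
pose F2 v := Fy v + lgt_bound * F1 v.
have sizeF1 v : (size v)%:R <= F1 v.
  rewrite ler_nat; elim: v => [|x v IHv]; rewrite ?big_nil// big_cons /=.
  by rewrite -addn1 addnC leq_add.
have F1_0 v : 0 <= F1 v by exact: word_time_ge0.
have Fyle v : `|Fy v| <= lgt_bound * F1 v.
  apply: le_trans (ysum_le _ _) _; rewrite size_map; exact: ler_wpM2l.
have F2_0 v : 0 <= F2 v.
  by have := Fyle v; rewrite /F2 ler_norml => /andP[]; lra.
have law1 := code_law_cyl Gconn hpG hpb eps0 eps_pb C0 r0 r1 decay.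
have cyt := cycle_total.
have [c1 [c1E L1]] := cycle_strong_law wgt0 law1 cyt F1_0 cycle_time_lty.
have F2fin : (\esum_(v in [set v | is_cycle i0 v]) (F2 v * word_weight wgt i0 v)%:E < +oo)%E.
  apply: (@le_lt_trans _ _ (\esum_(v in [set v | is_cycle i0 v])
      ((2 * lgt_bound)%:E * (F1 v * word_weight wgt i0 v)%:E))%E).
    apply: le_esum => v _; rewrite -EFinM lee_fin mulrA ler_wpM2r ?word_weight_ge0//.
    by have := Fyle v; rewrite /F2 ler_norml => /andP[]; lra.
  rewrite esumZl ?mulr_ge0// => [|v _]; last by rewrite lee_fin mulr_ge0// word_weight_ge0.
  by rewrite c1E -EFinM ltry.
have [c2 [c2E L2]] := cycle_strong_law wgt0 law1 cyt F2_0 F2fin.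
(* A cycle has at least one letter and each letter lasts at least one unit of time, so the limit can
   be divided by [c1]. *)
have c10 : 1 <= c1.
  rewrite -lee_fin -c1E -cyt; apply: le_esum => v cv.
  rewrite lee_fin ler_peMl ?word_weight_ge0//; apply: le_trans (sizeF1 v).
  by case: v cv => // x v _; rewrite ler1n.
have AC := ae_all_cycles wgt0 law1 cyt.
exists ((c2 - lgt_bound * c1) / c1).
have [N [mN N0 sub]] : {ae Q, forall c : pathspace s0,
   [/\ forall m, is_cycle i0 (cycle0 (iter m (theta (a := i0)) c)),
    (fun n : nat => n%:R^-1 * \sum_(i < n) F1 (cycle0 (iter i (theta (a := i0)) c))) @ \oo --> c1 &
    (fun n : nat => n%:R^-1 * \sum_(i < n) F2 (cycle0 (iter i (theta (a := i0)) c))) @ \oo --> c2]}.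
  by move: AC L1 L2; apply: filterS3 => c h1 h2 h3; split.
(* [Q] is the image of [P root] under [code], so a null set of codes pulls back to a null set of
   paths; on good paths [code] is the true [ray_code]. *)
have A1 : {ae P root, forall w, ~ N (code pG pb X w)}.
  exists (code pG pb X @^-1` N); split => [||w /= /contrapT//]; last exact: N0.
  by rewrite -[X in measurable X]setTI; exact: (measurable_code hX).
have mg : measurable good_ by exact: measurable_good.
have A2 : {ae P root, forall w, good_ (path_of root X w)}.
  exists (path_of root X @^-1` (~` good_)); split => //.
    rewrite -[X in measurable X]setTI; apply: (measurable_path_of hX measurableT).
    exact: measurableC.
  rewrite -(path_lawE hX) -/PT; have := PT_good eps0 eps_pb C0 r0 r1 decay (measurableC mg).
  by rewrite setICl measure0.
move: A1 A2; apply: filterS2 => w nN gw.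
have [cyc l1 l2] : [/\ forall m, is_cycle i0 (cycle0 (iter m (theta (a := i0)) (code pG pb X w))),
    (fun n : nat => n%:R^-1 * \sum_(i < n) F1 (cycle0 (iter i (theta (a := i0)) (code pG pb X w)))) @ \oo --> c1 &
    (fun n : nat => n%:R^-1 * \sum_(i < n) F2 (cycle0 (iter i (theta (a := i0)) (code pG pb X w)))) @ \oo --> c2].
  by apply: contrapT => h; apply: nN; apply: sub.
rewrite /code (safe_codeE gw) in cyc l1 l2.
apply: (drift_along_path gw cyc (lt_le_trans ltr01 c10) l1).
have l1' : (fun n : nat => lgt_bound * (n%:R^-1 * \sum_(i < n)
    F1 (cycle0 (iter i (theta (a := i0)) (ray_code (path_of root X w)))))) @ \oo -->
    lgt_bound * c1 by exact: cvgMl_tmp.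
have E n : n%:R^-1 * \sum_(i < n) ysum i0 (map fst
      (cycle0 (iter i (theta (a := i0)) (ray_code (path_of root X w))))) =
    n%:R^-1 * \sum_(i < n) F2 (cycle0 (iter i (theta (a := i0)) (ray_code (path_of root X w)))) -
    lgt_bound * (n%:R^-1 * \sum_(i < n)
    F1 (cycle0 (iter i (theta (a := i0)) (ray_code (path_of root X w))))).
  rewrite mulrCA -mulrBr; congr (_ * _); rewrite mulr_sumr -sumrB.
  by apply: eq_bigr => i _; rewrite /F2 /Fy addrK.
under eq_fun do rewrite E.
exact: cvgB l2 l1'.
Qed.

End Drift.

(** * The Green function *)

Section GreenFunction.
Context (R : realType) (G : countType) (edge : rel G) (i0 : G).
Context (pG : G -> G -> R) (pb : G -> R).
Context (d : measure_display) (W : measurableType d).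
Let T := dcover edge i0.
Context (P : T -> probability W R) (X : nat -> W -> T).
Hypothesis Gconn : strongly_connected edge.
Hypothesis hpG : graph_transitions edge pG.
Hypothesis hpb : backward_probabilities pb.
Hypothesis hX : markov_family (ptree pG pb) P X.
Variable eps : R.
Hypothesis eps0 : 0 < eps.
Hypothesis eps_pb : forall i, eps <= pb i.
Hypothesis eps_pfwd : forall i j, edge i j -> eps <= pfwd pG pb i j.
Let root : T := dc_root.
Let PT := path_law root hX.
Let path_ := pathspace root.
Variables (C r : R).
Hypotheses (C0 : 0 < C) (r0 : 0 < r) (r1 : r < 1).
Hypothesis decay : forall n, (PT root [set f | f n = root] <= (C * r ^+ n)%:E)%E.
Let s0 : G * nat := (i0, 0%N).
Let good_ : set path_ := good pG pb.
Let Gb i := Gbar P X i.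
Let gl_ := gl hX.
Let el_ := el hX.
Let wgt := step_weight hX.
Let goo := Goo hX.
Let Y : T -> R := @green_height R G edge i0 pG pb d W P X.

(** By strong connectivity some word with bubbles of length 0 leads from [i] to [i0]; following it
    and then escaping from a vertex of label [i0] has positive probability and is an escape from the
    starting vertex. *)
Lemma el_gt0 i : 0 < el_ i.
Proof.
have [s es ls] := Gconn i i0.
pose v := map (fun j => (j, 0%N)) s.
have we : 0 < wt hX i v * el_ (last_label i v).
  have -> : last_label i v = i0 by rewrite /last_label /v -map_comp map_id.
  rewrite mulr_gt0//; last exact: (el_i0_gt0 Gconn hpG hpb eps0 eps_pb C0 r0 r1 decay).
  rewrite /v; elim: s {ls v} i es => [|j s IHs] i //= /andP[ij es].
  by rewrite mulr_gt0 ?IHs// (gl0 hX) mulr1 (pfwd_gt0 hpG hpb).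
have lv := label_sv i0 Gconn hpG i.
have := follows_law Gconn hpG hpb hX (some_vertex edge i0 i) v.
rewrite wt_el// lv -wtE => fl.
rewrite /el_ /el -lte_fin -esE.
apply: (@lt_le_trans _ _ (PT (some_vertex edge i0 i) (follows (some_vertex edge i0 i) v))).
  by rewrite /PT fl lte_fin.
apply: le_path_law.
- exact: measurable_follows.
- exact: measurable_last_exit.
- by move=> f; exact: follows_last_exit.
Qed.

Fixpoint label_weight (i : G) (s : seq G) : R :=
  if s is j :: s' then pfwd pG pb i j * Gb j * label_weight j s' else 1.

Lemma label_weight_exp i s : path edge i s ->
  label_weight i s = expR (- ysum pG pb P X i s).
Proof.
elim: s i => [|j s IHs] i /=; first by rewrite oppr0 expR0.
move=> /andP[ij es]; rewrite opprD expRD opprK lnK ?IHs//.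
rewrite posrE mulr_gt0 ?(pfwd_gt0 hpG hpb)//.
exact: lt_le_trans ltr01 (Gbar_ge1 Gconn hpG eps0 eps_pb eps_pfwd r0 r1 decay j).
Qed.

Lemma word_weight_labels i s :
  (\esum_(v in [set v : seq (G * nat) | map fst v = s]) (word_weight wgt i v)%:E =
   (label_weight i s)%:E)%E.
Proof.
have w0 i' v : 0 <= word_weight wgt i' v.
  by apply: word_weight_ge0 => *; exact: step_weight_ge0.
elim: s i => [|j s IHs] i.
  have -> : [set v : seq (G * nat) | map fst v = [::]] = [set [::]].
    by apply/seteqP; split => [[]|_ ->].
  by rewrite esum_set1.
pose A : set (nat * seq (G * nat)) :=
  [set: nat] `*`` (fun=> [set v : seq (G * nat) | map fst v = s]).
have -> : [set v : seq (G * nat) | map fst v = j :: s] =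
    (fun x => (j, x.1) :: x.2) @` A.
  apply/seteqP; split => [[//|[j' t] v] [-> vs]|_ [[t v] [_ /= <-] <-]//].
  by exists (t, v).
rewrite esum_image; last by move=> [t v] [t' v'] _ _ [-> ->].
rewrite /A -(@esum_esum R _ _ [set: nat] (fun=> [set v : seq (G * nat) | map fst v = s])
  (fun t v => (word_weight wgt i ((j, t) :: v))%:E)); last by move=> t v _ _; rewrite lee_fin.
transitivity (\esum_(t in [set: nat]) ((wgt i j t)%:E * (label_weight j s)%:E))%E.
  apply: eq_esum => t _; rewrite -IHs -esumZl//; last by move=> v _; rewrite lee_fin.
  exact: step_weight_ge0.
rewrite esumZr.
- by rewrite (wgt_sum Gconn hpG hpb eps0 eps_pb eps_pfwd r0 r1 decay) -EFinM.
- by rewrite -IHs; apply: esum_ge0 => v _; rewrite lee_fin.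
- by move=> t; rewrite lee_fin; exact: step_weight_ge0.
Qed.

(** The probability that the ray passes through [x] is computed twice: by the time of the last exit
    from [x] it is G(o,x) times the escape probability, and by the law of the code, summed over all
    bubble lengths, it is [goo] times the label weight times the same escape probability. The
    positive common factor cancels. *)
Lemma green_functionE x :
  (\sum_(n <oo) PT root [set f | f n = x] = (goo * expR (- Y x))%:E)%E.
Proof.
pose k := hgt x; pose i := dc_label x.
pose D n := [set f : path_ | f n = x] `&` shift n @^-1` last_exit x.
have mD n : measurable (D n).
  apply: measurableI; first exact: (@measurable_at T root n [set x]).
  exact: (@shift_measurable T root n _ (@measurable_last_exit G edge i0 x)).
have mU : measurable (\bigcup_n D n) by exact: bigcupT_measurable.
have ED n : PT root (D n) = (PT root [set f | f n = x] * (el_ i)%:E)%E.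
  have lT : local_at n (setT : set (nat -> T)) by [].
  have mL := @measurable_last_exit G edge i0 x.
  have := path_law_markov hX root x lT mL; rewrite !setTI => ->.
  by rewrite -/PT esE es_el.
have tD : trivIset setT D.
  apply/trivIsetP => m n _ _ mn; apply/seteqP; split => // f [[fm vm] [fn vn]].
  by move/eqP: mn; apply; apply: (@exit_at_inj _ _ _ f); rewrite /exit_at ?fm ?fn.
have E1 : PT root (\bigcup_n D n) = ((\sum_(n <oo) PT root [set f | f n = x]) * (el_ i)%:E)%E.
  rewrite measure_semi_bigcup//; under eq_eseriesr do rewrite ED muleC.
  by rewrite nneseriesZl// muleC.
pose A := [set v : seq (G * nat) | map fst v = val x].
pose B : set (pathspace s0) := (fun c : pathspace s0 => mkseq c k) @^-1` A.
have mF : dmeas (fun c : pathspace s0 => mkseq c k).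
  exact: (dmeas_mkseq (f := fun k (f : pathspace s0) => f k)) (@dmeas_coord _ s0).
have E2 : PT root (\bigcup_n D n) = code_law hX B.
  rewrite (code_lawE eps0 eps_pb C0 r0 r1 decay); last exact: (mF A).
  rewrite -(PT_good eps0 eps_pb C0 r0 r1 decay mU); congr (PT root _).
  apply/seteqP; split => f.
    move=> [[n _ [fn fl]] gf]; split => //; rewrite /B /A /preimage /= safe_codeE//.
    rewrite -(val_ray gf) /ray; congr val; rewrite -fn; congr f.
    by apply: (exit_time_eq gf); rewrite /exit_at fn.
  rewrite /B /A /preimage /= => -[gf]; rewrite safe_codeE// -(val_ray gf) => /val_inj rx.
  split => //; have [ef _] := exit_timeP gf k.
  by exists (exit_time f k) => //; split => //; move: ef; rewrite /exit_at -/(ray f k) rx.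
have E3 : code_law hX B = (goo * (label_weight i0 (val x) * el_ i))%:E.
  rewrite -[B]setTI measure_fibers//.
  transitivity (\esum_(v in A) ((goo * el_ i)%:E * (word_weight wgt i0 v)%:E))%E.
    apply: eq_esum => v vx; rewrite setTI.
    have sv : size v = k by rewrite /k /hgt -vx size_map.
    have -> : [set c : pathspace s0 | mkseq c k = v] = starts_with v by rewrite /starts_with sv.
    transitivity (code_law hX (starts_with v)); first by [].
    rewrite (code_law_starts Gconn hpG hpb eps0 eps_pb C0 r0 r1 decay) -EFinM.
    have -> : last_label i0 v = i by rewrite /last_label vx.
    by congr EFin; rewrite -/goo -/wgt -/el_; ring.
  rewrite esumZl; first by rewrite word_weight_labels -EFinM; congr EFin; ring.
  - by rewrite mulr_ge0 ?el_ge0// ltW//; exact: (Goo_gt0 Gconn hpG hpb eps0 eps_pb C0 r0 r1 decay).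
  - by move=> v _; rewrite lee_fin word_weight_ge0// => *; exact: step_weight_ge0.
have ei : 0 < el_ i by exact: el_gt0.
have : ((\sum_(n <oo) PT root [set f | f n = x]) * (el_ i)%:E =
   (goo * expR (- Y x))%:E * (el_ i)%:E)%E.
  rewrite -E1 E2 E3 (label_weight_exp (valP x)) -EFinM; congr EFin.
  by rewrite /Y /green_height; ring.
move=> /(congr1 (mule^~ ((el_ i)^-1)%:E)).
by rewrite -!muleA -EFinM divff ?gt_eqF// !mule1.
Qed.

Lemma step_law_fin n x : PT root [set f | f n = x] \is a fin_num.
Proof. by apply: path_law_fin; exact: (@measurable_at T root n [set x]). Qed.

Lemma step_law_le_green n x :
  fine (PT root [set f | f n = x]) <= goo * expR (- Y x).
Proof.
rewrite -lee_fin fineK ?step_law_fin//.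
have := @nneseries_lim_ge R (fun n => PT root [set f | f n = x]) xpredT 0%N n.+1
  (fun m _ _ => measure_ge0 _ _).
rewrite green_functionE; apply: le_trans.
rewrite big_nat_recr//= leeDr// sume_ge0// => m _; exact: measure_ge0.
Qed.

(* The part of the Green function of [x] beyond time [K * n] is at most
   [C * r ^ (K * n) / ((1 - r) * eps ^ hgt x)], while the Green function itself
   is at least [eps ^ hgt x]. *)
Lemma green_partial_sum : exists2 K, (0 < K)%N & forall n x,
  (0 < n)%N -> (hgt x <= n)%N ->
  goo * expR (- Y x) <= 2 * \sum_(m < K * n) fine (PT root [set f | f m = x]).
Proof.
have r1' : 0 < 1 - r by rewrite subr_gt0.
pose de := Num.min 1 ((1 - r) / (2 * C)).
have de0 : 0 < de by rewrite lt_min ltr01 divr_gt0// mulr_gt0.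
have de1 : de <= 1 by rewrite ge_min lexx.
have deC : de <= (1 - r) / (2 * C) by rewrite ge_min lexx orbT.
(* One factor [eps] compensates the denominator of [height_bound], the other supplies the lower
   bound of the Green function, and [de] absorbs [C / (1 - r)] and the 2; taking n-th powers
   suffices because [hgt x <= n]. *)
have [K K0 rK] : exists2 K, (0 < K)%N & r ^+ K <= eps ^+ 2 * de.
  have /cvgr0_norm_le : GRing.exp r @ \oo --> 0 by apply: cvg_expr; rewrite ger0_norm ?ltW.
  move=> /(_ (eps ^+ 2 * de)); rewrite mulr_gt0 ?exprn_gt0// => /(_ isT)[N _ hN].
  exists N.+1 => //; have := hN N.+1 (leqnSn N); apply: le_trans; exact: ler_norm.
exists K => // n x n0 xn.
have e1 : eps <= 1 by exact: (eps_le1 i0 hpb eps_pb).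
have tail : (\sum_((K * n)%N <= m <oo) PT root [set f | f m = x] <= (eps ^+ hgt x / 2)%:E)%E.
  rewrite -nneseries_addn; last by move=> m; exact: measure_ge0.
  apply: (@le_trans _ _ (\sum_(m <oo) ((C * r ^+ (K * n) / eps ^+ hgt x) * r ^+ m)%:E)%E).
    apply: lee_nneseries => [m _ _|m _]; first exact: measure_ge0.
    apply: (@le_trans _ _ (PT root [set f | hgt (f (m + K * n)%N) = hgt x])).
      apply: le_path_law.
      - exact: (@measurable_at T root _ [set x]).
      - exact: (@measurable_at T root _ [set y | hgt y = hgt x]).
      - by move=> f /= ->.
    apply: le_trans (height_bound eps0 eps_pb C0 r0 r1 decay _ _) _.
    by rewrite lee_fin addnC exprD le_eqVlt; apply/orP; left; apply/eqP; ring.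
  rewrite nneseries_geometric ?(ltW r0)// lee_fin.
  have eh : 0 < eps ^+ hgt x by rewrite exprn_gt0.
  have rr : r ^+ (K * n) <= eps ^+ hgt x * eps ^+ hgt x * de.
    rewrite exprM; apply: (@le_trans _ _ ((eps ^+ 2 * de) ^+ n)).
      by apply: lerXn2r; rewrite // nnegrE ?exprn_ge0 ?(ltW r0)// mulr_ge0 ?exprn_ge0 ?(ltW de0) ?(ltW eps0).
    rewrite exprMn; apply: ler_pM; rewrite ?exprn_ge0 ?(ltW de0) ?(ltW eps0)//.
      rewrite -exprM mulnC exprM expr2; apply: ler_pM; rewrite ?exprn_ge0 ?(ltW eps0)//;
      by apply: ler_wiXn2l => //; exact: ltW.
    by rewrite -[leRHS]expr1; apply: ler_wiXn2l => //; exact: ltW.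
  have h1 : C * r ^+ (K * n) <= C * (eps ^+ hgt x * eps ^+ hgt x * ((1 - r) / (2 * C))).
    rewrite ler_pM2l//; apply: le_trans rr _; rewrite ler_wpM2l//.
    by rewrite mulr_ge0 ?(ltW eh).
  have -> : eps ^+ hgt x / 2 =
      C * (eps ^+ hgt x * eps ^+ hgt x * ((1 - r) / (2 * C))) / eps ^+ hgt x * (1 - r)^-1.
    by field; rewrite !gt_eqF.
  by do 2 (apply: ler_wpM2r; first by rewrite invr_ge0 ltW).
have := green_functionE x.
rewrite (@nneseries_split _ _ 0%N (K * n)%N); last by move=> m _; exact: measure_ge0.
rewrite add0n => E.
have low : eps ^+ hgt x <= goo * expR (- Y x).
  rewrite -lee_fin; apply: le_trans (reach_up hX eps0 eps_pfwd x) _.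
  by rewrite -[leLHS]fineK ?step_law_fin// lee_fin; exact: step_law_le_green.
have S : (\sum_(0 <= m < K * n) PT root [set f | f m = x] =
    (\sum_(m < K * n) fine (PT root [set f | f m = x]))%:E)%E.
  by rewrite big_mkord -sumEFin; apply: eq_bigr => m _; rewrite fineK ?step_law_fin.
have : ((goo * expR (- Y x))%:E <=
   (\sum_(m < K * n) fine (PT root [set f | f m = x]) + eps ^+ hgt x / 2)%:E)%E.
  by rewrite -E S EFinD leeD2l.
by rewrite lee_fin; lra.
Qed.

End GreenFunction.

(** * Entropy *)

Lemma ln_div_cvg0 (R : realType) (a : R) : 0 < a ->
  (fun n : nat => n%:R^-1 * ln (a * n%:R)) @ \oo --> (0 : R).
Proof.
move=> a0; apply/cvgrPdist_le => e e0.
pose de := e / (2 * a); have de0 : 0 < de by rewrite divr_gt0// mulr_gt0.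
(* [ln y <= de * y - ln de], and [ln y >= ln a] for [y = a * n]. *)
have c0 : (fun n : nat => (`|ln de| + `|ln a|) * n%:R^-1) @ \oo --> (0 : R).
  rewrite -[X in _ --> X](mulr0 (`|ln de| + `|ln a|)); apply: cvgMl_tmp.
  by rewrite -(cvg_shiftS (fun n => n%:R^-1 : R)); exact: cvg_harmonic.
have e2 : 0 < e / 2 by rewrite divr_gt0.
have /cvgr0_norm_le/(_ _ e2)[N _ hN] := c0.
exists N.+1 => // n /= Nn; rewrite sub0r normrN.
have n0 : 0 < n%:R :> R by rewrite ltr0n; lia.
have := hN n (ltnW Nn); rewrite ger0_norm ?mulr_ge0 ?invr_ge0 ?addr_ge0// => hn.
have an0 : 0 < a * n%:R by rewrite mulr_gt0.
have up : ln (a * n%:R) <= de * (a * n%:R) - ln de.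
  have : ln (de * (a * n%:R)) < de * (a * n%:R) by apply: ln_sublinear; rewrite mulr_gt0.
  by rewrite (@lnM _ de (a * n%:R)) ?posrE// => /ltW; rewrite addrC -lerBrDr.
have lo : ln a <= ln (a * n%:R).
  rewrite ler_ln ?posrE// ler_peMr ?(ltW a0)// ler1n; lia.
have dE : n%:R^-1 * (de * (a * n%:R)) = e / 2.
  by rewrite /de; field; rewrite !gt_eqF.
have b1 : - (`|ln de| + `|ln a|) <= ln a by have := ler_norm (- ln a); have := normr_ge0 (ln de); rewrite normrN; lra.
have b2 : - ln de <= `|ln de| + `|ln a| by have := ler_norm (- ln de); have := normr_ge0 (ln a); rewrite normrN; lra.
have ni : 0 <= n%:R^-1 :> R by rewrite invr_ge0.
rewrite ler_norml; apply/andP; split.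
  have := ler_wpM2l ni (le_trans b1 lo); rewrite mulrN mulrC; lra.
have := ler_wpM2l ni up; rewrite mulrBr dE; have := ler_wpM2l ni b2; rewrite mulrN [X in _ <= X]mulrC; lra.
Qed.

Lemma limn_einf_le (R : realType) (u v : (\bar R)^nat) :
  (\forall n \near \oo, (u n <= v n)%E) -> (limn_einf u <= limn_einf v)%E.
Proof.
move=> [N _ uv]; rewrite !limn_einf_lim; apply: lee_lim; try exact: is_cvg_einfs.
exists N => // n /= Nn; apply: le_ereal_inf_tmp => _ [k /= nk <-].
apply: le_trans (uv k _); last exact: leq_trans nk.
by apply: ereal_inf_lbound; exists k.
Qed.

Lemma limn_einf_add_cvg (R : realType) (u v : R^nat) (h : R) :
  limn_einf (EFin \o u) = 0%E -> v @ \oo --> h ->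
  limn_einf (fun n => (u n + v n)%:E) = h%:E.
Proof.
move=> u0 vh.
have sh (e : R) : limn_einf (fun n => e%:E + (u n)%:E)%E = e%:E.
  by rewrite (@limn_einf_shift R (EFin \o u) e%:E)// u0 adde0.
have near_h (e : R) : 0 < e -> \forall n \near \oo, `|h - v n| <= e.
  by move=> e0; move/cvgrPdist_le : vh => /(_ e e0).
apply/eqP; rewrite eq_le; apply/andP; split; apply/lee_addgt0Pr => e e0.
  rewrite -EFinD -(sh (h + e)); apply: limn_einf_le.
  have := near_h e e0; apply: filterS => n; rewrite ler_norml -EFinD lee_fin => /andP[]; lra.
rewrite -leeBlDr// -EFinB -(sh (h - e)); apply: limn_einf_le.
have := near_h e e0; apply: filterS => n; rewrite ler_norml -EFinD lee_fin => /andP[]; lra.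
Qed.

Section Entropy.
Context (R : realType) (G : countType) (edge : rel G) (i0 : G).
Context (pG : G -> G -> R) (pb : G -> R).
Context (d : measure_display) (W : measurableType d).
Let T := dcover edge i0.
Context (P : T -> probability W R) (X : nat -> W -> T).
Hypothesis Gconn : strongly_connected edge.
Hypothesis hpG : graph_transitions edge pG.
Hypothesis hpb : backward_probabilities pb.
Hypothesis hX : markov_family (ptree pG pb) P X.
Variable eps : R.
Hypothesis eps0 : 0 < eps.
Hypothesis eps_pb : forall i, eps <= pb i.
Hypothesis eps_pfwd : forall i j, edge i j -> eps <= pfwd pG pb i j.
Hypothesis eps_p : forall x y : T, 0 < ptree pG pb x y -> eps <= ptree pG pb x y.
Let root : T := dc_root.
Let PT := path_law root hX.
Let path_ := pathspace root.
Variables (C r : R).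
Hypotheses (C0 : 0 < C) (r0 : 0 < r) (r1 : r < 1).
Hypothesis decay : forall n, (PT root [set f | f n = root] <= (C * r ^+ n)%:E)%E.
Let goo := Goo hX.
Let Y : T -> R := @green_height R G edge i0 pG pb d W P X.
Let pi := law P X root.

Let goo0 : 0 < goo.
Proof. exact: (Goo_gt0 Gconn hpG hpb eps0 eps_pb C0 r0 r1 decay). Qed.

Let e1 : eps <= 1. Proof. exact: (eps_le1 i0 hpb eps_pb). Qed.

Lemma dmeas_state n : dmeas (X n).
Proof. by apply: dmeas_fibers => u; case: hX => mX _ _; exact: mX. Qed.

Lemma lawPE n x : pi n x = fine (PT root [set f | f n = x]).
Proof. by rewrite /PT path_lawE. Qed.

Lemma law_ge0 n x : 0 <= pi n x.
Proof. exact/fine_ge0/measure_ge0. Qed.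

Lemma lawE n x : P root [set w | X n w = x] = (pi n x)%:E.
Proof. by rewrite fineK// fin_num_measure//; case: hX => mX _ _; exact: mX. Qed.

Lemma law_le1 n x : pi n x <= 1.
Proof. by rewrite -lee_fin -lawE; apply: probability_le1; case: hX => mX _ _; exact: mX. Qed.

Lemma law_sum n : (\esum_(x in setT) (pi n x)%:E = 1)%E.
Proof.
rewrite -(probability_setT (P root)) -[X in _ = P root X](setTI (X n @^-1` setT)).
rewrite (measure_fibers (P root) setT measurableT (dmeas_state n)).
by apply: eq_esum => x _; rewrite setTI; exact/esym/lawE.
Qed.

(** A vertex of positive probability is reached by some legal path in n steps, each of probability
    at least [eps]. The lower bound makes [ln (pi n x)] bounded for fixed n, hence integrable. *)
Lemma law_gt0 n x : 0 < pi n x -> (hgt x <= n)%N /\ eps ^+ n <= pi n x.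
Proof.
rewrite lawPE => pi0.
have mQ : measurable [set f : path_ | f n = x] by exact: (@measurable_at T root n [set x]).
have [f [fn [f0 fs]]] : [set f : path_ | f n = x] `&` legal (ptree pG pb) root !=set0.
  apply/set0P/negP => /eqP E; move: pi0.
  by rewrite /PT -(path_law_legal hX root mQ) E measure0 ltxx.
suff H k : (hgt (f k) <= k)%N /\ ((eps ^+ k)%:E <= PT root [set g | g k = f k])%E.
  have [h1 h2] := H n; rewrite -fn; split => //.
  by rewrite -lee_fin fineK// (step_law_fin hX).
elim: k => [|k [IH1 IH2]].
  rewrite f0; split => //; rewrite expr0 /PT path_lawE.
  by case: hX => _ /(_ root) <-.
have st := ptree_step (fs k).
split; first by have [] := step_hgt st; lia.
rewrite -addn1; apply: le_trans (path_law_Chapman root hX root (f k) (f (k + 1)%N) k 1).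
rewrite path_law_step exprD expr1 EFinM; apply: lee_pmul => //; rewrite ?lee_fin ?exprn_ge0 ?(ltW eps0)//.
rewrite addn1; apply: eps_p; rewrite lt_def fs/=; exact: ptree_ge0.
Qed.

(** The additive constant that makes [defect] nonnegative: comparison with the Green function gives
    only [- ln (pi n x) - Y x >= - ln goo]. *)
Let L : R := `|ln goo|.

(* [- ln (pi n x) / n] splits into [defect], nonnegative with vanishing mean
   along the walk, and [drift], which converges along almost every path. Both are
   set to zero off the support of the law. *)
Definition defect n x : R :=
  if 0 < pi n x then n%:R^-1 * (- ln (pi n x) - Y x + L) else 0.

Definition drift n x : R := if 0 < pi n x then n%:R^-1 * (Y x - L) else 0.

Lemma defect_drift n x : - (ln (pi n x) / n%:R) = defect n x + drift n x.
Proof.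
rewrite /defect /drift; case: ifPn => [_|]; first by rewrite mulrC; ring.
by rewrite -leNgt => p0; rewrite ln0// mul0r oppr0 addr0.
Qed.

Let green x : R := goo * expR (- Y x).

Let green_gt0 x : 0 < green x. Proof. by rewrite mulr_gt0 ?expR_gt0. Qed.

Let ln_green x : ln (green x) = ln goo - Y x.
Proof. by rewrite lnM ?posrE ?expR_gt0// expRK. Qed.

Lemma defect_ge0 n x : 0 <= defect n x.
Proof.
rewrite /defect; case: ifPn => // p0; rewrite mulr_ge0 ?invr_ge0//.
have : pi n x <= green x.
  by rewrite lawPE; exact: (step_law_le_green Gconn hpG hpb eps0 eps_pb eps_pfwd C0 r0 r1 decay).
rewrite -ler_ln ?posrE// ln_green; have := ler_norm (ln goo); rewrite /L; lra.
Qed.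

Lemma drift_le n x : `|drift n x| <= lgt_bound eps r + L.
Proof.
have K0 : 0 <= lgt_bound eps r.
  apply: le_trans (normr_ge0 _) (lgt_le Gconn hpG hpb eps0 eps_pb eps_pfwd r0 r1 decay i0 i0).
have L0 : 0 <= L by exact: normr_ge0.
rewrite /drift; case: ifPn => [p0|_]; last by rewrite normr0 addr_ge0.
(* At n = 0 the factor [0^-1] is 0. *)
case: n p0 => [|n] p0; first by rewrite invr0 mul0r normr0 addr_ge0.
have [hx _] := law_gt0 p0.
have Yx : `|Y x| <= lgt_bound eps r * n.+1%:R.
  apply: le_trans (ysum_le Gconn hpG hpb eps0 eps_pb eps_pfwd r0 r1 decay i0 (val x)) _.
  by rewrite ler_wpM2l// ler_nat.
rewrite normrM ger0_norm ?invr_ge0// ler_pdivrMl// mulrC.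
apply: le_trans (ler_normB _ _) _; rewrite mulrDl; apply: lerD => //.
by rewrite ger0_norm// ler_peMr// ler1n.
Qed.

Lemma ln_law_le n x : `|ln (pi n x)| <= n%:R * - ln eps.
Proof.
have le0 : 0 <= - ln eps by rewrite oppr_ge0 ln_le0.
have [p0|p0] := ltP 0 (pi n x); last by rewrite ln0// normr0 mulr_ge0.
have [_ ep] := law_gt0 p0.
rewrite ler0_norm ?ln_le0 ?law_le1// mulrN lerN2.
by rewrite mulr_natl -lnXn// ler_ln ?posrE// exprn_gt0.
Qed.

(** With [N = K * n], the inequality [ln t <= t] is applied to [t = green x / (2 * N * pi n x)]. The
    normalisation by [2 * N] makes the mean of [t] at most 1, because [pi n x * t] is bounded by the
    average of [pi m x] over [m < N], and it costs only [ln (2 * N)]. Without it the same inequality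
    would give a bound of order n. *)
Lemma defect_sum : exists2 a : R, 0 < a & forall n, (0 < n)%N ->
  (\esum_(x in setT) (defect n x * pi n x)%:E <=
   (n%:R^-1 * (1 + (L - ln goo)) + n%:R^-1 * ln (a * n%:R))%:E)%E.
Proof.
have [K K0 HK] := green_partial_sum Gconn hpG hpb eps0 eps_pb eps_pfwd C0 r0 r1 decay.
have K0' : 0 < K%:R :> R by rewrite ltr0n.
exists (2 * K%:R); first by rewrite mulr_gt0.
move=> n n0; pose N : R := (K * n)%:R.
have n0' : 0 < n%:R :> R by rewrite ltr0n.
have N0 : 0 < N by rewrite /N natrM mulr_gt0.
have N1 : 1 <= N by rewrite ler1n muln_gt0 K0.
have L0 : 0 <= L - ln goo by rewrite subr_ge0 ler_norm.
have lN : 0 <= ln (2 * N) by rewrite ln_ge0//; lra.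
pose c := L - ln goo + ln (2 * N).
have c0 : 0 <= c by rewrite addr_ge0.
have bound x : defect n x * pi n x <=
    n%:R^-1 * (N^-1 * (\sum_(m < K * n) pi m x) + c * pi n x).
  have S0 : 0 <= \sum_(m < K * n) pi m x by apply: sumr_ge0 => m _; exact: law_ge0.
  have ni : 0 <= n%:R^-1 :> R by rewrite invr_ge0.
  rewrite /defect; case: ifPn => [p0|_]; last first.
    rewrite mul0r mulr_ge0// addr_ge0// mulr_ge0 ?law_ge0// invr_ge0; exact: ltW.
  have [hx _] := law_gt0 p0.
  have := HK n x n0 hx; rewrite -/(green x) => gS.
  have {}gS : green x / (2 * N) <= N^-1 * (\sum_(m < K * n) pi m x).
    rewrite ler_pdivrMr ?mulr_gt0// mulrAC mulrCA mulVf ?gt_eqF// mulr1 mulrC.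
    by rewrite mulrC; under eq_bigr do rewrite lawPE.
  rewrite -mulrA ler_wpM2l//.
  have t0 : 0 < green x / (2 * N) / pi n x by rewrite !divr_gt0// mulr_gt0.
  have lt : ln (green x / (2 * N) / pi n x) <= green x / (2 * N) / pi n x.
    exact/ltW/ln_sublinear.
  have lE : ln (green x / (2 * N) / pi n x) = ln goo - Y x - ln (2 * N) - ln (pi n x).
    by rewrite !ln_div ?posrE ?divr_gt0 ?mulr_gt0 ?expR_gt0// ln_green.
  apply: (@le_trans _ _ ((green x / (2 * N) / pi n x + c) * pi n x)).
    by rewrite ler_wpM2r ?law_ge0// /c; lra.
  by rewrite mulrDl divfK ?gt_eqF// lerD2r.
apply: (@le_trans _ _ (\esum_(x in setT) (n%:R^-1%:E *
    (N^-1%:E * (\sum_(m < K * n) (pi m x)%:E) + c%:E * (pi n x)%:E)))%E).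
  by apply: le_esum => x _; rewrite sumEFin lee_fin; exact: bound.
have p0 m x : (0 <= (pi m x)%:E)%E by rewrite lee_fin law_ge0.
have s0 x : (0 <= \sum_(m < K * n) (pi m x)%:E)%E by exact: sume_ge0.
have a0 x : (0 <= N^-1%:E * (\sum_(m < K * n) (pi m x)%:E))%E.
  by rewrite mule_ge0// lee_fin invr_ge0 ltW.
have b0 x : (0 <= c%:E * (pi n x)%:E)%E by rewrite mule_ge0.
rewrite esumZl ?invr_ge0//; last by move=> x _; exact: adde_ge0.
rewrite esumD// !esumZl ?invr_ge0 ?(ltW N0)// law_sum esum_sum//.
under eq_bigr do rewrite law_sum.
rewrite sumEFin sumr_const card_ord mule1 lee_fin -/N.
have -> : N^-1 * N = 1 by rewrite mulVf// gt_eqF.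
by rewrite /c /N natrM mulrA -mulrDr addrA.
Qed.

Lemma integrable_state (F : T -> R) M n : (forall x, `|F x| <= M) ->
  (P root).-integrable setT (fun w => (F (X n w))%:E).
Proof.
move=> FM; apply: (@measurable_bounded_integrable _ _ R (P root) (F \o X n)) => //.
- exact: le_lt_trans (probability_le1 (P root) measurableT) (ltry 1).
- exact: (@dmeas_measurable_fun _ _ _ _ _ (X n) F (dmeas_state n)).
- exists M; split; first exact: num_real.
  by move=> N /ltW MN w _ /=; exact: le_trans (FM _) MN.
Qed.

Lemma law_gt0_ae : {ae P root, forall w n, 0 < pi n (X n w)}.
Proof.
apply/ae_foralln => n; pose A := [set x : T | ~ 0 < pi n x].
exists (X n @^-1` A); split => //; first exact: dmeas_state.
rewrite -[X n @^-1` A]setTI (measure_fibers (P root) A measurableT (dmeas_state n)).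
apply: esum1 => x /negP; rewrite -leNgt => p0.
have -> : setT `&` [set w | X n w = x] = [set w | X n w = x] by rewrite setTI.
transitivity (pi n x)%:E; first exact: lawE.
by congr EFin; apply/eqP; rewrite eq_le p0 law_ge0.
Qed.

Lemma defect_int n :
  (\int[P root]_w (defect n (X n w))%:E = \esum_(x in setT) (defect n x * pi n x)%:E)%E.
Proof.
rewrite (ge0_integral_discrete (P root) measurableT (dmeas_state n) (defect_ge0 n)).
apply: eq_esum => x _.
have -> : setT `&` [set w | X n w = x] = [set w | X n w = x] by rewrite setTI.
by rewrite EFinM; congr (_ * _)%E; exact: lawE.
Qed.

Lemma defect_int_cvg : (fun n => \int[P root]_w (defect n (X n w))%:E)%E @ \oo --> 0%E.
Proof.
have [a a0 ha] := defect_sum.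
have b0 : (fun n : nat => (n%:R^-1 * (1 + (L - ln goo)) + n%:R^-1 * ln (a * n%:R))%:E)
    @ \oo --> 0%E.
  apply: cvg_EFin; first by apply: nearW.
  rewrite -[X in _ --> X](addr0 0); apply: cvgD; last exact: ln_div_cvg0.
  rewrite -[X in _ --> X](mul0r (1 + (L - ln goo))); apply: cvgMr_tmp.
  by rewrite -(cvg_shiftS (fun n => n%:R^-1 : R)); exact: cvg_harmonic.
apply: (squeeze_cvge _ (cvg_cst 0%E) b0); exists 1%N => // n n0.
rewrite integral_ge0/= => [|w _]; last by rewrite lee_fin defect_ge0.
by rewrite defect_int; exact: ha.
Qed.

Lemma defect_einf : {ae P root, forall w,
  limn_einf (fun n => (defect n (X n w))%:E) = 0%E}.
Proof.
pose f n w := (defect n (X n w))%:E.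
have mf n : measurable_fun setT (f n).
  exact: (@dmeas_measurable_fun _ _ _ _ _ (X n) (EFin \o defect n) (dmeas_state n)).
have f0 n w : (0 <= f n w)%E by rewrite lee_fin defect_ge0.
have l0 w : (0 <= limn_einf (f ^~ w))%E.
  have [<- _] := @cvg_limn_einf_sup R (fun=> 0%E) 0%E (cvg_cst _).
  by apply: limn_einf_le; apply: nearW => n; exact: f0.
have ml : measurable_fun setT (fun w => limn_einf (f ^~ w)).
  rewrite /limn_einf; apply: measurableT_comp => //.
  by apply: measurable_fun_limn_esup => n; exact: measurableT_comp.
have : (\int[P root]_w `|limn_einf (f ^~ w)| = 0)%E.
  apply/eqP; rewrite eq_le; apply/andP; split; last exact: integral_ge0.
  under eq_integral do rewrite gee0_abs//.
  apply: le_trans (fatou (P root) measurableT mf (fun n w _ => f0 n w)) _.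
  by have [-> _] := cvg_limn_einf_sup defect_int_cvg.
move/(ae_eq_integral_abs (P root) measurableT ml); apply: filterS => w; exact.
Qed.

(** [drift] is bounded uniformly, so its almost sure limit is also the limit of its means, by
    dominated convergence; [defect] adds 0 to the limit of the means and 0 to the pathwise
    liminf. *)
Theorem entropy_liminf (h : R) :
  {ae P root, forall w, (fun n : nat => n%:R^-1 * Y (X n w)) @ \oo --> h} ->
  (fun n : nat => (- (n%:R^-1)%:E * 'E_(P root)[fun w => ln (pi n (X n w))])%E)
    @ \oo --> h%:E /\
  {ae P root, forall w,
    limn_einf (fun n : nat => (- (ln (pi n (X n w)) / n%:R))%:E) = h%:E}.
Proof.
move=> Yh.
have Dh : {ae P root, forall w, (fun n : nat => drift n (X n w)) @ \oo --> h}.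
  move: law_gt0_ae Yh; apply: filterS2 => w pos Yw.
  have E n : drift n (X n w) = n%:R^-1 * Y (X n w) - L * n%:R^-1.
    by rewrite /drift pos mulrBr (mulrC L).
  under eq_fun do rewrite E.
  rewrite -(subr0 h); apply: cvgB => //.
  rewrite -[X in _ --> X](mulr0 L); apply: cvgMl_tmp.
  by rewrite -(cvg_shiftS (fun n => n%:R^-1 : R)); exact: cvg_harmonic.
split; last first.
  move: Dh defect_einf; apply: filterS2 => w dw ew.
  under eq_fun do rewrite defect_drift.
  exact: limn_einf_add_cvg.
have mdrift n : measurable_fun setT (fun w => (drift n (X n w))%:E).
  exact: (@dmeas_measurable_fun _ _ _ _ _ (X n) (EFin \o drift n) (dmeas_state n)).
have idrift n : (P root).-integrable setT (fun w => (drift n (X n w))%:E).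
  exact: integrable_state (drift_le n).
have idefect n : (P root).-integrable setT (fun w => (defect n (X n w))%:E).
  apply: (@integrable_state (defect n) (n%:R^-1 * (n%:R * - ln eps) + (lgt_bound eps r + L))).
  move=> x; have -> : defect n x = - (ln (pi n x) / n%:R) - drift n x.
    by rewrite defect_drift addrK.
  apply: le_trans (ler_normB _ _) _; apply: lerD; last exact: drift_le.
  rewrite normrN normrM mulrC ger0_norm ?invr_ge0//; apply: ler_wpM2l; last exact: ln_law_le.
  by rewrite invr_ge0.
have cvdrift : (fun n => \int[P root]_w (drift n (X n w))%:E)%E @ \oo --> h%:E.
  have [] := @dominated_convergence _ W R (P root) setT measurableT
    (fun n w => (drift n (X n w))%:E) (cst h%:E) (cst (lgt_bound eps r + L)%:E).
  - exact: mdrift.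
  - exact: measurable_cst.
  - by move: Dh; apply: filterS => w hw _; apply: cvg_EFin => //; exact: nearW.
  - exact: finite_measure_integrable_cst.
  - by apply: aeW => w n _; rewrite abse_EFin lee_fin drift_le.
  by move=> _ _; rewrite -[h%:E in X in _ -> X](expectation_cst (P root)) unlock.
have E n : (- (n%:R^-1)%:E * 'E_(P root)[fun w => ln (pi n (X n w))] =
    \int[P root]_w (defect n (X n w))%:E + \int[P root]_w (drift n (X n w))%:E)%E.
  rewrite unlock -EFinN -integralZl//; last first.
    exact: (@integrable_state (fun x => ln (pi n x)) _ n (ln_law_le n)).
  rewrite -integralD//; apply: eq_integral => w _.
  by rewrite -EFinM -EFinD -defect_drift; congr EFin; ring.
under eq_fun do rewrite E.
rewrite -(add0e h%:E); apply: cvgeD => //; exact: defect_int_cvg.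
Qed.

End Entropy.

Theorem corollary3p10 (R : realType) (G : countType) (edge : rel G) (i0 : G)
    (pG : G -> G -> R) (pb : G -> R)
    (d : measure_display) (W : measurableType d)
    (P : dcover edge i0 -> probability W R) (X : nat -> W -> dcover edge i0)
    (Gconn : strongly_connected edge)
    (Gbnd : bounded_geometry edge)
    (hpG : graph_transitions edge pG)
    (hpb : backward_probabilities pb)
    (hX : markov_family (ptree pG pb) P X)
    (Xtrans : transient P X)
    (pbnd : exists eps0 : R, 0 < eps0 /\
       forall x y : dcover edge i0,
         0 < ptree pG pb x y -> eps0 <= ptree pG pb x y)
    (Qpos : positive_recurrent (Qmat pG pb P X))
    (rho1 : (spectral_radius P X dc_root < 1)%E) :
  let pi := law P X dc_root in
  exists h : R,
    (fun n : nat =>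
       (- (n%:R^-1)%:E * 'E_(P dc_root)[fun w => ln (pi n (X n w))])%E)
      @ \oo --> h%:E /\
    {ae P dc_root, forall w,
       limn_einf (fun n : nat => (- (ln (pi n (X n w)) / n%:R))%:E) = h%:E}.
Proof.
move=> pi; have [eps [eps0 eps_p]] := pbnd.
have [C [r [C0 r0 r1 decay]]] := spectral_bound hX rho1.
(* The bound on the transitions of the tree passes to the labels, since every label occurs at a
   non-root vertex, where the backward step is available. *)
have eps_pb i : eps <= pb i.
  have [/eqP x0 <-] := some_vertexP i0 Gconn hpG i.
  rewrite -(ptree_anc pG pb x0); apply: eps_p.
  by rewrite (ptree_anc pG pb x0); case: hpb => /(_ (dc_label (some_vertex edge i0 i)))/andP[].
have eps_pfwd i j : edge i j -> eps <= pfwd pG pb i j.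
  have [_ xi] := some_vertexP i0 Gconn hpG i; rewrite -xi => ij.
  rewrite -(ptree_chd pG pb ij); apply: eps_p.
  by rewrite (ptree_chd pG pb ij) (pfwd_gt0 hpG hpb).
have [h Yh] := ae_drift Gconn hpG hpb eps0 eps_pb eps_pfwd C0 r0 r1 decay Qpos.
exists h; exact: (entropy_liminf Gconn hpG hpb eps0 eps_pb eps_pfwd eps_p C0 r0 r1 decay Yh).
Qed.
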